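(* Assume [ID], [PEN](ii)(iii), [CRIT], [LOC], [VPHI] and [VLQA]. Then: (1) $n(\phi(\widehat\alpha_n)-\phi(\alpha_0))'\Omega_{sd,n}^{-1}(\phi(\widehat\alpha_n)-\phi(\alpha_0))=n\mathbf Z_n'\Omega_{sd,n}^{-1}\mathbf Z_n+o_P(\sqrt{d(n)})$; (2) for a fixed $d(n)=d$, if $\sqrt n\,\Omega_{sd,n}^{-1/2}\mathbf Z_n\Rightarrow N(0,I_d)$, then $n(\phi(\widehat\alpha_n)-\phi(\alpha_0))'\Omega_{sd,n}^{-1}(\phi(\widehat\alpha_n)-\phi(\alpha_0))\Rightarrow\chi_d^2$; (3) if $d(n)\to\infty$ and $d(n)=o(\sqrt n\,\mu_{3,n}^{-1})$, then $$\frac{n(\phi(\widehat\alpha_n)-\phi(\alpha_0))'\Omega_{sd,n}^{-1}(\phi(\widehat\alpha_n)-\phi(\alpha_0))-d(n)}{\sqrt{2d(n)}}\Rightarrow N(0,1).$$ (All objects and the bracketed conditions are defined in the context.)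
   Context: MODEL. $Z=(Y',X')'$; $Z_1,Z_2,\dots$ are i.i.d. copies, $Z_i=(Y_i',X_i')'$, $Z^n=(Z_1,\dots,Z_n)$; $o_P,O_P$ refer to the law $P_{Z^\infty}$ of the sequence; $\mathcal X$ is the support of $X$; $\|\cdot\|_e$ is the Euclidean norm; $a_n\asymp b_n$ means $c_1a_n\le b_n\le c_2a_n$ for constants $0<c_1\le c_2<\infty$. $\mathcal A=\Theta\times\mathcal H$ with $\Theta\subset\mathbb R^{d_\theta}$ and $\mathcal H$ a space of functions with norm $\|\cdot\|_{\mathbf H}$; for $\alpha=(\theta',h)$, $\|\alpha\|_s=\|\theta\|_e+\|h\|_{\mathbf H}$. $\rho(Z;\alpha)\in\mathbb R^{d_\rho}$ is a known function, $m(X,\alpha)=E[\rho(Z;\alpha)|X]$, and $\alpha_0=(\theta_0',h_0)\in\mathrm{int}(\Theta)\times\mathcal H$ satisfies $m(X,\alpha_0)=0$ a.s. $\Sigma(X)$ is a positive definite weighting matrix, $\Sigma_0(X)=\mathrm{Var}(\rho(Z;\alpha_0)|X)$, $Q(\alpha)=E[m(X,\alpha)'\Sigma(X)^{-1}m(X,\alpha)]$. ESTIMATOR. $\widehat m(x,\alpha)=\sum_{i=1}^n\rho(Z_i,\alpha)A_n(X_i,x)$ is a consistent estimator of $m$ ($A_n(X_i,x)$ a known measurable function of $X_1,\dots,X_n$), $\widehat\Sigma$ is a consistent estimator of $\Sigma$, $\widehat Q_n(\alpha)=\frac1n\sum_{i=1}^n\widehat m(X_i,\alpha)'\widehat\Sigma(X_i)^{-1}\widehat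 m(X_i,\alpha)$. Sieve: $\mathcal A_{k(n)}=\Theta\times\mathcal H_{k(n)}$, $\mathcal H_{k(n)}=\{h\in\mathcal H:h=\sum_{k\le k(n)}\beta_kq_k\}$ for known basis functions $q_k$, $k(n)\to\infty$. $Pen\ge0$ is a penalty on $\mathcal H$, $\lambda_n=o(1)$. The PSMD (penalized sieve minimum distance) estimator $\widehat\alpha_n\in\mathcal A_{k(n)}$ minimizes $\widehat Q_n(\alpha)+\lambda_nPen(h)$ over $\mathcal A_{k(n)}$ up to $o_P(n^{-1})$. LOCAL OBJECTS. $\dot m(X)[v]=\partial_\tau m(X,\alpha_0+\tau v)|_{\tau=0}$ (pathwise derivative). $\langle v_1,v_2\rangle=E[\dot m(X)[v_1]'\Sigma(X)^{-1}\dot m(X)[v_2]]$, $\|v\|^2=\langle v,v\rangle$. $\mathcal A_{os}$ is a convex $\|\cdot\|_s$-neighbourhood of $\alpha_0$ contained in $\{\alpha\in\mathcal A:\|\alpha-\alpha_0\|_s<M_0,\ \lambda_nPen(h)<\lambda_nM_0\}$; $\mathcal A_{osn}=\mathcal A_{os}\cap\mathcal A_{k(n)}$. $\Pi_n\alpha_0=(\theta_0',\Pi_nh_0)$ with $\Pi_nh_0$ as in [ID](ii). $\tau_n=\sup\{\|\alpha-\Pi_n\alpha_0\|_s/\|\alpha-\Pi_n\alpha_0\|:\alpha\in\mathcal A_{osn},\|\alpha-\Pi_n\alpha_0\|\ne0\}$. $\bar\delta_{m,n}\downarrow0$ and $\delta_n=o(1)$, $\delta_n\le\bar\delta_{m,n}$,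 are positive sequences; $\delta_{s,n}=\|h_0-\Pi_nh_0\|_s+\tau_n\delta_n=o(1)$; $M_n=\min\{\log\log(n+1),\log(\delta_{s,n}^{-1}+1)\}$. $\mathcal N_{os}=\{\alpha\in\mathcal A:\|\alpha-\alpha_0\|\le M_n\delta_n,\|\alpha-\alpha_0\|_s\le M_n\delta_{s,n},\lambda_nPen(h)\le\lambda_nM_0\}$, $\mathcal N_{osn}=\mathcal N_{os}\cap\mathcal A_{k(n)}$. $\mathcal A_{k(n)}^{M_0}=\{\alpha\in\mathcal A_{k(n)}:\lambda_nPen(h)\le\lambda_nM_0\}$ with $M_0$ finite and so large that it contains $\Pi_n\alpha_0$, and contains $\widehat\alpha_n$ with probability arbitrarily close to one for large $n$. $\mathbf V$ is the linear span of $\mathcal A_{os}-\{\alpha_0\}$, $\overline{\mathbf V}$ its closure under $\|\cdot\|$; $\alpha_{0,n}$ minimizes $\|\alpha-\alpha_0\|$ over $\mathbb R^{d_\theta}\times\mathcal H_{k(n)}$; $\overline{\mathbf V}_{k(n)}$ is the closed linear span under $\|\cdot\|$ of $\mathcal A_{osn}-\{\alpha_{0,n}\}$, with $\dim\overline{\mathbf V}_{k(n)}=\dim\mathcal A_{k(n)}\asymp k(n)$. VECTOR FUNCTIONAL. $\phi=(\phi_1,\dots,\phi_{d(n)})':\mathbb R^{d_\theta}\times\mathcal H\to\mathbb R^{d(n)}$, each $\phi_j$ $\|\cdot\|_s$-continuous with pathwise derivative $\dot\phi_j[v]=\partial_\tau\phi_j(\alpha_0+\tau v)|_{\tau=0}$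 a $\|\cdot\|_s$-bounded linear functional; $\dot\phi[v]=(\dot\phi_1[v],\dots,\dot\phi_{d(n)}[v])'$. $v_{j,n}^*\in\overline{\mathbf V}_{k(n)}$ satisfies $\dot\phi_j[v]=\langle v_{j,n}^*,v\rangle$ for all $v\in\overline{\mathbf V}_{k(n)}$; $\mathbf v_n^*=(v_{1,n}^*,\dots,v_{d(n),n}^* )$; $\dot m(x)[\mathbf v_n^*]$ is the $d_\rho\times d(n)$ matrix with $j$-th column $\dot m(x)[v_{j,n}^*]$; $\langle\mathbf v_n^{*\prime},v\rangle$ is the $d(n)$-vector with components $\langle v_{j,n}^*,v\rangle$. $\Omega_{sd,n}=E[\dot m(X)[\mathbf v_n^*]'\Sigma(X)^{-1}\Sigma_0(X)\Sigma(X)^{-1}\dot m(X)[\mathbf v_n^*]]$. $\mathbf Z_n=\frac1n\sum_{i=1}^n\dot m(X_i)[\mathbf v_n^*]'\Sigma(X_i)^{-1}\rho(Z_i,\alpha_0)\in\mathbb R^{d(n)}$. $\mu_{3,n}=E[\|\Omega_{sd,n}^{-1/2}\dot m(X)[\mathbf v_n^*]'\Sigma(X)^{-1}\rho(Z,\alpha_0)\|_e^3]$. $\mathcal T_n^M=\{t\in\mathbb R^{d(n)}:\|t\|_e\le M_nn^{-1/2}\sqrt{d(n)}\}$, $\alpha(t)=\alpha+\mathbf v_n^*\Omega_{sd,n}^{-1/2}t$. $a_n,b_n,c_n,s_n$ are positive sequences converging to zero. CONDITIONS. [ID] (i) $E[\rho(Z;\alpha)|X]=0$ a.s. iff $\alpha\in\mathcal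 A$ with $\|\alpha-\alpha_0\|_s=0$; (ii) $\Theta$ is compact with nonempty interior, $\{\mathcal H_k\}_{k\ge1}$ is a non-decreasing sequence of nonempty closed linear subsets of the Banach space $(\mathcal H,\|\cdot\|_{\mathbf H})$ with $\mathcal H=cl(\cup_k\mathcal H_k)$, and there is $\Pi_nh_0\in\mathcal H_{k(n)}$ with $\|\Pi_nh_0-h_0\|_{\mathbf H}=o(1)$; (iii) $Q$ is lower semicontinuous on $(\mathcal A,\|\cdot\|_s)$; (iv) the eigenvalues of $\Sigma(x),\Sigma_0(x)$ are bounded and bounded away from zero uniformly in $x\in\mathcal X$. [PEN] (ii) $|Pen(\Pi_nh_0)-Pen(h_0)|=O(1)$, $Pen(h_0)<\infty$; (iii) for every $M$, $\{h\in\mathcal H:Pen(h)\le M\}$ is compact in $(\mathcal H,\|\cdot\|_{\mathbf H})$. [CRIT] (i) $\widehat Q_n(\Pi_n\alpha_0)\le c_0Q(\Pi_n\alpha_0)+o_P(n^{-1})$ for a finite $c_0>0$; (ii) $\widehat Q_n(\alpha)\ge cQ(\alpha)-O_P(\bar\delta_{m,n}^2)$ uniformly over $\mathcal A_{k(n)}^{M_0}$ for a finite $c>0$. [LOC] (i) $m(\cdot,\alpha)$ is continuously pathwise differentiable in $\alpha\in\mathcal A_{os}$ and $\|\alpha-\alpha_0\|\le C\|\alpha-\alpha_0\|_s$ on $\mathcal A_{os}$ for a finite $C$; (ii) $Q(\alpha)\asymp\|\alpha-\alpha_0\|^2$ on $\mathcal A_{os}$; (iii) $\widehat Q_n(\alpha)\ge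 cQ(\alpha)-O_P(\delta_n^2)$ uniformly over $\mathcal A_{osn}$, and $\max\{\delta_n^2,Q(\Pi_n\alpha_0),\lambda_n,o(n^{-1})\}=\delta_n^2$; (iv, imposed throughout by the paper) $\lambda_n\sup_{\alpha,\alpha'\in\mathcal A_{os}}|Pen(h)-Pen(h')|=o(n^{-1})$ or $\lambda_n=o(n^{-1})$. [VPHI] (i) for each $j$: $\dot\phi_j$ is a nonzero linear functional on $\mathbf V$, $\{\overline{\mathbf V}_k\}$ is an increasing sequence of finite dimensional Hilbert spaces dense in $(\overline{\mathbf V},\|\cdot\|)$, $\|v_{j,n}^*\|/\sqrt n=o(1)$; and $\dot\phi_1,\dots,\dot\phi_{d(n)}$ are linearly independent; (ii) $\sup_{(\alpha,t)\in\mathcal N_{osn}\times\mathcal T_n^M}\|\Omega_{sd,n}^{-1/2}\{\phi(\alpha(t))-\phi(\alpha_0)-\dot\phi[\alpha(t)-\alpha_0]\}\|_e=O(c_n)$; (iii) $\|\Omega_{sd,n}^{-1/2}\dot\phi[\alpha_{0,n}-\alpha_0]\|_e=O(c_n)$; (iv) $c_n=o(n^{-1/2})$. [VLQA] (i) for all $(\alpha,t)\in\mathcal N_{osn}\times\mathcal T_n^M$, $\alpha(t)\in\mathcal A_{k(n)}$, and with $\widehat\Lambda_n(\alpha(t),\alpha)=\frac12\{\widehat Q_n(\alpha(t))-\widehat Q_n(\alpha)\}$ and $r_n(t)=(\max\{\|t\|_e^2b_n,\|t\|_ea_n,s_n\})^{-1}$, $\sup_{(\alpha,t)\in\mathcal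 N_{osn}\times\mathcal T_n^M}r_n(t)|\widehat\Lambda_n(\alpha(t),\alpha)-t'\Omega_{sd,n}^{-1/2}\{\mathbf Z_n+\langle\mathbf v_n^{*\prime},\alpha-\alpha_0\rangle\}-\frac12t'\mathbb B_nt|=O_P(1)$, where $\mathbb B_n$ is a $Z^n$-measurable positive definite $d(n)\times d(n)$ matrix, $\mathbb B_n=O_P(1)$; (ii) $s_nnd(n)=o(1)$, $b_n\sqrt{d(n)}=o(1)$, $\sqrt{nd(n)}\,a_n=o(1)$.
   Formalization: A_os is a neighbourhood only relative to its containing set (else [PEN](iii) forces finite dimension); Pen is strictly below M_0 at Π_nα_0 and, w.p.→1, at the estimator; added: nλ_n sup|Pen(h(t))−Pen(h)|→0 over N_osn×T_n^M, without which a penalty infinite at α(t) breaks the claim. *)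

(* Defs.v *)
From HB Require Import structures.
From mathcomp Require Import all_boot all_order all_algebra.
From mathcomp Require Import all_classical all_reals all_analysis.

Set Implicit Arguments.
Unset Strict Implicit.
Unset Printing Implicit Defensive.

Import Order.TTheory GRing.Theory Num.Theory.
Import numFieldNormedType.Exports.

Local Open Scope classical_set_scope.
Local Open Scope ring_scope.

Section Generalities.
Context {R : realType}.

Definition enorm n (u : 'cV[R]_n) : R := Num.sqrt (\sum_(i < n) u i ord0 ^+ 2).

Definition qform n (u : 'cV[R]_n) (A : 'M[R]_n) (v : 'cV[R]_n) : R :=
  (u^T *m A *m v) ord0 ord0.

Definition posdef n (A : 'M[R]_n) : Prop :=
  A^T = A /\ forall u : 'cV[R]_n, u != 0 -> 0 < qform u A u.

Definition opnorm n (A : 'M[R]_n) : R :=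
  sup [set enorm (A *m u) | u in [set u : 'cV[R]_n | enorm u <= 1]].

Definition is_inv_sqrt n (A S : 'M[R]_n) : Prop :=
  [/\ A \in unitmx, posdef S & S *m S = invmx A].

(* [f] has a continuous derivative on [0, 1], one-sided at the endpoints: this
   derivative is the continuous [g] *)
Definition C1_on01 (f : R -> R) : Prop :=
  exists g : R -> R,
    [/\ {within `[0, 1], continuous f}, {within `[0, 1], continuous g} &
        forall tau : R, 0 < tau < 1 -> is_derive tau (1 : R) f (g tau)].

Section LinearSpan.
Variable E : lmodType R.

Definition lspan (A : set E) : set E := [set v | exists N (c : 'I_N -> R)
  (s : 'I_N -> E), (forall i, A (s i)) /\ v = \sum_(i < N) c i *: s i].

Definition has_dim (W : set E) (D : nat) : Prop := exists b : 'I_D -> E,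
  (forall c : 'I_D -> R, \sum_(i < D) c i *: b i = 0 -> forall i, c i = 0) /\
  W = [set \sum_(i < D) c i *: b i | c in [set: 'I_D -> R]].

Definition convex_subset (A : set E) : Prop := forall a b (t : R),
  A a -> A b -> 0 <= t <= 1 -> A (t *: a + (1 - t) *: b).

End LinearSpan.
End Generalities.

(* Stochastic order symbols and weak convergence. Estimators and suprema need
   not be measurable, hence outer probability [P^*] and outer expectation; both
   agree with probability and expectation on measurable events and variables. *)
Section StochasticOrder.
Context {R : realType} {dO : measure_display} {Om : measurableType dO}.
Variable P : probability Om R.

Definition oP (X : nat -> Om -> R) (r : nat -> R) : Prop :=
  forall e : R, 0 < e ->
    (P^* [set w | e * r n < `|X n w| ]%R)%mu @[n --> \oo] --> 0%E.

Definition OP (X : nat -> Om -> R) (r : nat -> R) : Prop :=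
  forall e : R, 0 < e -> exists C : R, \forall n \near \oo,
    ((P^* [set w | C * r n < `|X n w| ]%R)%mu <= e%:E)%E.

Definition outer_expectation (g : Om -> R) : \bar R :=
  ereal_inf [set (\int[P]_w (u w)%:E)%E | u in [set u : Om -> R |
    P.-integrable setT (EFin \o u) /\ forall w, g w <= u w]].

(* Weak convergence of [X n] to the law with expectation functional [L]. *)
Definition cvg_in_law (T : topologicalType) (X : nat -> Om -> T)
    (L : (T -> R) -> \bar R) : Prop :=
  forall f : T -> R, continuous f -> (exists C, forall x, `|f x| <= C) ->
    outer_expectation (fun w => f (X n w)) @[n --> \oo] --> L f.

End StochasticOrder.

Section LimitLaws.
Context {R : realType}.

Definition normal_law (f : R -> R) : \bar R :=
  (\int[normal_prob (0 : R) 1]_x (f x)%:E)%E.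

Definition tcons n (p : measurableTypeR R * n.-tuple (measurableTypeR R)) :
  n.+1.-tuple (measurableTypeR R) := [tuple of p.1 :: p.2].

Lemma measurable_tcons n : measurable_fun setT (@tcons n).
Proof. exact: measurable_cons. Qed.

HB.instance Definition _ n := isMeasurableFun.Build _ _ _ _ (@tcons n)
  (@measurable_tcons n).

(* The product measure N(0,1)^n on R^n. *)
Fixpoint gauss n : probability (n.-tuple (measurableTypeR R)) R :=
  match n with
  | 0 => \d_ ([tuple] : 0.-tuple (measurableTypeR R))
  | n'.+1 => distribution (normal_prob (0 : R) 1 \x gauss n')%E (@tcons n')
  end.

Definition gauss_law n (f : 'cV[R]_n -> R) : \bar R :=
  (\int[gauss n]_x (f (\col_i (tnth x i : R)))%:E)%E.

(* chi-square with n degrees of freedom: law of the sum of the squares of n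
   independent N(0,1) variables. *)
Definition chi2_law n (f : R -> R) : \bar R :=
  (\int[gauss n]_x (f (\sum_(i < n) (tnth x i : R) ^+ 2))%:E)%E.

End LimitLaws.

Definition obs (R : realType) (dy dx : nat) : Type :=
  (dy.-tuple R * dx.-tuple R)%type.

(* The raw data of the PSMD problem; what they have to satisfy is stated in the
   predicates below. An observation is z = (y, x). Sequences are indexed by the
   sample size n; nothing is meant at n = 0. *)
Record psmd (R : realType) (H : completeNormedModType R)
    (dO : measure_display) (Om : measurableType dO) := Psmd {
  dy : nat; dx : nat; dth : nat; drho : nat;
  law : probability (dy.-tuple R * dx.-tuple R)%type R;
  Zs : nat -> Om -> obs R dy dx;
  rho : obs R dy dx -> 'cV[R]_dth * H -> 'cV[R]_drho;
  mreg : dx.-tuple R -> 'cV[R]_dth * H -> 'cV[R]_drho;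
  Sig : dx.-tuple R -> 'M[R]_drho;
  Sig0 : dx.-tuple R -> 'M[R]_drho;
  Theta : set 'cV[R]_dth;
  theta0 : 'cV[R]_dth;
  h0 : H;
  (* weights: [An n (X_1, .., X_n) X_i x] is A_n(X_i, x) *)
  An : forall n, n.-tuple (dx.-tuple R) -> dx.-tuple R -> dx.-tuple R -> R;
  Sighat : forall n, n.-tuple (obs R dy dx) -> dx.-tuple R -> 'M[R]_drho;
  basis : nat -> H;
  kn : nat -> nat;
  Pen : H -> \bar R;
  lam : nat -> R;
  ahat : forall n, n.-tuple (obs R dy dx) -> 'cV[R]_dth * H;
  M0 : R;
  Aos : set ('cV[R]_dth * H);
  PiH0 : nat -> H;
  (* [mdot x v]: a version of the pathwise derivative of m(x, .) at alpha_0 *)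
  mdot : dx.-tuple R -> 'cV[R]_dth * H -> 'cV[R]_drho;
  dbar : nat -> R;
  delta : nat -> R;
  (* indexed by the sieve dimension k, so that alpha_{0,n} is [alpha0k (kn n)] *)
  alpha0k : nat -> 'cV[R]_dth * H;
  dn : nat -> nat;
  phi : forall n, 'I_(dn n) -> 'cV[R]_dth * H -> R;
  vst : forall n, 'I_(dn n) -> 'cV[R]_dth * H;
  (* the matrix Omega_{sd,n}^{-1/2} *)
  Omis : forall n, 'M[R]_(dn n);
  BB : forall n, n.-tuple (obs R dy dx) -> 'M[R]_(dn n);
  an : nat -> R; bn : nat -> R; cn : nat -> R; sn : nat -> R
}.

Section PSMD.
Context {R : realType} {H : completeNormedModType R}.
Context {dO : measure_display} {Om : measurableType dO}.
Variables (P : probability Om R) (S : psmd H Om).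

Local Notation dy := (dy S).
Local Notation dx := (dx S).
Local Notation dth := (dth S).
Local Notation drho := (drho S).
Local Notation law := (law S).
Local Notation rho := (@rho _ _ _ _ S).
Local Notation mreg := (@mreg _ _ _ _ S).
Local Notation Sig := (@Sig _ _ _ _ S).
Local Notation Sig0 := (@Sig0 _ _ _ _ S).
Local Notation Theta := (@Theta _ _ _ _ S).
Local Notation h0 := (@h0 _ _ _ _ S).
Local Notation An := (@An _ _ _ _ S).
Local Notation Sighat := (@Sighat _ _ _ _ S).
Local Notation kn := (@kn _ _ _ _ S).
Local Notation Pen := (@Pen _ _ _ _ S).
Local Notation lam := (@lam _ _ _ _ S).
Local Notation M0 := (@M0 _ _ _ _ S).
Local Notation Aos := (@Aos _ _ _ _ S).
Local Notation PiH0 := (@PiH0 _ _ _ _ S).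
Local Notation mdot := (@mdot _ _ _ _ S).
Local Notation dbar := (@dbar _ _ _ _ S).
Local Notation delta := (@delta _ _ _ _ S).
Local Notation alpha0k := (@alpha0k _ _ _ _ S).
Local Notation dn := (@dn _ _ _ _ S).
Local Notation phi := (@phi _ _ _ _ S).
Local Notation vst := (@vst _ _ _ _ S).
Local Notation Omis := (@Omis _ _ _ _ S).
Local Notation BB := (@BB _ _ _ _ S).
Local Notation an := (@an _ _ _ _ S).
Local Notation bn := (@bn _ _ _ _ S).
Local Notation cn := (@cn _ _ _ _ S).
Local Notation sn := (@sn _ _ _ _ S).

Local Notation Z := (obs R dy dx).
Local Notation X := (dx.-tuple R).
Local Notation E := ('cV[R]_dth * H)%type.

Definition EZ (f : Z -> R) : \bar R := (\int[law]_z (f z)%:E)%E.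

Definition alpha0 : E := (theta0 S, h0).
Definition Pia0 n : E := (theta0 S, PiH0 n).
Definition snorm (a : E) : R := enorm a.1 + `|a.2|.
Definition Aspace : set E := [set a | Theta a.1].

Definition suppX : set X := [set x | forall e : R, 0 < e ->
  (0 < law [set z : Z | forall j, (`|tnth z.2 j - tnth x j| < e)%R])%E].

Definition is_condexp (f : Z -> R) (g : X -> R) : Prop :=
  [/\ measurable_fun setT g, law.-integrable setT (EFin \o f),
      law.-integrable setT (EFin \o (g \o snd)) &
      forall B : set X, measurable B ->
        (\int[law]_(z in snd @^-1` B) (f z)%:E =
         \int[law]_(z in snd @^-1` B) (g z.2)%:E)%E].

Definition Q (a : E) : \bar R :=
  EZ (fun z => qform (mreg z.2 a) (invmx (Sig z.2)) (mreg z.2 a)).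

Definition sample n (w : Om) : n.-tuple Z := [tuple Zs S i w | i < n].

Definition mhat n (z : n.-tuple Z) (x : X) (a : E) : 'cV[R]_drho :=
  \sum_(i < n)
    An (map_tuple snd z : n.-tuple X) (tnth z i).2 x *: rho (tnth z i) a.

Definition Qhat n (z : n.-tuple Z) (a : E) : R := n%:R^-1 * \sum_(i < n)
  qform (mhat z (tnth z i).2 a) (invmx (Sighat z (tnth z i).2))
        (mhat z (tnth z i).2 a).

Definition Hk (k : nat) : set H :=
  [set \sum_(j < k) b j *: basis S j | b in [set: 'I_k -> R]].
Definition Ak (k : nat) : set E := [set a | Theta a.1 /\ Hk k a.2].
Definition Aosk (k : nat) : set E := Aos `&` Ak k.

Definition lpen n (a : E) : \bar R := ((lam n)%:E * Pen a.2)%E.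

Definition AkM0 n : set E :=
  [set a | Ak (kn n) a /\ (lpen n a <= (lam n * M0)%:E)%E].

Definition inner (u v : E) : R :=
  fine (EZ (fun z => qform (mdot z.2 u) (invmx (Sig z.2)) (mdot z.2 v))).
Definition nrm (v : E) : R := Num.sqrt (inner v v).

Definition ratios n : set R := [set snorm (a - Pia0 n) / nrm (a - Pia0 n) |
  a in [set a | Aosk (kn n) a /\ nrm (a - Pia0 n) != 0]].
(* [local_objects] requires the set of ratios to be bounded. *)
Definition tau n : R := sup (ratios n).
Definition deltas n : R := snorm (alpha0 - Pia0 n) + tau n * delta n.
Definition Mn n : R :=
  Num.min (ln (ln n.+1%:R)) (ln ((deltas n)^-1 + 1)).

Definition Nos n : set E := [set a | [/\ Aspace a,
  nrm (a - alpha0) <= Mn n * delta n,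
  snorm (a - alpha0) <= Mn n * deltas n &
  (lpen n a <= (lam n * M0)%:E)%E]].
Definition Nosn n : set E := Nos n `&` Ak (kn n).

Definition nclosure (W : set E) : set E :=
  [set v | forall e : R, 0 < e -> exists2 u, W u & nrm (v - u) < e].
Definition Vspan : set E := lspan [set a - alpha0 | a in Aos].
Definition Vbar : set E := nclosure Vspan.
Definition Vbark k : set E := nclosure (lspan [set a - alpha0k k | a in Aosk k]).

Definition phiv n (a : E) : 'cV[R]_(dn n) := \col_j phi j a.
Definition dphi n (j : 'I_(dn n)) (v : E) : R :=
  derive1 (fun tau : R => phi j (alpha0 + tau *: v)) 0.
Definition dphiv n (v : E) : 'cV[R]_(dn n) := \col_j dphi j v.

Definition mdotv n (x : X) : 'M[R]_(drho, dn n) :=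
  \matrix_(k, j) mdot x (vst j) k ord0.
Definition innerv n (v : E) : 'cV[R]_(dn n) := \col_j inner (vst j) v.

Definition Omega n : 'M[R]_(dn n) := \matrix_(i, j) fine (EZ (fun z =>
  ((mdotv n z.2)^T *m invmx (Sig z.2) *m Sig0 z.2 *m invmx (Sig z.2)
   *m mdotv n z.2) i j)).

Definition score n (z : Z) : 'cV[R]_(dn n) :=
  (mdotv n z.2)^T *m invmx (Sig z.2) *m rho z alpha0.
Definition Zn n (w : Om) : 'cV[R]_(dn n) :=
  n%:R^-1 *: \sum_(i < n) score n (tnth (sample n w) i).
Definition mu3 n : \bar R :=
  EZ (fun z => enorm (Omis n *m score n z) ^+ 3).

Definition Tn n : set 'cV[R]_(dn n) := [set t |
  enorm t <= Mn n * (Num.sqrt n%:R)^-1 * Num.sqrt (dn n)%:R].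
Definition shift_at n (a : E) (t : 'cV[R]_(dn n)) : E :=
  a + \sum_(j < dn n) (Omis n *m t) j ord0 *: vst j.

Definition ahat_at n (w : Om) : E := ahat (sample n w).

(* n (phi(ahat) - phi(alpha_0))' Omega^{-1} (phi(ahat) - phi(alpha_0)) *)
Definition wald n (w : Om) : R :=
  n%:R * qform (phiv n (ahat_at n w) - phiv n alpha0) (invmx (Omega n))
               (phiv n (ahat_at n w) - phiv n alpha0).

Definition model : Prop :=
  [/\ (forall i, measurable_fun setT (Zs S i) /\
         forall B, measurable B -> P (Zs S i @^-1` B) = law B),
      (forall n (B : nat -> set Z), (forall i, measurable (B i)) ->
         P (\bigcap_(i < n) (Zs S i @^-1` B i)) =
         (\prod_(i < n) fine (P (Zs S i @^-1` B i)))%:E),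
      (forall a, Aspace a -> forall i,
         is_condexp (fun z => rho z a i ord0) (fun x => mreg x a i ord0)) &
      Theta° (theta0 S) /\ {ae law, forall z, mreg z.2 alpha0 = 0}] /\
  [/\ (forall i j, measurable_fun setT (fun x => Sig x i j)),
      (forall x, posdef (Sig x)) &
      forall i j, is_condexp
        (fun z => (rho z alpha0 i ord0 - mreg z.2 alpha0 i ord0) *
                  (rho z alpha0 j ord0 - mreg z.2 alpha0 j ord0))
        (fun x => Sig0 x i j)].

(* Consistency of the first-step estimators is in P_X-measure, in probability;
   this is implied by pointwise, L^2 or uniform consistency. *)
Definition estimators : Prop :=
  [/\ (forall n (i : 'I_n) x,
         measurable_fun setT (fun xs : n.-tuple X => An xs (tnth xs i) x)),
      (forall a, Aspace a -> forall e : R, 0 < e ->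
         oP P (fun n w => fine (law^* [set z |
           e < enorm (mhat (sample n w) z.2 a - mreg z.2 a)])%mu) (fun=> 1)),
      (forall e : R, 0 < e ->
         oP P (fun n w => fine (law^* [set z | exists i j,
           e < `|Sighat (sample n w) z.2 i j - Sig z.2 i j|])%mu) (fun=> 1)),
      (forall h, 0 <= Pen h)%E /\
        (kn n @[n --> \oo] --> \oo) /\
        (forall n, 0 <= lam n) /\ (lam n @[n --> \oo] --> 0) &
      exists2 eta : nat -> Om -> R, oP P eta (fun n => n%:R^-1) &
        forall n w, Ak (kn n) (ahat_at n w) /\
          forall a, Ak (kn n) a ->
            ((Qhat (sample n w) (ahat_at n w))%:E + lpen n (ahat_at n w) <=
             (Qhat (sample n w) a)%:E + lpen n a + (eta n w)%:E)%E].

(* [m] is differentiable at [alpha0] in every direction with derivative [mdot],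
   which is linear and square integrable, so that [inner] is well defined. *)
Definition pathwise_derivative : Prop :=
  [/\ (forall v i, measurable_fun setT (fun x => mdot x v i ord0)),
      (forall v, {ae law, forall z, forall i,
         is_derive (0 : R) (1 : R)
           (fun tau : R => mreg z.2 (alpha0 + tau *: v) i ord0)
           (mdot z.2 v i ord0)}),
      (forall (c : R) u v,
         {ae law, forall z, mdot z.2 (c *: u + v) =
                            c *: mdot z.2 u + mdot z.2 v}) &
      forall v, law.-integrable setT (fun z =>
        (qform (mdot z.2 v) (invmx (Sig z.2)) (mdot z.2 v))%:E)].

(* [Aos] is a neighbourhood of [alpha0] relative to the set [G] in which it is
   contained: it cannot be one in [Aspace], since by [PEN] the set [G] is relatively
   compact in its second component. As [M0] is taken large, the penalties of
   [Pia0 n] and [ahat] are strictly below it. *)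
Definition local_objects : Prop :=
  let G := [set a | [/\ Aspace a, snorm (a - alpha0) < M0 &
                        forall n, (lpen n a < (lam n * M0)%:E)%E]] in
  [/\ 0 < M0, convex_subset Aos, Aos alpha0, Aos `<=` G &
      exists2 r : R, 0 < r &
        forall a, G a -> snorm (a - alpha0) < r -> Aos a] /\
  [/\ (forall n, AkM0 n (Pia0 n) /\ (lpen n (Pia0 n) < (lam n * M0)%:E)%E),
      ((P^* (~` [set w | AkM0 n (ahat_at n w) /\
           (lpen n (ahat_at n w) < (lam n * M0)%:E)%E]))%mu
         @[n --> \oo] --> 0%E),
      (forall n, 0 < delta n <= dbar n) /\ (delta n @[n --> \oo] --> 0),
      nonincreasing_seq dbar /\ (dbar n @[n --> \oo] --> 0) &
      (forall n, has_ubound (ratios n)) /\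
        (deltas n @[n --> \oo] --> 0)] /\
  (forall k, Hk k (alpha0k k).2 /\
     forall a : E, Hk k a.2 -> nrm (alpha0k k - alpha0) <= nrm (a - alpha0)) /\
  exists D : nat -> nat,
    (\forall n \near \oo, has_dim (Vbark (kn n)) (D n) /\
                          has_dim (lspan (Ak (kn n))) (D n)) /\
    exists c1 c2 : R, [/\ 0 < c1, 0 < c2 & \forall n \near \oo,
      c1 * (kn n)%:R <= (D n)%:R <= c2 * (kn n)%:R].

Definition functional_objects : Prop :=
  [/\ (forall n (j : 'I_(dn n)) (a : E) (e : R), 0 < e ->
         exists2 r : R, 0 < r & forall b : E, snorm (b - a) < r ->
           `|phi j b - phi j a| < e),
      (forall n (j : 'I_(dn n)),
         [/\ forall v, derivable (fun tau : R => phi j (alpha0 + tau *: v)) 0 1,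
             forall (c : R) u v, dphi j (c *: u + v) = c * dphi j u + dphi j v &
             exists C : R, forall v, `|dphi j v| <= C * snorm v]),
      (forall n (j : 'I_(dn n)), Vbark (kn n) (vst j) /\
         forall v, Vbark (kn n) v -> dphi j v = inner (vst j) v),
      (forall n, is_inv_sqrt (Omega n) (Omis n)) &
      forall n, [/\ 0 < an n, 0 < bn n, 0 < cn n & 0 < sn n]] /\
  [/\ an n @[n --> \oo] --> 0, bn n @[n --> \oo] --> 0,
      cn n @[n --> \oo] --> 0 & sn n @[n --> \oo] --> 0].

(* By definition, the sets [Hk k] are finite-dimensional (hence closed) linear
   subspaces, nondecreasing in [k]. *)
Definition ID : Prop :=
  [/\ (forall a, Aspace a ->
         {ae law, forall z, mreg z.2 a = 0} <-> snorm (a - alpha0) = 0),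
      [/\ compact Theta, Theta° !=set0, closure (\bigcup_k Hk k) = setT,
          forall n, Hk (kn n) (PiH0 n) &
          `|PiH0 n - h0| @[n --> \oo] --> 0],
      (forall a (y : R), Aspace a -> (y%:E < Q a)%E ->
         exists2 r : R, 0 < r & forall b, Aspace b -> snorm (b - a) < r ->
           (y%:E < Q b)%E) &
      exists c C : R, 0 < c /\ forall x, suppX x -> forall l : R,
        eigenvalue (Sig x) l \/ eigenvalue (Sig0 x) l -> c <= l <= C].

Definition PEN : Prop :=
  [/\ (exists C : R, forall n, (`|Pen (PiH0 n) - Pen h0| <= C%:E)%E),
      (Pen h0 < +oo)%E &
      forall M : R, compact [set h | (Pen h <= M%:E)%E]].

Definition CRIT : Prop :=
  (exists2 c0 : R, 0 < c0 & exists2 r : nat -> Om -> R,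
     oP P r (fun n => n%:R^-1) & forall n w,
     ((Qhat (sample n w) (Pia0 n))%:E <=
        c0%:E * Q (Pia0 n) + (r n w)%:E)%E) /\
  (exists2 c : R, 0 < c & exists2 r : nat -> Om -> R,
     OP P r (fun n => dbar n ^+ 2) & forall n w a, AkM0 n a ->
     (c%:E * Q a - (r n w)%:E <= (Qhat (sample n w) a)%:E)%E).

(* In the maximum, o(1/n) stands for any sequence of that order. *)
Definition LOC : Prop :=
  [/\ (forall a b, Aos a -> Aos b -> {ae law, forall z, forall i,
         C1_on01 (fun tau : R => mreg z.2 (a + tau *: (b - a)) i ord0)}) /\
      (exists C : R, forall a, Aos a ->
         nrm (a - alpha0) <= C * snorm (a - alpha0)),
      (exists c1 c2 : R, [/\ 0 < c1, 0 < c2 & forall a, Aos a ->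
         ((c1 * nrm (a - alpha0) ^+ 2)%:E <= Q a <=
          (c2 * nrm (a - alpha0) ^+ 2)%:E)%E]),
      (exists2 c : R, 0 < c & exists2 r : nat -> Om -> R,
         OP P r (fun n => delta n ^+ 2) & forall n w a, Aosk (kn n) a ->
         (c%:E * Q a - (r n w)%:E <= (Qhat (sample n w) a)%:E)%E) /\
      (forall e : nat -> R, (n%:R * e n @[n --> \oo] --> 0) ->
         \forall n \near \oo,
         maxe (maxe (delta n ^+ 2)%:E (Q (Pia0 n)))
              (maxe (lam n)%:E (e n)%:E) = (delta n ^+ 2)%:E) &
      ((n%:R * lam n)%:E * ereal_sup
         [set `|Pen ab.1.2 - Pen ab.2.2| | ab in Aos `*` Aos])%E
           @[n --> \oo] --> 0%E \/
      n%:R * lam n @[n --> \oo] --> 0].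

(* The bound on penalty increments of [LOC], for the pairs a, a(t) to which it
   is applied: a(t) need not belong to [Aos], see [local_objects]. *)
Definition LOC_perturbed : Prop :=
  ((n%:R * lam n)%:E * ereal_sup
     [set `|Pen (shift_at at_.1 at_.2).2 - Pen at_.1.2| |
        at_ in Nosn n `*` @Tn n])%E @[n --> \oo] --> 0%E.

Definition VPHI : Prop :=
  [/\ (forall n (j : 'I_(dn n)), exists2 v, Vspan v & dphi j v != 0) /\
      (forall j (e : R), 0 < e -> \forall n \near \oo,
         forall jn : (j < dn n)%N,
           nrm (vst (Ordinal jn)) <= e * Num.sqrt n%:R) /\
      (forall n (c : 'cV[R]_(dn n)),
         (forall v, Vspan v -> \sum_(j < dn n) c j ord0 * dphi j v = 0) -> c = 0),
      [/\ forall k, Vbark k `<=` Vbark k.+1 /\ Vbark k `<=` Vbar,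
          forall k, exists D, has_dim (Vbark k) D,
          forall k v, Vbark k v -> inner v v = 0 -> v = 0 &
          forall v, Vbar v -> forall e : R, 0 < e ->
            exists k, exists2 u, Vbark k u & nrm (v - u) < e],
      (exists C : R, \forall n \near \oo, forall a (t : 'cV[R]_(dn n)),
         Nosn n a -> Tn t ->
         enorm (Omis n *m (phiv n (shift_at a t) - phiv n alpha0 -
                           dphiv n (shift_at a t - alpha0))) <= C * cn n),
      (exists C : R, \forall n \near \oo,
         enorm (Omis n *m dphiv n (alpha0k (kn n) - alpha0)) <= C * cn n) &
      Num.sqrt n%:R * cn n @[n --> \oo] --> 0].

(* The suprema over (a, t) are bounded in probability: the event that such a
   supremum exceeds C is the event that some (a, t) does. *)
Definition VLQA : Prop :=
  let gap n w a (t : 'cV[R]_(dn n)) :=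
    2^-1 * (Qhat (sample n w) (shift_at a t) - Qhat (sample n w) a)
    - (t^T *m Omis n *m (Zn n w + innerv n (a - alpha0))) ord0 ord0
    - 2^-1 * qform t (BB (sample n w)) t in
  let rn n (t : 'cV[R]_(dn n)) :=
    (Num.max (Num.max (enorm t ^+ 2 * bn n) (enorm t * an n)) (sn n))^-1 in
  [/\ (forall n a (t : 'cV[R]_(dn n)), Nosn n a -> Tn t ->
         Ak (kn n) (shift_at a t)),
      (forall e : R, 0 < e -> exists C : R, \forall n \near \oo,
         ((P^* [set w | exists a (t : 'cV[R]_(dn n)),
            [/\ Nosn n a, Tn t & (C < rn n t * `|gap n w a t|)%R]])%mu
          <= e%:E)%E),
      (forall n i j, measurable_fun setT (fun z : n.-tuple Z => BB z i j)) /\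
        (forall n (z : n.-tuple Z), posdef (BB z)),
      OP P (fun n w => opnorm (BB (sample n w))) (fun=> 1) &
      [/\ sn n * n%:R * (dn n)%:R @[n --> \oo] --> 0,
          bn n * Num.sqrt (dn n)%:R @[n --> \oo] --> 0 &
          Num.sqrt (n%:R * (dn n)%:R) * an n @[n --> \oo] --> 0]].

End PSMD.

(* Main.v *)
(** The penalty confines the estimator to a compact set, on which [Q] is bounded
   away from 0 off [alpha0]; the lower bounds on the criterion then yield the rate
   [delta n] in [nrm] and, through [tau], the rate [deltas n] in [snorm]. Since
   [Mn] tends to infinity, the estimator lies in [Nosn] with probability tending to
   one. Perturb it there by [t = - s V / |V|], with
   [V = Omis (Zn + <v*, ahat - alpha0>)] and [s] of order n^(-1/2): near-minimality
   and the quadratic approximation give [|V| = o_P(n^(-1/2))], and by the expansion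
   of [phi], [V] is up to o(n^(-1/2)) the sum of [Omis Zn] and
   [Omis (phi (ahat) - phi (alpha0))].

   For d(n) tending to infinity, [sqrt n Omis Zn] is a normalized sum of i.i.d.
   standardized vectors, whose squared length is analysed by a Lindeberg exchange
   carried out on the real line: after k of n summands, the missing part of
   (|S|^2 - d) / sqrt (2 d) is represented by a normal variable of variance
   1 - (k / n)^2, which by stability of the normal law splits into the one of the
   next step and one of variance (2 k + 1) / n^2. The third moments of the score
   control each exchange, and no Gaussian vector is needed. *)

Require Import Defs.
From HB Require Import structures.
From mathcomp Require Import all_boot all_order all_algebra.
From mathcomp Require Import all_classical all_reals all_analysis.
From mathcomp Require Import measurable_realfun ring lra.

Set Implicit Arguments.
Unset Strict Implicit.
Unset Printing Implicit Defensive.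

Import Order.TTheory GRing.Theory Num.Theory.
Import numFieldNormedType.Exports.

Local Open Scope classical_set_scope.
Local Open Scope ring_scope.

(** * Euclidean norm, quadratic forms and operator norm *)

Section EuclideanNorm.
Context {R : realType}.
Implicit Types n : nat.

(** The exchange can stay on the real line because the second-order term of one data step is u''
    |S_k|^2 / (n d), and |S_k|^2 is close to its mean k d / n: to leading order, step k injects the
    deterministic variance 2 k / n^2, which a real normal variable can imitate. The variances (2 k +
    1) / n^2 add up to exactly 1, and the excess 1 / n^2 is of smaller order. The fluctuation of
    |S_k|^2 is harmless because test functions with compactly supported derivatives only see states
    whose normalized value is bounded; in total it costs an error of order d^(-1/2), which is where
    d(n) tending to infinity enters.

    Two features of the setting shape the rest. The estimator and the suprema need not be
    measurable, so events are handled through outer probability and the Slutsky argument through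
    outer expectation. And the entries of [Omega] are defined with [fine], so square integrability
    of the score is not given: it is extracted from the invertibility of [Omega], by truncating the
    weights and passing to the limit. *)

Definition dot n (u v : 'cV[R]_n) : R := \sum_(i < n) u i ord0 * v i ord0.

Lemma dotE n (u v : 'cV[R]_n) : (u^T *m v) ord0 ord0 = dot u v.
Proof. by rewrite mxE; apply: eq_bigr => i _; rewrite mxE. Qed.

Lemma dotC n (u v : 'cV[R]_n) : dot u v = dot v u.
Proof. by apply: eq_bigr => i _; rewrite mulrC. Qed.

Lemma dotDl n (u v w : 'cV[R]_n) : dot (u + v) w = dot u w + dot v w.
Proof. by rewrite /dot -big_split; apply: eq_bigr => i _; rewrite mxE mulrDl. Qed.

Lemma dotZl n (c : R) (u w : 'cV[R]_n) : dot (c *: u) w = c * dot u w.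
Proof. by rewrite /dot mulr_sumr; apply: eq_bigr => i _; rewrite mxE mulrA. Qed.

Lemma dotDr n (u v w : 'cV[R]_n) : dot w (u + v) = dot w u + dot w v.
Proof. by rewrite dotC dotDl !(dotC w). Qed.

Lemma dotZr n (c : R) (u w : 'cV[R]_n) : dot w (c *: u) = c * dot w u.
Proof. by rewrite dotC dotZl dotC. Qed.

Lemma dot_ge0 n (u : 'cV[R]_n) : 0 <= dot u u.
Proof. by apply: sumr_ge0 => i _; rewrite -expr2 sqr_ge0. Qed.

Lemma enorm_sqr n (u : 'cV[R]_n) : enorm u ^+ 2 = dot u u.
Proof.
rewrite /enorm sqr_sqrtr; first by apply: eq_bigr => i _; rewrite expr2.
by apply: sumr_ge0 => i _; rewrite sqr_ge0.
Qed.

Lemma enorm_ge0 n (u : 'cV[R]_n) : 0 <= enorm u.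
Proof. exact: sqrtr_ge0. Qed.

Lemma enorm0 n : enorm (0 : 'cV[R]_n) = 0.
Proof.
by rewrite /enorm big1 ?sqrtr0// => i _; rewrite mxE expr0n.
Qed.

Lemma enormZ n (c : R) (u : 'cV[R]_n) : enorm (c *: u) = `|c| * enorm u.
Proof.
rewrite /enorm -sqrtr_sqr -sqrtrM ?sqr_ge0//; congr Num.sqrt.
by rewrite mulr_sumr; apply: eq_bigr => i _; rewrite mxE exprMn.
Qed.

Lemma enormN n (u : 'cV[R]_n) : enorm (- u) = enorm u.
Proof. by rewrite -scaleN1r enormZ normrN1 mul1r. Qed.

Lemma coord_le_enorm n (u : 'cV[R]_n) i : `|u i ord0| <= enorm u.
Proof.
rewrite -sqrtr_sqr ler_sqrt; last by apply: sumr_ge0 => j _; exact: sqr_ge0.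
rewrite (bigD1 i)//= lerDl; apply: sumr_ge0 => j _; exact: sqr_ge0.
Qed.

Lemma enorm_eq0 n (u : 'cV[R]_n) : enorm u = 0 -> u = 0.
Proof.
move=> u0; apply/matrixP => i j; rewrite ord1 mxE; apply/eqP.
by rewrite -normr_le0 -u0 coord_le_enorm.
Qed.

Lemma dot_le_enorm n (u v : 'cV[R]_n) : dot u v <= enorm u * enorm v.
Proof.
have [u0|u0] := eqVneq (enorm u) 0.
  rewrite (enorm_eq0 u0) enorm0 mul0r /dot big1// => i _.
  by rewrite mxE mul0r.
have [v0|v0] := eqVneq (enorm v) 0.
  rewrite (enorm_eq0 v0) enorm0 mulr0 /dot big1// => i _.
  by rewrite mxE mulr0.
have up : 0 < enorm u by rewrite lt_neqAle eq_sym u0 enorm_ge0.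
have vp : 0 < enorm v by rewrite lt_neqAle eq_sym v0 enorm_ge0.
(* Expanding this square gives 2 |u| |v| (|u| |v| - u.v) >= 0. *)
have := dot_ge0 (enorm v *: u - enorm u *: v).
rewrite -scaleNr !(dotDl, dotDr, dotZl, dotZr) -!enorm_sqr (dotC v u) => h.
have {}h : 0 <= (enorm u * enorm v) * (enorm u * enorm v - dot u v) by nra.
by rewrite pmulr_rge0 ?mulr_gt0// subr_ge0 in h.
Qed.

Lemma abs_dot_le n (u v : 'cV[R]_n) : `|dot u v| <= enorm u * enorm v.
Proof.
rewrite ler_norml dot_le_enorm andbT -(enormN u) lerNl -mulN1r -dotZl scaleN1r.
exact: dot_le_enorm.
Qed.

Lemma enormD n (u v : 'cV[R]_n) : enorm (u + v) <= enorm u + enorm v.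
Proof.
rewrite -(@ler_pXn2r _ 2)// ?nnegrE ?addr_ge0 ?enorm_ge0//.
rewrite enorm_sqr dotDl !dotDr (dotC v u) -!enorm_sqr.
have := dot_le_enorm u v; nra.
Qed.

Lemma enorm_le_sum n (u : 'cV[R]_n) : enorm u <= \sum_(i < n) `|u i ord0|.
Proof.
have s0 : 0 <= \sum_(i < n) `|u i ord0| by apply: sumr_ge0.
rewrite -(@ler_pXn2r _ 2)// ?nnegrE ?enorm_ge0//.
rewrite enorm_sqr expr2 /dot mulr_suml ler_sum// => i _.
rewrite (le_trans (ler_norm _))// normrM ler_wpM2l//.
by rewrite (bigD1 i)//= lerDl sumr_ge0.
Qed.

Lemma qformE n (u : 'cV[R]_n) A v : qform u A v = dot u (A *m v).
Proof. by rewrite /qform -mulmxA dotE. Qed.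

Lemma is_inv_sqrt_sym n (A S : 'M[R]_n) : is_inv_sqrt A S -> S^T = S.
Proof. by case=> _ []. Qed.

Lemma dot_sym n (S : 'M[R]_n) (u v : 'cV[R]_n) : S^T = S ->
  dot (S *m u) v = dot u (S *m v).
Proof.
by move=> ST; rewrite -!dotE trmx_mul ST mulmxA.
Qed.

Lemma qform_inv_sqrt n (A S : 'M[R]_n) (u : 'cV[R]_n) : is_inv_sqrt A S ->
  qform u (invmx A) u = enorm (S *m u) ^+ 2.
Proof.
move=> AS; case: (AS) => _ _ <-.
by rewrite qformE enorm_sqr (dot_sym _ _ (is_inv_sqrt_sym AS)) mulmxA.
Qed.

Lemma enorm_mulmx_le_opnorm n (B : 'M[R]_n) (u : 'cV[R]_n) :
  enorm (B *m u) <= opnorm B * enorm u.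
Proof.
(* [sup] is 0 on an unbounded set, so the image of the unit ball must first be bounded; the sum of
   the absolute entries does it. *)
have hB : has_sup [set enorm (B *m u) | u in [set u : 'cV[R]_n | enorm u <= 1]].
  split.
    by exists (enorm (B *m 0)); exists 0; rewrite //= enorm0 ler01.
  exists (\sum_i \sum_j `|B i j|) => _ [v /= v1 <-].
  rewrite (le_trans (enorm_le_sum _))// ler_sum// => i _.
  rewrite mxE (le_trans (ler_norm_sum _ _ _))// ler_sum// => j _.
  by rewrite normrM ler_piMr// (le_trans (coord_le_enorm v j)).
have [u0|u0] := eqVneq (enorm u) 0.
  by rewrite (enorm_eq0 u0) mulmx0 !enorm0 mulr0.
have up : 0 < enorm u by rewrite lt_neqAle eq_sym u0 enorm_ge0.
rewrite -ler_pdivrMr//.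
rewrite (_ : _ / _ = enorm (B *m ((enorm u)^-1 *: u))).
  apply: ub_le_sup; first by case: hB.
  exists ((enorm u)^-1 *: u) => //=.
  by rewrite enormZ ger0_norm ?invr_ge0 ?enorm_ge0// mulVf.
by rewrite -scalemxAr enormZ ger0_norm ?invr_ge0 ?enorm_ge0// mulrC.
Qed.

Lemma qform_le_opnorm n (B : 'M[R]_n) (u : 'cV[R]_n) :
  qform u B u <= opnorm B * enorm u ^+ 2.
Proof.
rewrite qformE (le_trans (dot_le_enorm _ _))//.
rewrite expr2 mulrCA ler_wpM2l ?enorm_ge0//; exact: enorm_mulmx_le_opnorm.
Qed.

End EuclideanNorm.

(** * Integrals of real-valued functions *)

Section RealIntegrals.
Context d (T : measurableType d) (R : realType) (mu : {finite_measure set T -> \bar R}).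
Implicit Types f g : T -> R.

Definition intble f := mu.-integrable setT (EFin \o f).

Lemma intble_measurable f : intble f -> measurable_fun setT f.
Proof. by move=> /(measurable_int mu) /measurable_EFinP. Qed.

Lemma EFin_Rintegral f : intble f -> (\int[mu]_x (f x)%:E)%E = (\int[mu]_x f x)%:E.
Proof. by move=> h; rewrite /Rintegral fineK//; exact: integrable_fin_num. Qed.

Lemma intble_bounded f (C : R) : measurable_fun setT f ->
  (forall x, `|f x| <= C) -> intble f.
Proof.
move=> mf fC; apply: measurable_bounded_integrable => //.
  by rewrite -ge0_fin_numE ?fin_num_measure.
exists C; split; first exact: num_real.
by move=> M CM w _ /=; rewrite (le_trans (fC w))// ltW.
Qed.

Lemma intble_cst (c : R) : intble (fun=> c).
Proof. exact: (@intble_bounded _ `|c|). Qed.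

Lemma intbleD f g : intble f -> intble g -> intble (fun x => f x + g x).
Proof. by move=> hf hg; have := integrableD measurableT hf hg. Qed.

Lemma intbleN f : intble f -> intble (fun x => - f x).
Proof. by move=> hf; have := integrableN hf. Qed.

Lemma intbleB f g : intble f -> intble g -> intble (fun x => f x - g x).
Proof. by move=> hf hg; apply: intbleD => //; exact: intbleN. Qed.

Lemma intbleZl (c : R) f : intble f -> intble (fun x => c * f x).
Proof. by move=> hf; have := integrableZl measurableT c hf. Qed.

Lemma intbleZr (c : R) f : intble f -> intble (fun x => f x * c).
Proof.
move=> hf; rewrite (_ : (fun x => _) = (fun x => c * f x)); first exact: intbleZl.
by apply/funext => x; rewrite mulrC.
Qed.

Lemma intble_sum I (s : seq I) (p : pred I) (F : I -> T -> R) :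
  (forall i, p i -> intble (F i)) -> intble (fun x => \sum_(i <- s | p i) F i x).
Proof.
move=> h; elim: s => [|a s IH].
  rewrite (_ : (fun x => _) = (fun=> 0)); first exact: intble_cst.
  by apply/funext => x; rewrite big_nil.
rewrite (_ : (fun x => _) = (fun x => (if p a then F a x else 0) +
    \sum_(i <- s | p i) F i x)).
  apply: intbleD => //; case pa: (p a); [exact: h|exact: intble_cst].
by apply/funext => x; rewrite big_cons; case: ifP; rewrite ?add0r.
Qed.

Lemma intble_norm f : intble f -> intble (fun x => `|f x|).
Proof. by move=> hf; have := integrable_abse hf. Qed.

Lemma intble_le f g : measurable_fun setT f -> intble g ->
  (forall x, `|f x| <= g x) -> intble f.
Proof.
move=> mf ig fg; apply: (le_integrable measurableT _ _ ig).
  exact/measurable_EFinP.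
by move=> x _ /=; rewrite lee_fin (le_trans (fg x))// ler_norm.
Qed.

Lemma Rintegral_setT_cst (c : R) : \int[mu]_(x in setT) c = c * fine (mu setT).
Proof. by rewrite Rintegral_cst. Qed.

Lemma Rint_le f g : intble f -> intble g -> (forall x, f x <= g x) ->
  \int[mu]_x f x <= \int[mu]_x g x.
Proof. by move=> hf hg h; apply: le_Rintegral => //. Qed.

Lemma RintD f g : intble f -> intble g ->
  \int[mu]_x (f x + g x) = \int[mu]_x f x + \int[mu]_x g x.
Proof. by move=> hf hg; rewrite RintegralD. Qed.

Lemma RintB f g : intble f -> intble g ->
  \int[mu]_x (f x - g x) = \int[mu]_x f x - \int[mu]_x g x.
Proof. by move=> hf hg; rewrite RintegralB. Qed.

Lemma RintZl (c : R) f : intble f -> \int[mu]_x (c * f x) = c * \int[mu]_x f x.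
Proof. by move=> hf; rewrite RintegralZl. Qed.

Lemma RintZr (c : R) f : intble f -> \int[mu]_x (f x * c) = (\int[mu]_x f x) * c.
Proof. by move=> hf; rewrite RintegralZr. Qed.

Lemma Rint_sum I (s : seq I) (p : pred I) (F : I -> T -> R) :
  (forall i, p i -> intble (F i)) ->
  \int[mu]_x (\sum_(i <- s | p i) F i x) = \sum_(i <- s | p i) \int[mu]_x (F i x).
Proof.
move=> h; elim: s => [|a s IH].
  rewrite big_nil; under eq_Rintegral do rewrite big_nil.
  by rewrite Rintegral_setT_cst mul0r.
rewrite big_cons; under eq_Rintegral do rewrite big_cons.
case: ifP => pa; last exact: IH.
by rewrite RintD ?IH//; [exact: h|exact: intble_sum].
Qed.

Lemma Rint_norm_le f : intble f -> `|\int[mu]_x f x| <= \int[mu]_x `|f x|.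
Proof. by move=> hf; apply: le_normr_Rintegral. Qed.

End RealIntegrals.

Section RealExpectations.
Context d (T : measurableType d) (R : realType) (mu : probability T R).

Lemma Rint_cst (c : R) : \int[mu]_x c = c.
Proof.
rewrite Rintegral_setT_cst -[RHS]mulr1; congr (_ * _).
by rewrite -[RHS]/(fine (1%:E : \bar R)); congr fine; exact: probability_setT.
Qed.

Lemma Rint_indic (A : set T) : measurable A -> \int[mu]_x (\1_A x : R) = fine (mu A).
Proof. by move=> mA; rewrite /Rintegral integral_indic// setIT. Qed.

Lemma intble_indic (A : set T) : measurable A -> intble mu (\1_A : T -> R).
Proof.
move=> mA; apply: (@intble_bounded _ _ _ _ _ 1); first exact: measurable_indic.
by move=> w; rewrite indicE; case: (_ \in _); rewrite ?normr1 ?normr0.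
Qed.

Lemma Rint_dist (f g : T -> R) (e : R) : intble mu f -> intble mu g ->
  (forall x, `|f x - g x| <= e) -> `|\int[mu]_x f x - \int[mu]_x g x| <= e.
Proof.
move=> hf hg h; rewrite -RintB// (le_trans (Rint_norm_le (intbleB hf hg)))//.
rewrite -[leRHS](Rint_cst e); apply: Rint_le => //; last exact: intble_cst.
by apply: intble_norm; exact: intbleB.
Qed.

End RealExpectations.

(** * Outer probability and weak convergence *)

Section Outer.
Context {R : realType} {dO : measure_display} {Om : measurableType dO}.
Variable P : probability Om R.

(** Epsilon form of outer probabilities tending to 0; it passes to subsets and finite unions without
    any measurability. *)
Definition vanish (B : nat -> set Om) : Prop := forall e : R, 0 < e ->
  \forall n \near \oo, ((P^* (B n))%mu <= e%:E)%E.

Lemma oprob_ge0 (A : set Om) : (0 <= (P^* A)%mu)%E.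
Proof. exact: mu_ext_ge0. Qed.

Lemma oprob_le (A B : set Om) : A `<=` B -> ((P^* A)%mu <= (P^* B)%mu)%E.
Proof. by move=> AB; exact: le_mu_ext. Qed.

Lemma oprobE (A : set Om) : measurable A -> (P^* A)%mu = P A.
Proof. by move=> mA; rewrite measurable_mu_extE. Qed.

Lemma oprob_le1 (A : set Om) : ((P^* A)%mu <= 1)%E.
Proof.
by rewrite (le_trans (oprob_le (@subsetT _ A)))// oprobE// probability_setT.
Qed.

Lemma oprob_fin (A : set Om) : (P^* A)%mu \is a fin_num.
Proof.
by rewrite ge0_fin_numE ?oprob_ge0// (le_lt_trans (oprob_le1 _))// ltry.
Qed.

Lemma oprobU (A B : set Om) : ((P^* (A `|` B))%mu <= (P^* A)%mu + (P^* B)%mu)%E.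
Proof. exact: (outer_measureU2 (mu_ext P)). Qed.

(** The outer measure is an infimum over countable measurable covers; the union of a nearly optimal
    cover serves as [C]. *)
Lemma oprob_cover (A : set Om) (e : R) : 0 < e -> exists2 C : set Om,
  measurable C /\ A `<=` C & (P C <= (P^* A)%mu + e%:E)%E.
Proof.
move=> e0.
have : ((P^* A)%mu < (P^* A)%mu + e%:E)%E by rewrite lteDl ?oprob_fin ?lte_fin.
move=> /ereal_inf_lt[_ [F [mF AF] <-]] /ltW h.
exists (\bigcup_k F k); first by split => //; exact: bigcup_measurable.
apply: le_trans h; apply: measure_sigma_subadditive => //.
exact: bigcup_measurable.
Qed.

Lemma vanishP (B : nat -> set Om) :
  ((P^* (B n))%mu @[n --> \oo] --> 0%E) <-> vanish B.
Proof.
split.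
- move=> /fine_cvgP[_ /cvgrPdist_le h] e e0; have := h e e0.
  apply: filterS => n /=; rewrite sub0r normrN ger0_norm ?fine_ge0 ?oprob_ge0//.
  by rewrite -lee_fin fineK// oprob_fin.
- move=> h; apply/fine_cvgP; split; first by near=> n; exact: oprob_fin.
  apply/cvgrPdist_le => e e0; have := h e e0; apply: filterS => n /=.
  rewrite sub0r normrN ger0_norm ?fine_ge0 ?oprob_ge0//.
  by rewrite -lee_fin fineK// oprob_fin.
Unshelve. all: by end_near. Qed.

Lemma oP_vanish (X : nat -> Om -> R) r :
  oP P X r <-> forall e : R, 0 < e -> vanish (fun n => [set w | e * r n < `|X n w|]).
Proof. by split => h e e0; apply/vanishP; exact: h. Qed.

Lemma vanish_sub (A B : nat -> set Om) : vanish B ->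
  (\forall n \near \oo, A n `<=` B n) -> vanish A.
Proof.
move=> vB AB e e0; near=> n; apply: (@le_trans _ _ (P^* (B n))%mu).
  by apply: oprob_le; near: n.
by near: n; exact: vB.
Unshelve. all: by end_near. Qed.

Lemma vanishU (A B : nat -> set Om) : vanish A -> vanish B ->
  vanish (fun n => A n `|` B n).
Proof.
move=> vA vB e e0; near=> n; rewrite (le_trans (oprobU _ _))//.
rewrite (splitr e) EFinD leeD//; near: n; [apply: vA|apply: vB];
  by rewrite divr_gt0.
Unshelve. all: by end_near. Qed.

(** This is how an O_P bound is used: its constant depends on e, so the event where the bound fails
    is discarded first, and the rest of the argument runs with the constant fixed. *)
Lemma vanish_tight (A : nat -> set Om) : (forall e : R, 0 < e ->
    exists2 B : nat -> set Om,
      \forall n \near \oo, ((P^* (B n))%mu <= e%:E)%E &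
      vanish (fun n => A n `\` B n)) -> vanish A.
Proof.
move=> h e e0; have e2 : 0 < e / 2 by rewrite divr_gt0.
have [B hB vA] := h _ e2; near=> n.
rewrite (le_trans (oprob_le (_ : A n `<=` (A n `\` B n) `|` B n)))//.
  by move=> w Aw; have [Bw|Bw] := pselect (B n w); [right|left].
rewrite (le_trans (oprobU _ _))// (splitr e) EFinD leeD//.
  by near: n; apply: vA.
by near: n.
Unshelve. all: by end_near. Qed.

Local Notation oexp := (outer_expectation P).

(** From an integrable majorant u of g2 one gets the majorant u + e + c 1_C of g1, with [C] a
    measurable cover of the exceptional set [B], on which only the crude bound with c is
    available. *)
Lemma oexp_le (g1 g2 : Om -> R) (B : set Om) (e c : R) : 0 <= c ->
  (forall w, g1 w <= g2 w + e) \/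
  (forall w, ~ B w -> g1 w <= g2 w + e) /\ (forall w, g1 w <= g2 w + e + c) ->
  (oexp g1 <= oexp g2 + e%:E + c%:E * (P^* B)%mu)%E.
Proof.
move=> c0 h.
have {}h : (forall w, ~ B w -> g1 w <= g2 w + e) /\
    (forall w, g1 w <= g2 w + e + c).
  by case: h => // h; split => w //; rewrite (le_trans (h w))// lerDl.
case: h => hB hA.
apply/lee_addgt0Pr => d d0.
(* The cover is weighted by c, and c d / (c + 1) <= d also when c = 0. *)
have d1 : 0 < d / (c + 1) by rewrite divr_gt0// ltr_wpDl.
have [C [mC BC] PC] := oprob_cover B d1.
have fB : (P^* B)%mu = (fine (P^* B)%mu)%:E by rewrite fineK// oprob_fin.
have fC : P C = (fine (P C))%:E by rewrite fineK// fin_num_measure.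
rewrite fB -EFinM -!addeA -!EFinD -leeBlDr//.
apply: le_ereal_inf_tmp => _ [u [iu gu] <-]; rewrite leeBlDr//.
have iC : intble P (fun w => e + c * \1_C w).
  by apply: intbleD; [exact: intble_cst|apply: intbleZl; exact: intble_indic].
have iuC := intbleD iu iC.
apply: (@le_trans _ _ (\int[P]_w (u w + (e + c * \1_C w))%:E)%E).
  apply: ge_ereal_inf; exists (\int[P]_w (u w + (e + c * \1_C w))%:E)%E => //.
  exists (fun w => u w + (e + c * \1_C w)) => //; split => //.
  move=> w; have [Cw|Cw] := pselect (C w).
    rewrite indicE mem_set// mulr1 (le_trans (hA w))// -addrA lerD2r.
    exact: gu.
  rewrite indicE memNset// mulr0 addr0 (le_trans (hB _ _))//.
    by move=> /BC.
  by rewrite lerD2r.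
rewrite !EFin_Rintegral// -EFinD lee_fin RintD// lerD2l RintD//; last 2 first.
- exact: intble_cst.
- by apply: intbleZl; exact: intble_indic.
rewrite Rint_cst lerD2l RintZl; last exact: intble_indic.
rewrite Rint_indic//.
move: PC; rewrite fB fC -EFinD lee_fin => PC.
rewrite (le_trans (ler_wpM2l c0 PC))// mulrDr lerD2l.
by rewrite mulrA ler_pdivrMr ?ltr_wpDl// [leRHS]mulrC ler_wpM2r ?lerDl// ltW.
Qed.

Lemma oexpE (g : Om -> R) (C : R) : measurable_fun setT g ->
  (forall w, `|g w| <= C) -> oexp g = (\int[P]_w (g w)%:E)%E.
Proof.
move=> mg gC; have ig := intble_bounded P mg gC.
apply/eqP; rewrite eq_le; apply/andP; split.
  apply: ge_ereal_inf; exists (\int[P]_w (g w)%:E)%E => //.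
  by exists g.
apply: le_ereal_inf_tmp => _ [u [iu gu] <-].
by apply: le_integral => // w _; rewrite lee_fin.
Qed.

Lemma oexp_cst (a : R) : oexp (fun=> a) = a%:E.
Proof.
by rewrite (@oexpE _ `|a|)// EFin_Rintegral ?Rint_cst//; exact: intble_cst.
Qed.

Lemma oexp_homo (g1 g2 : Om -> R) : (forall w, g1 w <= g2 w) ->
  (oexp g1 <= oexp g2)%E.
Proof.
move=> h; have := @oexp_le g1 g2 set0 0 0 (lexx 0).
by rewrite mul0e !adde0; apply; left => w; rewrite addr0.
Qed.

Lemma oexp_fin (g : Om -> R) C : (forall w, `|g w| <= C) -> oexp g \is a fin_num.
Proof.
move=> gC; rewrite fin_real//; apply/andP; split.
  rewrite (@lt_le_trans _ _ (- C)%:E) ?ltNyr// -oexp_cst.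
  by apply: oexp_homo => w; have := gC w; rewrite ler_norml => /andP[].
rewrite (@le_lt_trans _ _ C%:E) ?ltry// -[leRHS]oexp_cst.
by apply: oexp_homo => w; have := gC w; rewrite ler_norml => /andP[].
Qed.

(** For every integrable majorant u of g, the measurable event {u >= 1} contains [B] and has
    probability at most the integral of u. *)
Lemma oprob_le_oexp (B : set Om) (g : Om -> R) :
  (forall w, 0 <= g w) -> (forall w, B w -> 1 <= g w) ->
  ((P^* B)%mu <= oexp g)%E.
Proof.
move=> g0 g1; apply: le_ereal_inf_tmp => _ [u [iu gu] <-].
have mu := intble_measurable iu.
have mC : measurable [set w | 1 <= u w].
  rewrite (_ : [set _ | _] = u @^-1` `[1, +oo[).
    rewrite -[X in measurable X]setTI; exact: mu.
  by apply/seteqP; split => w /=; rewrite in_itv/= andbT.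
rewrite (le_trans (oprob_le (_ : B `<=` [set w | 1 <= u w])))//.
  by move=> w Bw /=; rewrite (le_trans (g1 _ Bw)).
rewrite oprobE//.
rewrite EFin_Rintegral// -[X in (X <= _)%E]fineK ?fin_num_measure// lee_fin.
rewrite -Rint_indic//; apply: Rint_le => //; first exact: intble_indic.
move=> w; rewrite indicE; case: (boolP (_ \in _)) => [/set_mem//|_].
by rewrite (le_trans (g0 w)).
Qed.

End Outer.

Section UniformContinuity.
Context {R : realType}.

(** Heine's theorem with only x confined to the interval: in the applications, y is a nearby point
    that may leave it. *)
Lemma continuous_uniform_itv (f : R -> R) (K e : R) : continuous f -> 0 < e ->
  exists2 dl : R, 0 < dl &
    forall x y, `|x| <= K -> `|x - y| <= dl -> `|f x - f y| <= e.
Proof.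
move=> cf e0.
have cK : compact `[- K, K]%classic by exact: segment_compact.
pose Q (dl : R) (x : R) := forall y, `|x - y| <= dl -> `|f x - f y| <= e.
have e2 : 0 < e / 2 by rewrite divr_gt0.
have : \forall dl \near (0 : R)^'+, `[- K, K]%classic `<=` Q dl.
  apply: (compact_near_coveringP _).1 => // x _.
  have /cvgrPdist_le/(_ _ e2)/nbhs_ballP[r /= r0 hr] := cf x.
  have r2 : 0 < r / 2 by rewrite divr_gt0.
  exists (ball x (r / 2), [set dl | dl < r / 2]) => /=.
    split; first exact: nbhsx_ballx.
    exact: nbhs_right_lt.
  move=> [x' dl] /= [xx' dlr] y xy.
  have h1 : `|f x - f x'| <= e / 2.
    by apply: hr; rewrite /ball/= (lt_le_trans xx')// ler_pdivrMr// ler_peMr ?ltW// ltr1n.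
  have h2 : `|f x - f y| <= e / 2.
    apply: hr; rewrite /ball/= -(subrK x' x) -addrA (le_lt_trans (ler_normD _ _))//.
    by rewrite (splitr r) ltrD// (le_lt_trans xy).
  rewrite -(subrK (f x) (f x')) -addrA (le_trans (ler_normD _ _))//.
  by rewrite (splitr e) lerD// distrC.
move=> h; have : \forall dl \near (0 : R)^'+, 0 < dl /\ `[- K, K]%classic `<=` Q dl.
  by near=> dl; split; [near: dl; exact: nbhs_right_gt|near: dl].
case/filter_ex => dl [dl0 hdl]; exists dl => // x y xK xy.
by apply: hdl => //=; rewrite in_itv/= -ler_norml.
Unshelve. all: by end_near. Qed.

End UniformContinuity.

Section Tail.
Context {R : realType} d (T : measurableType d) (nu : probability T R) (g : T -> R).
Hypothesis mg : measurable_fun setT g.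

Lemma measurable_norm_gt (K : R) : measurable [set t | K < `|g t|].
Proof.
rewrite (_ : [set _ | _] = (fun t => `|g t|) @^-1` `]K, +oo[).
  rewrite -[X in measurable X]setTI.
  by apply: (measurableT_comp _ mg).
by apply/seteqP; split => w /=; rewrite in_itv/= andbT.
Qed.

Lemma tail_small (e : R) : 0 < e ->
  exists2 K : R, 0 <= K & fine (nu [set t | K < `|g t|]) <= e.
Proof.
move=> e0; pose F (n : nat) := [set t | (n%:R : R) < `|g t|].
have : nu \o F @ \oo --> nu (\bigcap_n F n).
  apply: nonincreasing_cvg_mu => //.
  - by rewrite -ge0_fin_numE ?fin_num_measure//; exact: measurable_norm_gt.
  - by move=> n; exact: measurable_norm_gt.
  - by apply: bigcap_measurable => [|n _]; [exists 0%N|exact: measurable_norm_gt].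
  - move=> m n mn; apply/subsetPset => t; rewrite /F/=; apply: le_lt_trans.
    by rewrite ler_nat.
rewrite (_ : \bigcap_n F n = set0); last first.
  apply/seteqP; split => // t /(_ (Num.trunc `|g t|).+1 I); rewrite /F/=.
  by rewrite ltNge ltW// truncnS_gt.
rewrite measure0 => /fine_cvgP[_ /cvgrPdist_le/(_ _ e0)].
case/filter_ex => n /=; rewrite sub0r normrN => h; exists n%:R => //.
by rewrite (le_trans _ h)// ler_norm.
Qed.

End Tail.

Section WeakConvergence.
Context {R : realType} {dO : measure_display} {Om : measurableType dO}.
Variable P : probability Om R.
Context d (T : measurableType d) (nu : probability T R) (g : T -> R).
Hypothesis mg : measurable_fun setT g.

Local Notation oexp := (outer_expectation P).
(** [normal_law] and [chi2_law] are both of this form, so one Slutsky argument serves the two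
    limits. *)
Definition law_of (f : R -> R) : \bar R := (\int[nu]_t (f (g t))%:E)%E.

Lemma intble_comp (f : R -> R) C : continuous f -> (forall x, `|f x| <= C) ->
  intble nu (f \o g).
Proof.
move=> cf fC; apply: (@intble_bounded _ _ _ _ _ C) => [|x]; last exact: fC.
by apply: measurableT_comp => //; exact: continuous_measurable_fun.
Qed.

Lemma oexp_cvgP (G : nat -> Om -> R) (C l : R) : (forall n w, `|G n w| <= C) ->
  (oexp (G n) @[n --> \oo] --> l%:E) <->
  (forall e : R, 0 < e -> \forall n \near \oo, `|fine (oexp (G n)) - l| <= e).
Proof.
move=> GC; split.
  move=> /fine_cvgP[_ /cvgrPdist_le h] e /h; apply: filterS => n /=.
  by rewrite distrC.
move=> h; apply/fine_cvgP; split.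
  by near=> n; apply: (@oexp_fin _ _ _ _ _ C).
by apply/cvgrPdist_le => e /h; apply: filterS => n /=; rewrite distrC.
Unshelve. all: by end_near. Qed.

Lemma oexp_dist (g1 g2 : Om -> R) (B : set Om) (C e b : R) :
  0 <= C -> (forall w, `|g1 w| <= C) -> (forall w, `|g2 w| <= C) ->
  (forall w, ~ B w -> `|g1 w - g2 w| <= e) -> ((P^* B)%mu <= b%:E)%E -> 0 <= e ->
  `|fine (oexp g1) - fine (oexp g2)| <= e + 2 * C * b.
Proof.
move=> C0 C1 C2 h Bb e0.
suff key : forall g1 g2 : Om -> R, (forall w, `|g1 w| <= C) ->
    (forall w, `|g2 w| <= C) -> (forall w, ~ B w -> `|g1 w - g2 w| <= e) ->
    fine (oexp g1) <= fine (oexp g2) + (e + 2 * C * b).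
  rewrite ler_norml lerBlDl key// andbT lerBrDl lerBlDr key// => w Bw.
  by rewrite distrC h.
move=> {C1 C2 h} {}g1 {}g2 C1 C2 h.
have C20 : 0 <= 2 * C by rewrite mulr_ge0.
have := @oexp_le _ _ _ P g1 g2 B e (2 * C) C20.
rewrite -(fineK (oexp_fin P C1)) -(fineK (oexp_fin P C2)).
rewrite -(fineK (oprob_fin P B)) -EFinM -!EFinD lee_fin => H.
rewrite (le_trans (H _))//.
  right; split => w; first by move=> /h; rewrite ler_norml lerBlDl => /andP[].
  have := C1 w; have := C2 w; rewrite !ler_norml => /andP[a _] /andP[_ b'].
  lra.
by rewrite -addrA lerD2l lerD2l ler_wpM2l// -lee_fin fineK// oprob_fin.
Qed.

(** It vanishes for |x| <= K and is 1 for |x| >= K + 1. Testing weak convergence on it transfers the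
    tail bound of the limit law to the sequence. *)
Definition cutoff (K x : R) : R := Num.min 1 (Num.max 0 (`|x| - K)).

Lemma cutoff_continuous K : continuous (cutoff K).
Proof.
move=> x; rewrite /cutoff.
apply: (@continuous_min _ _ (fun=> 1) (fun x => Num.max 0 (`|x| - K))).
  exact: cvg_cst.
apply: (@continuous_max _ _ (fun=> 0) (fun x => (`|x| - K))).
  exact: cvg_cst.
by apply: cvgB; [exact: norm_continuous|exact: cvg_cst].
Qed.

Lemma cutoff_ge0 K x : 0 <= cutoff K x.
Proof. by rewrite /cutoff le_min ler01 le_max lexx. Qed.

Lemma cutoff_le1 K x : cutoff K x <= 1.
Proof. by rewrite /cutoff ge_min lexx. Qed.

Lemma cutoff_norm K x : `|cutoff K x| <= 1.
Proof. by rewrite ger0_norm ?cutoff_ge0// cutoff_le1. Qed.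

Lemma cutoff_eq1 K x : K + 1 <= `|x| -> cutoff K x = 1.
Proof.
move=> h; rewrite /cutoff; apply/min_idPl; rewrite le_max; apply/orP; right.
lra.
Qed.

Lemma cutoff_eq0 K x : `|x| <= K -> cutoff K x = 0.
Proof.
move=> h; rewrite /cutoff; apply/eqP; rewrite eq_le; apply/andP; split.
  by rewrite ge_min; apply/orP; right; rewrite ge_max lexx subr_le0.
by rewrite cutoff_ge0.
Qed.

Lemma law_cutoff (K : R) :
  \int[nu]_t (cutoff K (g t)) <= fine (nu [set t | K < `|g t|]).
Proof.
rewrite -Rint_indic; last exact: measurable_norm_gt.
apply: Rint_le.
- exact: (intble_comp (@cutoff_continuous K) (@cutoff_norm K)).
- by apply: intble_indic; exact: measurable_norm_gt.
- move=> t; rewrite indicE; case: (boolP (_ \in _)) => [_|]; first exact: cutoff_le1.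
  by move=> /negP; rewrite inE/= => /negP; rewrite -leNgt => /cutoff_eq0 ->.
Qed.

(** A bounded continuous f is only uniformly continuous on compact sets, so tightness of X comes
    first, by way of [cutoff]; outside an event of small outer probability, f (W n) and f (X n) are
    then close. *)
Lemma slutsky (X W : nat -> Om -> R) :
  (forall e : R, 0 < e -> vanish P (fun n => [set w | e < `|W n w - X n w|])) ->
  cvg_in_law P X law_of -> cvg_in_law P W law_of.
Proof.
move=> XW cX f cf [C fC].
have C0 : 0 <= C by rewrite (le_trans _ (fC 0)).
have lE : law_of f = (\int[nu]_t (f (g t)))%:E.
  by rewrite /law_of EFin_Rintegral//; exact: intble_comp.
have := cX _ cf (ex_intro _ C fC); rewrite lE => /(oexp_cvgP _ (fun n w => fC _)) hf.
apply/(oexp_cvgP _ (fun n w => fC _)) => e e0.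
(* The errors below add up to at most (2 + 6 C) e1. *)
pose e1 := e / (4 + 8 * C).
have D0 : 0 < 4 + 8 * C by rewrite ltr_pwDl// mulr_ge0.
have e10 : 0 < e1 by rewrite divr_gt0.
have [K K0 hK] := tail_small nu mg e10.
have := cX _ (@cutoff_continuous K) (ex_intro _ 1 (@cutoff_norm K)).
rewrite {1}/law_of EFin_Rintegral; last first.
  exact: (intble_comp (@cutoff_continuous K) (@cutoff_norm K)).
move/(oexp_cvgP _ (fun n w => cutoff_norm _ _)) => /(_ _ e10) hc.
have [dl dl0 hdl] := continuous_uniform_itv (K + 1) cf e10.
near=> n.
have B1 : ((P^* [set w | (K + 1 < `|X n w|)%R])%mu <= (2 * e1)%:E)%E.
  apply: (@le_trans _ _ (oexp (fun w => cutoff K (X n w)))).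
    apply: oprob_le_oexp => w; first exact: cutoff_ge0.
    by move=> /= /ltW /cutoff_eq1 ->.
  rewrite -(fineK (oexp_fin P (fun w => cutoff_norm K (X n w)))) lee_fin.
  have : `|fine (oexp (fun w => cutoff K (X n w))) -
    \int[nu]_t (cutoff K (g t))| <= e1 by near: n.
  have := law_cutoff K.
  rewrite ler_norml => h1 /andP[_ h2]; lra.
have B2 : ((P^* [set w | (dl < `|W n w - X n w|)%R])%mu <= e1%:E)%E.
  by near: n; exact: XW.
pose B := [set w | K + 1 < `|X n w|] `|` [set w | dl < `|W n w - X n w|].
have hB : ((P^* B)%mu <= (3 * e1)%:E)%E.
  rewrite (le_trans (oprobU _ _ _))// (_ : 3 * e1 = 2 * e1 + e1); last by ring.
  by rewrite EFinD leeD.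
have := @oexp_dist (fun w => f (W n w)) (fun w => f (X n w)) B C e1 (3 * e1)
  C0 (fun=> fC _) (fun=> fC _).
move=> /(_ _ hB (ltW e10)) H.
have {}H : `|fine (oexp (fun w => f (W n w))) - fine (oexp (fun w => f (X n w)))|
    <= e1 + 2 * C * (3 * e1).
  apply: H => w /not_orP[/negP]; rewrite -leNgt => XK /negP.
  by rewrite -leNgt distrC => WX; rewrite distrC hdl.
have h3 : `|fine (oexp (fun w => f (X n w))) - \int[nu]_t f (g t)| <= e1.
  by near: n; exact: hf.
rewrite -(subrK (fine (oexp (fun w => f (X n w)))) (fine (oexp (fun w => f (W n w))))).
rewrite -addrA (le_trans (ler_normD _ _))// (le_trans (lerD H h3))//.
have -> : e = 4 * e1 + 8 * (C * e1) by rewrite /e1; field; rewrite gt_eqF.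
have : 0 <= C * e1 by rewrite mulr_ge0// ltW.
lra.
Unshelve. all: by end_near. Qed.

End WeakConvergence.

(** * Weak convergence tested on smoothed steps *)

Section StepInterpolation.
Context {R : realType} (S f : R -> R) (x0 eta : R).
Hypothesis S_le0 : forall x, x <= 0 -> S x = 0.
Hypothesis S_ge1 : forall x, 1 <= x -> S x = 1.
Hypothesis eta0 : 0 < eta.

Definition node (i : nat) : R := x0 + i%:R * eta.

(* The steps make [interp] agree with [f] at the nodes and lie between two
   consecutive values of [f] elsewhere: weak convergence is tested on steps. *)
Definition interp (N : nat) (x : R) : R := f (node 0) +
  \sum_(0 <= i < N) (f (node i.+1) - f (node i)) * S ((x - node i) / eta).

Lemma step_node_ge i x : node i.+1 <= x -> S ((x - node i) / eta) = 1.
Proof.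
move=> h; apply: S_ge1; rewrite ler_pdivlMr// mul1r.
move: h; rewrite /node -natr1; lra.
Qed.

Lemma step_node_le i x : x <= node i -> S ((x - node i) / eta) = 0.
Proof. by move=> h; apply: S_le0; rewrite pmulr_lle0 ?invr_gt0// subr_le0. Qed.

Lemma node_le i j : (i <= j)%N -> node i <= node j.
Proof. by move=> ij; rewrite /node lerD2l ler_wpM2r ?ler_nat// ltW. Qed.

Lemma interp_left N x : x <= node 0 -> interp N x = f (node 0).
Proof.
move=> h; rewrite /interp big_nat big1 ?addr0// => i _.
by rewrite step_node_le ?mulr0// (le_trans h)// node_le.
Qed.

Lemma interp_right N x : node N <= x -> interp N x = f (node N).
Proof.
move=> h; rewrite /interp.
under eq_big_nat => i /andP[_ iN].
  rewrite step_node_ge ?mulr1; last by rewrite (le_trans _ h)// node_le.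
  over.
by rewrite telescope_sumr// addrC subrK.
Qed.

Lemma interp_mid N j x : (j < N)%N -> node j <= x <= node j.+1 ->
  interp N x = f (node j) + (f (node j.+1) - f (node j)) * S ((x - node j) / eta).
Proof.
move=> jN /andP[h1 h2]; rewrite /interp (@big_cat_nat _ _ _ j)//=; last exact: ltnW.
have := interp_right h1; rewrite /interp => H; rewrite addrA H.
congr (_ + _); rewrite big_ltn// big_nat big1 ?addr0// => i /andP[ji _].
by rewrite step_node_le ?mulr0// (le_trans h2)// node_le.
Qed.

End StepInterpolation.

Section Portmanteau.
Context {R : realType} {dO : measure_display} {Om : measurableType dO}.
Variable P : probability Om R.
Context d (T : measurableType d) (nu : probability T R) (g : T -> R).
Hypothesis mg : measurable_fun setT g.
Variable S : R -> R.
Hypothesis cS : continuous S.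
Hypothesis S01 : forall x, 0 <= S x <= 1.
Hypothesis S_le0 : forall x, x <= 0 -> S x = 0.
Hypothesis S_ge1 : forall x, 1 <= x -> S x = 1.
Variable X : nat -> Om -> R.
Hypothesis mX : forall n, measurable_fun setT (X n).

(** Bounded continuous functions whose expectations are known to converge. They form a vector space
    containing the constants and the steps, hence every interpolation. *)
Let good (f : R -> R) := [/\ continuous f, exists C : R, forall x, `|f x| <= C &
  forall e : R, 0 < e -> \forall n \near \oo,
    `|\int[P]_w f (X n w) - \int[nu]_t f (g t)| <= e].

Let good_intX f n : good f -> intble P (fun w => f (X n w)).
Proof.
case=> cf [C fC] _; apply: (@intble_bounded _ _ _ _ _ C) => //.
by apply: measurableT_comp => //; exact: continuous_measurable_fun.
Qed.

Let good_intg f : good f -> intble nu (fun t => f (g t)).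
Proof. by case=> cf [C fC] _; exact: (intble_comp _ mg cf fC). Qed.

Let goodD f1 f2 : good f1 -> good f2 -> good (fun x => f1 x + f2 x).
Proof.
move=> g1 g2; have [c1 [C1 b1] h1] := g1; have [c2 [C2 b2] h2] := g2; split.
- by move=> x; apply: cvgD; [exact: c1|exact: c2].
- by exists (C1 + C2) => x; rewrite (le_trans (ler_normD _ _))// lerD.
move=> e e0; have e2 : 0 < e / 2 by rewrite divr_gt0.
near=> n; rewrite !RintD; [|exact: good_intg|exact: good_intg|exact: good_intX..].
rewrite opprD addrACA (le_trans (ler_normD _ _))// (splitr e) lerD//; near: n.
  exact: h1.
exact: h2.
Unshelve. all: by end_near. Qed.

Let goodZ c f : good f -> good (fun x => c * f x).
Proof.
move=> gf; have [cf [C b] h] := gf; split.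
- by move=> x; apply: cvgM; [exact: cvg_cst|exact: cf].
- by exists (`|c| * C) => x; rewrite normrM ler_wpM2l.
move=> e e0; have c1 : 0 < `|c| + 1 by rewrite ltr_wpDl.
have e2 : 0 < e / (`|c| + 1) by rewrite divr_gt0.
near=> n; rewrite !RintZl; [|exact: good_intg|exact: good_intX].
rewrite -mulrBr normrM (@le_trans _ _ (`|c| * (e / (`|c| + 1))))//.
  by rewrite ler_wpM2l//; near: n; exact: h.
by rewrite mulrA ler_pdivrMr// mulrC ler_wpM2l ?lerDl// ltW.
Unshelve. all: by end_near. Qed.

Let good_cst c : good (fun=> c).
Proof.
split; [by move=> x; exact: cvg_cst|by exists `|c|; move=> _|].
move=> e e0; near=> n; rewrite !Rint_cst subrr normr0 ltW.
Unshelve. all: by end_near. Qed.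

Let good_sum (F : nat -> R -> R) m n : (forall i, good (F i)) ->
  good (fun x => \sum_(m <= i < n) F i x).
Proof.
move=> gF; elim: n => [|n IH].
  rewrite (_ : (fun x => _) = (fun=> 0)); first exact: good_cst.
  by apply/funext => x; rewrite big_geq.
have [mn|mn] := leqP m n; last first.
  rewrite (_ : (fun x => _) = (fun=> 0)); first exact: good_cst.
  by apply/funext => x; rewrite big_geq.
rewrite (_ : (fun x => _) = (fun x => \sum_(m <= i < n) F i x + F n x)).
  exact: goodD.
by apply/funext => x; rewrite big_nat_recr.
Qed.

Hypothesis steps : forall a eta : R, 0 < eta -> forall e : R, 0 < e ->
  \forall n \near \oo,
    `|\int[P]_w S ((X n w - a) / eta) - \int[nu]_t S ((g t - a) / eta)| <= e.

Let good_step a eta : 0 < eta -> good (fun x => S ((x - a) / eta)).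
Proof.
move=> eta0; split; last exact: steps.
- move=> x; apply: (cvg_comp (fun x => (x - a) / eta) S); last exact: cS.
  by apply: cvgM; [apply: cvgB; [exact: cvg_id|exact: cvg_cst]|exact: cvg_cst].
- exists 1 => x; have /andP[h0 h1] := S01 ((x - a) / eta).
  by rewrite ger0_norm.
Qed.

(** An arbitrary f is replaced by its interpolation s: the error is small on [-(K+1), K+1] and at
    most 2 C elsewhere. The mass elsewhere is controlled by chi, itself made of two steps, so
    tightness needs no separate argument. *)
Lemma cvg_in_law_steps : cvg_in_law P X (law_of nu g).
Proof.
move=> f cf [C fC].
have C0 : 0 <= C by rewrite (le_trans _ (fC 0)).
have ifg : intble nu (fun t => f (g t)) := intble_comp nu mg cf fC.
have ifX n : intble P (fun w => f (X n w)).
  apply: (@intble_bounded _ _ _ _ _ C) => //.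
  by apply: measurableT_comp => //; exact: continuous_measurable_fun.
rewrite {1}/law_of EFin_Rintegral//.
apply/(oexp_cvgP _ _ (fun n w => fC _)) => e e0.
pose e1 := e / (4 + 8 * C).
have D0 : 0 < 4 + 8 * C by rewrite ltr_pwDl// mulr_ge0.
have e10 : 0 < e1 by rewrite divr_gt0.
have [K K0 hK] := tail_small nu mg e10.
have [dl dl0 hdl] := continuous_uniform_itv (K + 1) cf e10.
(* Enough nodes on [-(K+1), K+1] for the mesh eta to be below the modulus dl. *)
pose N := (Num.trunc (2 * (K + 1) / dl)).+1.
have N0 : 0 < N%:R :> R by rewrite ltr0n.
pose eta := 2 * (K + 1) / N%:R.
have eta0 : 0 < eta by rewrite divr_gt0// mulr_gt0// ltr_wpDl.
have eta_dl : eta <= dl.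
  rewrite /eta ler_pdivrMr// [leRHS]mulrC -ler_pdivrMr// ltW//; exact: truncnS_gt.
pose s := interp S f (- (K + 1)) eta N.
have n0 : node (- (K + 1)) eta 0 = - (K + 1) by rewrite /node mul0r addr0.
have nN : node (- (K + 1)) eta N = K + 1.
  rewrite /node /eta mulrCA divff ?gt_eqF//; lra.
(* chi is 1 off [-(K+1), K+1] and 0 on [-K, K]: it dominates the indicator of the region where s is
   constant and is dominated by the tail indicator. *)
pose chi := fun x : R => 1 - S (x + K + 1) + S (x - K).
have gs : good s.
  apply: goodD; first exact: good_cst.
  by apply: good_sum => i; apply: goodZ; exact: good_step.
have gchi : good chi.
  apply: goodD; first apply: goodD.
  - exact: good_cst.
  - rewrite (_ : (fun x => _) = (fun x => (- 1) * S ((x - (- (K + 1))) / 1))).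
      by apply: goodZ; exact: good_step.
    by apply/funext => x; rewrite divr1 mulN1r opprK addrA.
  - rewrite (_ : (fun x => _) = (fun x => S ((x - K) / 1))).
      exact: good_step.
    by apply/funext => x; rewrite divr1.
have chi0 x : 0 <= chi x.
  rewrite /chi; have /andP[_ h1] := S01 (x + K + 1); have /andP[h2 _] := S01 (x - K).
  lra.
have sf x : `|f x - s x| <= e1 + 2 * C * chi x.
  have [xl|xl] := lerP x (- (K + 1)).
    have a1 : S (x + K + 1) = 0 by apply: S_le0; lra.
    have a2 : S (x - K) = 0 by apply: S_le0; lra.
    rewrite /chi a1 a2.
    rewrite /s interp_left ?n0// subr0 addr0 mulr1.
    rewrite (le_trans (ler_normB _ _))//; have := fC x.
    have := fC (- (K + 1)); lra.
  have [xr|xr] := lerP (K + 1) x.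
    have a1 : S (x + K + 1) = 1 by apply: S_ge1; lra.
    have a2 : S (x - K) = 1 by apply: S_ge1; lra.
    rewrite /chi a1 a2.
    rewrite /s interp_right ?nN// subrr add0r mulr1.
    rewrite (le_trans (ler_normB _ _))//; have := fC x.
    have := fC (K + 1); lra.
  pose j := Num.trunc ((x + (K + 1)) / eta).
  have q0 : 0 <= (x + (K + 1)) / eta by rewrite divr_ge0 ?ltW//; lra.
  have hj := trunc_itv q0.
  have j1 : node (- (K + 1)) eta j <= x.
    have /andP[h _] := hj; move: h; rewrite ler_pdivlMr//.
    rewrite /node -/j; lra.
  have j2 : x <= node (- (K + 1)) eta j.+1.
    have /andP[_ /ltW h] := hj; move: h; rewrite ler_pdivrMr//.
    rewrite /node -/j; lra.
  have jN : (j < N)%N.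
    rewrite -(ltr_nat R) (le_lt_trans (andP hj).1)// ltr_pdivrMr//.
    rewrite /eta mulrCA divff ?gt_eqF//; lra.
  rewrite /s (interp_mid _ S_le0 S_ge1 eta0 jN) ?j1//.
  set a := node _ _ j; set b := node _ _ j.+1.
  have ab : b - a = eta by rewrite /b /a /node -natr1; ring.
  have xK : `|x| <= K + 1 by rewrite ler_norml; apply/andP; split; lra.
  have fa : `|f x - f a| <= e1.
    by apply: hdl => //; rewrite ger0_norm ?subr_ge0// (le_trans _ eta_dl)// -ab lerD2r.
  have fb : `|f x - f b| <= e1.
    apply: hdl => //; rewrite distrC ger0_norm ?subr_ge0// (le_trans _ eta_dl)// -ab.
    by rewrite lerD2l lerN2.
  have /andP[t0 t1] := S01 ((x - a) / eta).
  set t := S _ in t0 t1 *.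
  rewrite (_ : _ - _ = (1 - t) * (f x - f a) + t * (f x - f b)); last by ring.
  rewrite (le_trans (ler_normD _ _))// !normrM (ger0_norm t0) ger0_norm ?subr_ge0//.
  have : 0 <= 2 * C * chi x by rewrite !mulr_ge0.
  have t1' : 0 <= 1 - t by rewrite subr_ge0.
  have := ler_wpM2l t0 fb; have := ler_wpM2l t1' fa; nra.
have chig : \int[nu]_t chi (g t) <= e1.
  rewrite (le_trans _ hK)// -Rint_indic; last exact: measurable_norm_gt.
  apply: Rint_le; first exact: good_intg.
    by apply: intble_indic; exact: measurable_norm_gt.
  move=> t; rewrite indicE; case: (boolP (_ \in _)) => [_|].
    rewrite /chi; have /andP[h2 h1] := S01 (g t + K + 1).
    have /andP[h3 h4] := S01 (g t - K).
    rewrite mulr1n.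
    have [gK|gK] := lerP (g t) K.
      have a2 : S (g t - K) = 0 by apply: S_le0; lra.
      by rewrite a2; lra.
    have a2 : S (g t + K + 1) = 1 by apply: S_ge1; lra.
    by rewrite a2; lra.
  move=> /negP; rewrite inE/= => /negP; rewrite -leNgt ler_norml => /andP[a b].
  have a1 : S (g t + K + 1) = 1 by apply: S_ge1; lra.
  have a2 : S (g t - K) = 0 by apply: S_le0; lra.
  by rewrite mulr0n /chi a1 a2; lra.
have key (d' : measure_display) (T' : measurableType d') (mu : probability T' R)
    (Y : T' -> R) : intble mu (fun t => f (Y t)) -> intble mu (fun t => s (Y t)) ->
    intble mu (fun t => chi (Y t)) ->
    `|\int[mu]_t f (Y t) - \int[mu]_t s (Y t)| <= e1 + 2 * C * \int[mu]_t chi (Y t).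
  move=> iF is_ ichi; rewrite -RintB// (le_trans (Rint_norm_le (intbleB iF is_)))//.
  rewrite -(Rint_cst mu e1) -RintZl// -RintD; last 2 first.
  - exact: intble_cst.
  - exact: intbleZl.
  apply: Rint_le; first by apply: intble_norm; exact: intbleB.
  - by apply: intbleD; [exact: intble_cst|exact: intbleZl].
  - by move=> t; exact: sf.
near=> n.
rewrite (oexpE P (C := C)); last 2 first.
- by apply: measurableT_comp => //; exact: continuous_measurable_fun.
- by move=> w; exact: fC.
rewrite -/(Rintegral P setT (fun w => f (X n w))).
have h1 := key _ _ P _ (ifX n) (good_intX n gs) (good_intX n gchi).
have h2 := key _ _ nu _ ifg (good_intg gs) (good_intg gchi).
have h3 : `|\int[P]_w s (X n w) - \int[nu]_t s (g t)| <= e1.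
  by near: n; have [_ _] := gs; exact.
have h4 : `|\int[P]_w chi (X n w) - \int[nu]_t chi (g t)| <= e1.
  by near: n; have [_ _] := gchi; exact.
have h5 : \int[P]_w chi (X n w) <= 2 * e1.
  move: h4; rewrite ler_norml => /andP[_ h4]; lra.
have h6 := ler_wpM2l (mulr_ge0 (ler0n R 2) C0) h5.
have h7 := ler_wpM2l (mulr_ge0 (ler0n R 2) C0) chig.
have -> : e = 4 * e1 + 8 * (C * e1) by rewrite /e1; field; rewrite gt_eqF.
have : 0 <= C * e1 by rewrite mulr_ge0// ltW.
move: h1 h2 h3; rewrite !ler_norml => /andP[a1 b1] /andP[a2 b2] /andP[a3 b3] hC.
apply/andP; split; lra.
Unshelve. all: by end_near. Qed.

End Portmanteau.

(** * Smooth test functions *)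

Section Derivatives.
Context {R : realType}.
Implicit Types f g : R -> R.

Definition deriv_at (x : R) f (a : R) := is_derive x (1 : R) f a.

Lemma der_eq x f a b : deriv_at x f a -> a = b -> deriv_at x f b.
Proof. by move=> h <-. Qed.

Lemma der_ext x f g a : f =1 g -> deriv_at x f a -> deriv_at x g a.
Proof. by move=> /funext ->. Qed.

Lemma der_cst x (c : R) : deriv_at x (fun=> c) 0.
Proof. exact: is_derive_cst. Qed.

Lemma der_id x : deriv_at x (fun t => t) 1.
Proof. exact: is_derive_id. Qed.

Lemma der_add x f g a b : deriv_at x f a -> deriv_at x g b ->
  deriv_at x (fun t => f t + g t) (a + b).
Proof. by move=> hf hg; exact: (@is_deriveD _ _ _ f g x 1 a b). Qed.

Lemma der_mul x f g a b : deriv_at x f a -> deriv_at x g b ->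
  deriv_at x (fun t => f t * g t) (a * g x + f x * b).
Proof.
move=> hf hg; apply: der_eq; first exact: (@is_deriveM _ _ f g x 1 a b).
by rewrite /GRing.scale/= addrC mulrC.
Qed.

Lemma der_scale x f a c : deriv_at x f a -> deriv_at x (fun t => c * f t) (c * a).
Proof.
move=> hf; apply: der_eq (der_mul (der_cst x c) hf) _.
by rewrite mul0r add0r.
Qed.

Lemma der_comp x f g a b : deriv_at (g x) f a -> deriv_at x g b ->
  deriv_at x (fun t => f (g t)) (a * b).
Proof. by move=> hf hg; exact: (is_derive1_comp hf hg). Qed.

Lemma der_affine x f a (c k : R) : deriv_at (c * x + k) f a ->
  deriv_at x (fun t => f (c * t + k)) (a * c).
Proof.
move=> hf; apply: (der_comp (g := fun t => c * t + k)) => //.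
apply: der_eq (der_add (der_scale c (der_id x)) (der_cst x k)) _.
by rewrite addr0 mulr1.
Qed.

Lemma der_exp x n : deriv_at x (fun t => t ^+ n.+1) (n.+1%:R * x ^+ n).
Proof.
elim: n => [|n IH]; first by rewrite expr0 mulr1; exact: der_id.
apply: der_ext (der_eq (der_mul (der_id x) IH) _) => [t|].
  by rewrite [RHS]exprS.
by rewrite -[n.+2%:R]natr1 exprS; ring.
Qed.

Lemma deriv_continuous f df : (forall x, deriv_at x f (df x)) -> continuous f.
Proof.
move=> h x; apply: differentiable_continuous.
by apply/derivable1_diffP; have [] := h x.
Qed.

Lemma mean_value_bound f df C (t : R) : 0 <= t <= 1 ->
  (forall x, deriv_at x f (df x)) -> (forall x, 0 <= x <= 1 -> `|df x| <= C) ->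
  `|f t - f 0| <= C.
Proof.
move=> /andP[t0 t1] h hC.
have C0 : 0 <= C by apply: le_trans (hC 0 _); rewrite ?lexx ?ler01.
have [->|tn0] := eqVneq t 0; first by rewrite subrr normr0.
have tp : 0 < t by rewrite lt_neqAle eq_sym tn0.
have [] := @MVT _ f df 0 t tp.
- by move=> x _; exact: h.
- by apply: continuous_subspaceT; exact: deriv_continuous h.
move=> c; rewrite in_itv/= => /andP[c0 ct] ->.
rewrite normrM subr0 (gtr0_norm tp) (@le_trans _ _ (C * t))//.
  by rewrite ler_wpM2r// hC// ltW// (le_trans (ltW ct)).
by rewrite ler_piMr.
Qed.

(** The mean value bound is applied to f2, f1 and f in turn, each time after subtraction of the
    lower Taylor terms; each use costs a factor at most 1, whence C and not C / 6. *)
Lemma taylor2 f f1 f2 f3 C :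
  (forall x, deriv_at x f (f1 x)) -> (forall x, deriv_at x f1 (f2 x)) ->
  (forall x, deriv_at x f2 (f3 x)) -> (forall x, 0 <= x <= 1 -> `|f3 x| <= C) ->
  `|f 1 - f 0 - f1 0 - f2 0 / 2| <= C.
Proof.
move=> h1 h2 h3 hC.
have b2 t : 0 <= t <= 1 -> `|f2 t - f2 0| <= C.
  by move=> t01; exact: mean_value_bound h3 hC.
have b1 t : 0 <= t <= 1 -> `|f1 t - f1 0 - f2 0 * t| <= C.
  move=> t01; have := @mean_value_bound (fun t => f1 t + (- f2 0) * t)
    (fun t => f2 t - f2 0) C t t01; rewrite mulr0 addr0 => H.
  rewrite (_ : _ - _ = f1 t + - f2 0 * t - f1 0); last by ring.
  apply: H => // x; apply: der_eq (der_add (h2 x) (der_scale _ (der_id x))) _.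
  by rewrite mulr1.
have := @mean_value_bound (fun t => f t + (- f1 0 * t + (- (f2 0 / 2)) * t ^+ 2))
    (fun t => f1 t - f1 0 - f2 0 * t) C 1.
rewrite ler01 lexx => /(_ isT) H.
rewrite (_ : _ - _ = f 1 + (- f1 0 * 1 + - (f2 0 / 2) * 1 ^+ 2) -
  (f 0 + (- f1 0 * 0 + - (f2 0 / 2) * 0 ^+ 2))); last by ring.
apply: H => // x; apply: der_eq.
  apply: (der_add (h1 x)); apply: der_add; first exact: (der_scale _ (der_id x)).
  exact: (der_scale _ (der_exp x 1)).
by field.
Qed.

(* [p + t b + t^2 c] is the path followed by a quadratic functional of [x + t h]. *)
Lemma taylor_path (u u1 u2 u3 : R -> R) (p b c C : R) :
  (forall x, deriv_at x u (u1 x)) -> (forall x, deriv_at x u1 (u2 x)) ->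
  (forall x, deriv_at x u2 (u3 x)) ->
  (forall t, 0 <= t <= 1 -> let q := p + t * b + t ^+ 2 * c in
     `|u3 q| * `|b + 2 * t * c| ^+ 3 + 6 * (`|u2 q| * (`|b + 2 * t * c| * `|c|)) <= C) ->
  `|u (p + b + c) - u p - u1 p * b - (u2 p * b ^+ 2 / 2 + u1 p * c)| <= C.
Proof.
move=> h1 h2 h3 hC.
pose q := fun t : R => p + t * b + t ^+ 2 * c.
pose r := fun t : R => b + 2 * t * c.
have dr t : deriv_at t r (2 * c).
  apply: der_ext (_ : deriv_at t (fun t => b + (2 * c) * t) _).
    by move=> x; rewrite /r; ring.
  apply: der_eq (der_add (der_cst _ _) (der_scale _ (der_id t))) _; ring.
have dq t : deriv_at t q (r t).
  apply: der_ext (_ : deriv_at t (fun t => p + (b * t + c * t ^+ 2)) _).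
    by move=> x; rewrite /q; ring.
  apply: der_eq; first exact: (der_add (der_cst _ _)
    (der_add (der_scale _ (der_id t)) (der_scale _ (der_exp t 1)))).
  by rewrite /r; ring.
(* As r has the constant derivative 2 c, the third derivative of u (q t) is u3 r^3 + 3 u2 r (2
   c). *)
have := @taylor2 (fun t => u (q t)) (fun t => u1 (q t) * r t)
  (fun t => u2 (q t) * (r t * r t) + u1 (q t) * (2 * c))
  (fun t => u3 (q t) * r t ^+ 3 + 6 * (u2 (q t) * (r t * c))) C.
rewrite (_ : q 1 = p + b + c); last by rewrite /q; ring.
rewrite (_ : q 0 = p); last by rewrite /q; ring.
rewrite (_ : r 0 = b); last by rewrite /r; ring.
move=> H.
rewrite (_ : _ + _ = (u2 p * (b * b) + u1 p * (2 * c)) / 2); last by field.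
apply: H.
- by move=> t; apply: (der_comp (h1 _)); exact: dq.
- move=> t; apply: der_eq.
    apply: der_mul; last exact: dr.
    by apply: (der_comp (h2 _)); exact: dq.
  by rewrite /=; ring.
- move=> t; apply: der_eq.
    apply: der_add; last first.
      apply: der_mul; last exact: der_cst.
      by apply: (der_comp (h2 _)); exact: dq.
    apply: der_mul; last by apply: der_mul; exact: dr.
    by apply: (der_comp (h3 _)); exact: dq.
  by rewrite /=; ring.
- move=> t t01; rewrite (le_trans _ (hC t t01))// (le_trans (ler_normD _ _))//.
  by rewrite -/(q t) -/(r t) normrM normrX lerD2l !normrM (ger0_norm (ler0n _ 6)).
Qed.

(** The truncated power of spline theory. For n = 0 it is constantly 1, hence the successors in the
    exponents below. *)
Definition pospow n (x : R) : R := Num.max 0 x ^+ n.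

Lemma pospow_le0 n x : x <= 0 -> pospow n.+1 x = 0.
Proof. by move=> x0; rewrite /pospow max_l// expr0n. Qed.

Lemma pospow_ge0 n x : 0 <= x -> pospow n x = x ^+ n.
Proof. by move=> x0; rewrite /pospow max_r. Qed.

Lemma deriv_pospow n x : deriv_at x (pospow n.+2) (n.+2%:R * pospow n.+1 x).
Proof.
have [x0|x0|->] := ltgtP x 0.
- rewrite pospow_le0 ?ltW// mulr0.
  apply: near_eq_is_derive (der_cst x 0).
  near=> y; rewrite pospow_le0// ltW//; near: y; exact: lt_nbhsl.
- rewrite pospow_ge0 ?ltW//.
  apply: near_eq_is_derive (der_exp x n.+1).
  near=> y; rewrite pospow_ge0// ltW//; near: y; exact: lt_nbhsr.
- rewrite pospow_le0// mulr0.
  (* At 0 the two local formulas do not apply; the difference quotient is h^(n+1) for h > 0 and 0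
     for h < 0. *)
  have h : h^-1 *: (pospow n.+2 (h *: (1:R) + 0) - pospow n.+2 0) @[h --> (0:R)^'] --> (0:R).
    apply/cvgrPdist_le => e e0; near=> h.
    rewrite addr0 (pospow_le0 _ (lexx 0)) subr0 sub0r normrN /GRing.scale/= mulr1.
    have h0 : h != 0 by near: h; exact: nbhs_dnbhs_neq.
    have h1 : `|h| <= 1 by near: h; apply: dnbhs0_le.
    have he : `|h| <= e by near: h; apply: dnbhs0_le.
    have [hn|hp] := lerP h 0; first by rewrite pospow_le0// mulr0 normr0 ltW.
    rewrite (pospow_ge0 _ (ltW hp)) exprS mulKf// normrX exprS.
    by apply: le_trans he; rewrite ler_piMr// exprn_ile1.
  by split; [exact: (cvgP _ h)|exact: cvg_lim].
Unshelve. all: by end_near. Qed.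

End Derivatives.

Section SmoothStep.
Context {R : realType}.

(** Fourth difference of the truncated power at the knots 0, ..., 4; for n = 3 it is a multiple of
    the cubic B-spline. Beyond 4 it is the fourth difference of x^n, which is 0 for n <= 3 and 4! =
    24 for n = 4: this is the normalization of the step. *)
Definition alt4 n (x : R) : R := pospow n x - 4 * pospow n (x - 1) +
  6 * pospow n (x - 2) - 4 * pospow n (x - 3) + pospow n (x - 4).

Lemma alt4_le0 n x : x <= 0 -> alt4 n.+1 x = 0.
Proof. by move=> x0; rewrite /alt4 !pospow_le0; lra. Qed.

Lemma alt4_ge4 n x : 4 <= x -> alt4 n x = x ^+ n - 4 * (x - 1) ^+ n +
  6 * (x - 2) ^+ n - 4 * (x - 3) ^+ n + (x - 4) ^+ n.
Proof. by move=> x4; rewrite /alt4 !pospow_ge0//; lra. Qed.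

Lemma deriv_alt4 n x : deriv_at x (alt4 n.+2) (n.+2%:R * alt4 n.+1 x).
Proof.
have h k : deriv_at x (fun t => pospow n.+2 (t - k)) (n.+2%:R * pospow n.+1 (x - k)).
  apply: der_eq (@der_comp _ x (pospow n.+2) (fun t => t - k) _ _
    (deriv_pospow n (x - k)) (der_add (der_id x) (der_cst x (- k)))) _.
  by rewrite addr0 mulr1.
apply: der_ext (_ : deriv_at x (fun t => pospow n.+2 t +
  ((-4) * pospow n.+2 (t - 1) + (6 * pospow n.+2 (t - 2) +
  ((-4) * pospow n.+2 (t - 3) + pospow n.+2 (t - 4))))) _).
  by move=> t; rewrite /alt4; ring.
apply: der_eq (der_add (deriv_pospow n x) (der_add (der_scale _ (h 1))
  (der_add (der_scale _ (h 2)) (der_add (der_scale _ (h 3)) (h 4))))) _.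
by rewrite /alt4; ring.
Qed.

Lemma pospow_bound n (x : R) : x <= 4 -> 0 <= pospow n x <= 4 ^+ n.
Proof.
move=> x4; rewrite /pospow exprn_ge0 ?le_max ?lexx//=.
by apply: lerXn2r; rewrite ?nnegrE ?le_max ?lexx// ge_max x4 andbT.
Qed.

Lemma alt4_bound n x : x <= 4 -> `|alt4 n x| <= 16 * 4 ^+ n.
Proof.
move=> x4; rewrite /alt4.
have /andP[a0 b0] := pospow_bound n x4.
have /andP[a1 b1] : 0 <= pospow n (x - 1) <= 4 ^+ n by apply: pospow_bound; lra.
have /andP[a2 b2] : 0 <= pospow n (x - 2) <= 4 ^+ n by apply: pospow_bound; lra.
have /andP[a3 b3] : 0 <= pospow n (x - 3) <= 4 ^+ n by apply: pospow_bound; lra.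
have /andP[a4 b4] : 0 <= pospow n (x - 4) <= 4 ^+ n by apply: pospow_bound; lra.
by rewrite ler_norml; apply/andP; split; lra.
Qed.

(* The primitive of the cubic B-spline with knots 0, 1/4, 1/2, 3/4, 1. *)
Definition smooth_step (x : R) : R := alt4 4 (4 * x) / 24.

Lemma smooth_step_le0 x : x <= 0 -> smooth_step x = 0.
Proof. by move=> x0; rewrite /smooth_step alt4_le0 ?mul0r//; lra. Qed.

Lemma smooth_step_ge1 x : 1 <= x -> smooth_step x = 1.
Proof.
move=> x1; rewrite /smooth_step alt4_ge4; last by lra.
by rewrite (_ : _ + _ = 24) ?divff//; ring.
Qed.

Lemma smooth_step01 x : 0 <= smooth_step x <= 1.
Proof.
rewrite /smooth_step; set y := 4 * x.
suff : 0 <= alt4 4 y <= 24.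
  by move=> /andP[a b]; apply/andP; split; rewrite ?divr_ge0// ler_pdivrMr// mul1r.
have [y0|y0] := lerP y 0; first by rewrite alt4_le0// lexx ler0n.
have [y1|y1] := lerP y 1.
  rewrite /alt4 (pospow_ge0 _ (ltW y0)) !pospow_le0; [|lra..].
  have : y ^+ 4 <= 1 by rewrite exprn_ile1// ltW.
  have : 0 <= y ^+ 4 by rewrite exprn_ge0// ltW.
  by move=> a b; apply/andP; split; lra.
have [y2|y2] := lerP y 2.
  have z0 : 0 <= y - 1 by lra.
  have z1 : y - 1 <= 1 by lra.
  rewrite /alt4 (pospow_ge0 _ (ltW y0)) (pospow_ge0 _ z0) !pospow_le0; [|lra..].
  rewrite (_ : y ^+ 4 = (y - 1 + 1) ^+ 4); last by ring.
  set z := y - 1 in z0 z1 *.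
  have : 0 <= z ^+ 4 by rewrite exprn_ge0.
  have : z ^+ 4 <= 1 by rewrite exprn_ile1.
  have h3 : z ^+ 3 <= 1 by rewrite exprn_ile1.
  have h3' : z ^+ 4 <= z ^+ 3 by rewrite exprS ler_piMl// exprn_ge0.
  have : 0 <= z ^+ 2 by rewrite exprn_ge0.
  have : z ^+ 2 <= 1 by rewrite exprn_ile1.
  move=> a b c e.
  rewrite (_ : (z + 1) ^+ 4 = z ^+ 4 + 4 * z ^+ 3 + 6 * z ^+ 2 + 4 * z + 1); last by ring.
  by apply/andP; split; lra.
have [y3|y3] := lerP y 3.
  have z0 : 0 <= y - 2 by lra.
  have z1 : y - 2 <= 1 by lra.
  have z0' : 0 <= y - 1 by lra.
  rewrite /alt4 (pospow_ge0 _ (ltW y0)) (pospow_ge0 _ z0) (pospow_ge0 _ z0') !pospow_le0; [|lra..].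
  set z := y - 2 in z0 z1 *.
  rewrite [X in _ <= X <= _](_ : _ = 3 * z ^+ 4 - 8 * z ^+ 3 + 16 * z + 12); last by rewrite /z; ring.
  have : 0 <= z ^+ 4 by rewrite exprn_ge0.
  have : z ^+ 4 <= z ^+ 3 by rewrite exprS ler_piMl// exprn_ge0.
  have : z ^+ 3 <= z by rewrite exprS ler_piMr// exprn_ile1.
  have : z * z ^+ 2 <= z by rewrite ler_piMr// exprn_ile1.
  rewrite -exprS => a b c e.
  (* The tangent of z^3 at 1, that is z^3 >= 3 z - 2; together with z^4 <= z^3 it bounds the
     polynomial by z + 22. *)
  have tang : 0 <= (z - 1) ^+ 2 * (z + 2) by rewrite mulr_ge0 ?sqr_ge0//; lra.
  rewrite (_ : _ * _ = z ^+ 3 - 3 * z + 2) in tang; last by ring.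
  by apply/andP; split; lra.
have [y4|y4] := lerP y 4.
  have z0 : 0 <= y - 2 by lra.
  have z1 : 0 <= y - 3 by lra.
  have z0' : 0 <= y - 1 by lra.
  rewrite /alt4 (pospow_ge0 _ (ltW y0)) (pospow_ge0 _ z0) (pospow_ge0 _ z0')
    (pospow_ge0 _ z1) !pospow_le0; [|lra..].
  (* The full fourth difference of y^4 is 24, and only its last term (y - 4)^4 is missing here. *)
  rewrite [X in _ <= X <= _](_ : _ = 24 - (4 - y) ^+ 4); last by ring.
  have : (4 - y) ^+ 4 <= 1 by rewrite exprn_ile1//; lra.
  have : 0 <= (4 - y) ^+ 4 by rewrite exprn_ge0//; lra.
  by move=> a b; apply/andP; split; lra.
rewrite (alt4_ge4 _ (ltW y4)) [X in _ <= X <= _](_ : _ = 24); last by ring.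
by rewrite lexx ler0n.
Qed.

(** The derivatives vanish off [-K, K]: this is what makes the Taylor bound in [path_bound] uniform
    in the state reached by the partial sum. *)
Record test_function (u u1 u2 u3 : R -> R) (K M : R) : Prop := TestFunction {
  test_deriv1 : forall x, deriv_at x u (u1 x);
  test_deriv2 : forall x, deriv_at x u1 (u2 x);
  test_deriv3 : forall x, deriv_at x u2 (u3 x);
  test_support : forall x, K < `|x| -> [/\ u1 x = 0, u2 x = 0 & u3 x = 0];
  test_bound : forall x, [/\ `|u1 x| <= M, `|u2 x| <= M & `|u3 x| <= M];
  test_range : forall x, 0 <= u x <= 1;
  test_ge0 : 0 <= K /\ 0 <= M }.

Lemma smooth_step_continuous : continuous smooth_step.
Proof.
apply: (@deriv_continuous _ smooth_step (fun x => (4%:R * alt4 3 (4 * x)) * 4 / 24)) => x.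
apply: der_ext (_ : deriv_at x (fun t => 24^-1 * alt4 4 (4 * t + 0)) _).
  by move=> t; rewrite addr0 mulrC.
apply: der_eq (der_scale _ (@der_affine _ x (alt4 4) _ 4 0 (deriv_alt4 2 (4 * x + 0)))) _.
by rewrite addr0 [RHS]mulrC.
Qed.

Lemma test_function_step (a eta : R) : 0 < eta -> exists u1 u2 u3 K M,
  test_function (fun x => smooth_step ((x - a) / eta)) u1 u2 u3 K M.
Proof.
move=> eta0.
pose c := 4 / eta; pose k := - (4 * a / eta).
have c0 : 0 < c by rewrite divr_gt0.
have ck x : 4 * ((x - a) / eta) = c * x + k by rewrite /c /k; ring.
(* The step is alt4 4 (c x + k) / 24, and each derivative brings a factor c and lowers the exponent:
   4/24, then 3/6, then 2/2. The transition takes place in [a, a + eta], whence K = |a| + eta. *)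
exists (fun x => c / 6 * alt4 3 (c * x + k)), (fun x => c ^+ 2 / 2 * alt4 2 (c * x + k)),
  (fun x => c ^+ 3 * alt4 1 (c * x + k)), (`|a| + eta),
  ((16 * 4 ^+ 3) * (c + c ^+ 2 + c ^+ 3)).
have aff n x : deriv_at x (fun x => alt4 n.+2 (c * x + k))
    (n.+2%:R * alt4 n.+1 (c * x + k) * c).
  by apply: (@der_affine _ x (alt4 n.+2)); exact: deriv_alt4.
have cp2 : 0 < c ^+ 2 by rewrite exprn_gt0.
have cp3 : 0 < c ^+ 3 by rewrite exprn_gt0.
split.
- move=> x; apply: der_ext (_ : deriv_at x (fun x => 24^-1 * alt4 4 (c * x + k)) _).
    by move=> t; rewrite /smooth_step ck mulrC.
  by apply: der_eq (der_scale _ (aff 2 x)) _; field.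
- by move=> x; apply: der_eq (der_scale _ (aff 1 x)) _; field.
- by move=> x; apply: der_eq (der_scale _ (aff 0 x)) _; field.
- move=> x xK.
  suff h n : (n < 3)%N -> alt4 n.+1 (c * x + k) = 0 by rewrite !h// !mulr0.
  rewrite -ck; have [x0|x0] := lerP 0 x.
    rewrite (ger0_norm x0) in xK => n3; rewrite alt4_ge4.
      by case: n n3 => [|[|[|]]]// _; ring.
    rewrite ler_peMr// ler_pdivlMr// mul1r.
    have := ler_norm a; lra.
  rewrite (ltr0_norm x0) in xK => _; rewrite alt4_le0//.
  rewrite pmulr_rle0// pmulr_lle0 ?invr_gt0//.
  have := ler_norm (- a); rewrite normrN; lra.
- move=> x.
  have b n : (n < 3)%N -> `|alt4 n.+1 (c * x + k)| <= (16 * 4 ^+ 3).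
    move=> n3; have [x4|x4] := lerP (c * x + k) 4.
      rewrite (le_trans (alt4_bound _ x4))//.
      by case: n n3 => [|[|[|]]]// _; lra.
    rewrite (alt4_ge4 _ (ltW x4)).
    rewrite [X in `|X| <= _](_ : _ = 0); first by rewrite normr0 mulr_ge0// exprn_ge0.
    by case: n n3 => [|[|[|]]]// _; ring.
  have e : 0 <= c + c ^+ 2 + c ^+ 3 by rewrite !addr_ge0// ltW.
  split; rewrite normrM gtr0_norm ?divr_gt0//.
  + by have := ler_wpM2l (ltW c0) (b 2 isT); lra.
  + by have := ler_wpM2l (ltW cp2) (b 1 isT); lra.
  + by have := ler_wpM2l (ltW cp3) (b 0 isT); lra.
- by move=> x; exact: smooth_step01.
- split; first by rewrite addr_ge0// ltW.
  by rewrite mulr_ge0 ?mulr_ge0 ?exprn_ge0// !addr_ge0// ltW.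
Qed.

End SmoothStep.

(** * The normal law *)

Section Gaussian.
Context {R : realType}.
Local Notation leb := (@lebesgue_measure R).
Local Notation N01 := (normal_prob (0 : R) 1).

(** [normal_prob] is given by its values on sets, so its density is identified with the
    Radon-Nikodym derivative, which is unique almost everywhere. *)
Lemma ge0_integral_normal_prob (m s : R) (f : R -> \bar R) :
  measurable_fun setT f -> (forall x, 0 <= f x)%E ->
  (\int[normal_prob m s]_x f x = \int[leb]_x (f x * (normal_pdf m s x)%:E))%E.
Proof.
move=> mf f0; have dom := normal_prob_dominates m s.
rewrite -(Radon_Nikodym_SigmaFinite.change_of_variables dom)//.
have iRN := Radon_Nikodym_SigmaFinite.f_integrable dom.
have mpdf : measurable_fun setT (EFin \o normal_pdf m s).
  by apply/measurable_EFinP; exact: measurable_normal_pdf.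
apply: ae_eq_integral => //.
- by apply: emeasurable_funM => //; exact: measurable_int iRN.
- exact: emeasurable_funM.
- suff : ae_eq leb setT (Radon_Nikodym_SigmaFinite.f (normal_prob m s) leb)
      (EFin \o normal_pdf m s).
    by apply: filterS => x h Dx; rewrite h.
  apply: integral_ae_eq => //.
  by move=> A _ mA; rewrite -Radon_Nikodym_SigmaFinite.f_integral.
Qed.

Lemma integral_normal_prob (m s : R) (f : R -> R) : measurable_fun setT f ->
  (forall x, 0 <= f x) ->
  (\int[normal_prob m s]_x (f x)%:E = \int[leb]_x (f x * normal_pdf m s x)%:E)%E.
Proof.
move=> mf f0; rewrite ge0_integral_normal_prob//; exact/measurable_EFinP.
Qed.

Lemma normal_pdf_std (y : R) : normal_pdf 0 1 y = normal_peak 1 * expR (- y ^+ 2 / 2).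
Proof. by rewrite normal_pdfE ?oner_neq0// /normal_fun subr0 expr1n. Qed.

Lemma normal_mgf (t : R) : (\int[N01]_y (expR (t * y))%:E = (expR (t ^+ 2 / 2))%:E)%E.
Proof.
rewrite integral_normal_prob; last 2 first.
- by apply: measurableT_comp => //; exact: measurable_funM.
- by move=> x; exact: expR_ge0.
under eq_integral => y _.
  (* Tilting by exp (t y) turns the N(0,1) density into that of N(t,1), up to the factor exp (t^2 /
     2). *)
  rewrite (_ : expR _ * _ = expR (t ^+ 2 / 2) * normal_pdf t 1 y); last first.
    rewrite normal_pdf_std normal_pdfE ?oner_neq0// /normal_fun expr1n.
    rewrite mulrCA [RHS]mulrCA -!expRD; congr (_ * expR _).
    by rewrite -[1 *+ 2]/(2%:R : R); field.
  rewrite EFinM; over.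
by rewrite integralZl//= ?integral_normal_pdf ?mule1//; exact: integrable_normal_pdf.
Qed.

Lemma intble_normal_exp (t : R) : intble N01 (fun y => expR (t * y)).
Proof.
apply/integrableP; split.
  by apply/measurable_EFinP; apply: measurableT_comp => //; exact: measurable_funM.
under eq_integral do rewrite /= ger0_norm ?expR_ge0//.
by rewrite normal_mgf ltry.
Qed.

Lemma Rint_normal_exp (t : R) : \int[N01]_y expR (t * y) = expR (t ^+ 2 / 2).
Proof. by rewrite /Rintegral normal_mgf. Qed.

Lemma norm_exp_le k (y : R) : `|y| ^+ k <= expR (k%:R * y) + expR ((- (k%:R)) * y).
Proof.
have h : `|y| ^+ k <= expR (k%:R * `|y|).
  rewrite mulrC expRM_natr; apply: lerXn2r; rewrite ?nnegrE ?expR_ge0//.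
  by rewrite (le_trans _ (expR_ge1Dx _))// lerDr.
rewrite (le_trans h)//; have [y0|y0] := lerP 0 y.
  by rewrite (ger0_norm y0) lerDl expR_ge0.
by rewrite (ltr0_norm y0) mulrN mulNr lerDr expR_ge0.
Qed.

Lemma intble_normal_pow k : intble N01 (fun y => `|y| ^+ k).
Proof.
refine (intble_le (mu := N01) (g := (fun y => expR (k%:R * y) + expR ((- (k%:R)) * y))) _ _ _).
- by apply: measurable_funX; exact: normr_measurable.
- by apply: intbleD; exact: intble_normal_exp.
- by move=> x; rewrite ger0_norm ?exprn_ge0// norm_exp_le.
Qed.

Lemma intble_normal_id : intble N01 (fun y => y).
Proof.
by apply: (intble_le _ (intble_normal_pow 1)) => // x; rewrite expr1.
Qed.

Lemma intble_normal_sqr : intble N01 (fun y => y ^+ 2).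
Proof.
apply: (intble_le _ (intble_normal_pow 2)) => [|x]; last by rewrite normrX.
exact: measurable_funX.
Qed.

Lemma exp_taylor (x : R) : `|expR x - 1 - x - x ^+ 2 / 2| <= `|x| ^+ 3 * expR `|x|.
Proof.
have d t : deriv_at t (fun t => expR (t * x)) (x * expR (t * x)).
  apply: der_ext (_ : deriv_at t (fun t => expR (x * t + 0)) _).
    by move=> s; rewrite addr0 mulrC.
  apply: der_eq (@der_affine _ t (@expR R) _ x 0 (is_derive_expR _)) _.
  by rewrite addr0 mulrC (mulrC t).
have := @taylor2 _ (fun t => expR (t * x)) (fun t => x * expR (t * x))
  (fun t => x ^+ 2 * expR (t * x)) (fun t => x ^+ 3 * expR (t * x))
  (`|x| ^+ 3 * expR `|x|).
rewrite !mul0r mul1r expR0 !mulr1; apply.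
- exact: d.
- by move=> t; apply: der_eq (der_scale x (d t)) _; ring.
- by move=> t; apply: der_eq (der_scale (x ^+ 2) (d t)) _; ring.
- move=> t /andP[t0 t1]; rewrite normrM normrX (ger0_norm (expR_ge0 _)).
  rewrite ler_wpM2l ?exprn_ge0// ler_expR (le_trans (ler_norm _))//.
  by rewrite normrM ler_piMl// ger0_norm.
Qed.

Lemma eq0_of_small (x C : R) : (forall t, 0 < t -> t <= 1 -> `|x| <= C * t) -> x = 0.
Proof.
move=> h; apply/eqP; rewrite -normr_le0 leNgt; apply/negP => x0.
have C0 : 0 < C by have := h 1 ltr01 (lexx 1); rewrite mulr1; exact: lt_le_trans.
pose t := Num.min 1 (`|x| / (2 * C)).
have t0 : 0 < t by rewrite lt_min ltr01/= divr_gt0// mulr_gt0.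
have t1 : t <= 1 by rewrite ge_min lexx.
have t2 : t <= `|x| / (2 * C) by rewrite ge_min lexx orbT.
have := h t t0 t1; have := ler_wpM2l (ltW C0) t2.
rewrite (_ : C * (`|x| / (2 * C)) = `|x| / 2); last by field; rewrite gt_eqF.
lra.
Qed.

(** Read off the moment generating function: second-order expansions of both sides give |t^2/2 - t
    m1 - t^2 m2/2| = O(t^3), and dividing by t, then by t^2, yields m1 = 0 and m2 = 1. *)
Lemma normal_moments : \int[N01]_y y = 0 /\ \int[N01]_y (y ^+ 2) = 1.
Proof.
set m1 := \int[N01]_y y; set m2 := \int[N01]_y (y ^+ 2).
(* For t <= 1, |y|^3 exp (t |y|) <= exp (4 |y|), which the integrand dominates. *)
pose A := \int[N01]_y (expR (4 * y) + expR ((- 4) * y)).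
have key t : 0 < t -> t <= 1 ->
    `|t ^+ 2 / 2 - t * m1 - t ^+ 2 / 2 * m2| <= (A + 2 * expR 1) * t ^+ 3.
  move=> t0 t1.
  have i1 : intble N01 (fun y => expR (t * y) - 1 - t * y - t ^+ 2 / 2 * y ^+ 2).
    apply: intbleB; last exact: (intbleZl _ intble_normal_sqr).
    apply: intbleB; last exact: (intbleZl _ intble_normal_id).
    by apply: intbleB; [exact: intble_normal_exp|exact: intble_cst].
  have iA : intble N01 (fun y => expR (4 * y) + expR ((- 4) * y)).
    by apply: intbleD; exact: intble_normal_exp.
  have e1 : expR (t ^+ 2 / 2) - 1 - t * m1 - t ^+ 2 / 2 * m2 =
      \int[N01]_y (expR (t * y) - 1 - t * y - t ^+ 2 / 2 * y ^+ 2).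
    have i2 := intble_normal_exp t.
    have i3 := intbleB i2 (intble_cst N01 1).
    have i4 := intbleB i3 (intbleZl t intble_normal_id).
    rewrite RintB// ?RintB// ?RintB// ?Rint_normal_exp ?Rint_cst ?RintZl//.
    + exact: intble_normal_sqr.
    + exact: intble_normal_id.
    + exact: intble_cst.
    + exact: (intbleZl _ intble_normal_id).
    + exact: (intbleZl _ intble_normal_sqr).
  have h1 : `|expR (t ^+ 2 / 2) - 1 - t * m1 - t ^+ 2 / 2 * m2| <= t ^+ 3 * A.
    rewrite e1 (le_trans (Rint_norm_le i1))// /A -RintZl//.
    apply: Rint_le; [exact: intble_norm|exact: intbleZl|] => y.
    have -> : expR (t * y) - 1 - t * y - t ^+ 2 / 2 * y ^+ 2 =
      expR (t * y) - 1 - t * y - (t * y) ^+ 2 / 2 by ring.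
    rewrite (le_trans (exp_taylor _))// normrM exprMn (gtr0_norm t0) -mulrA.
    apply: ler_wpM2l; first by rewrite exprn_ge0// ltW.
    have h : `|y| ^+ 3 <= expR (3 * `|y|).
      rewrite mulrC expRM_natr; apply: lerXn2r; rewrite ?nnegrE ?expR_ge0//.
      by rewrite (le_trans _ (expR_ge1Dx _))// lerDr.
    rewrite (@le_trans _ _ (expR (3 * `|y|) * expR `|y|))//.
      rewrite ler_pM ?exprn_ge0 ?expR_ge0// ler_expR ler_piMl//.
    rewrite -expRD (_ : 3 * `|y| + `|y| = 4 * `|y|); last by ring.
    have [y0|y0] := lerP 0 y.
      by rewrite (ger0_norm y0) lerDl expR_ge0.
    by rewrite (ltr0_norm y0) mulrN mulNr lerDr expR_ge0.
  have h2 : `|expR (t ^+ 2 / 2) - 1 - t ^+ 2 / 2| <= 2 * expR 1 * t ^+ 3.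
    set s := t ^+ 2 / 2.
    have s0 : 0 <= s by rewrite divr_ge0// sqr_ge0.
    have t3 : 0 <= t ^+ 3 by rewrite exprn_ge0// ltW.
    have s1 : s <= 1.
      by rewrite ler_pdivrMr// mul1r (le_trans (exprn_ile1 2 (ltW t0) t1))// ler1n.
    have s3 : s ^+ 2 <= t ^+ 3.
      rewrite /s expr_div_n -exprM ler_pdivrMr ?exprn_gt0//.
      rewrite (_ : (2 * 2)%N = 4%N)// (exprS t 3) mulrC ler_wpM2l//.
      by rewrite (le_trans t1)// -natrX ler1n.
    have := exp_taylor s; rewrite (ger0_norm s0) => h.
    have e1' : expR s <= expR 1 by rewrite ler_expR.
    have ee : 1 <= expR 1 :> R by rewrite -[leLHS]expR0 ler_expR.
    have h' : s ^+ 3 * expR s <= t ^+ 3 * expR 1.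
      rewrite ler_pM ?exprn_ge0 ?expR_ge0//.
      by apply: le_trans s3; rewrite exprS ler_piMl// sqr_ge0.
    have h'' : s ^+ 2 / 2 <= t ^+ 3 * expR 1.
      apply: (@le_trans _ _ (t ^+ 3 * 1)); last by rewrite ler_wpM2l.
      rewrite mulr1; have := sqr_ge0 s; lra.
    move: h; rewrite !ler_norml => /andP[a b].
    by have := sqr_ge0 s; move=> c; apply/andP; split; lra.
  rewrite (_ : _ - _ = (expR (t ^+ 2 / 2) - 1 - t * m1 - t ^+ 2 / 2 * m2) -
    (expR (t ^+ 2 / 2) - 1 - t ^+ 2 / 2)); last by ring.
  rewrite (le_trans (ler_normB _ _))// (le_trans (lerD h1 h2))//.
  by rewrite [leRHS]mulrDl (mulrC A).
set B := A + 2 * expR 1 in key.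
have B0 : 0 <= B.
  by have := key 1 ltr01 (lexx 1); rewrite !expr1n (mulr1 B); apply: le_trans.
have m10 : m1 = 0.
  apply: (@eq0_of_small _ (B + (1 + `|m2|))) => t t0 t1.
  have := key t t0 t1.
  have t2 : t ^+ 3 <= t ^+ 2 by rewrite (exprS t 2) ler_piMl ?sqr_ge0.
  have tt : 0 < t ^+ 2 by rewrite exprn_gt0.
  rewrite (_ : _ - _ = - (t * m1) + t ^+ 2 / 2 * (1 - m2)); last by ring.
  move=> h; rewrite -(ler_pM2l t0) -(ger0_norm (ltW t0)) -normrM -normrN.
  rewrite (ger0_norm (ltW t0)).
  have -> : - (t * m1) = (- (t * m1) + t ^+ 2 / 2 * (1 - m2)) - t ^+ 2 / 2 * (1 - m2).
    by rewrite addrK.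
  rewrite (le_trans (ler_normB _ _))//.
  have t20 : 0 <= t ^+ 2 / 2 by rewrite divr_ge0// ltW.
  rewrite normrM (ger0_norm t20).
  have h2 : `|1 - m2| <= 1 + `|m2| by rewrite (le_trans (ler_normB _ _))// normr1.
  have h3 := ler_wpM2l B0 t2.
  have h4 : t ^+ 2 / 2 * `|1 - m2| <= t ^+ 2 / 2 * (1 + `|m2|).
    by rewrite ler_wpM2l// divr_ge0// ltW.
  have h5 : 0 <= t ^+ 2 * (1 + `|m2|) by rewrite mulr_ge0 ?ltW// addr_ge0.
  rewrite (_ : t * ((B + (1 + `|m2|)) * t) = B * t ^+ 2 + t ^+ 2 * (1 + `|m2|)); last by ring.
  lra.
split => //; apply/esym/eqP; rewrite -subr_eq0; apply/eqP.
apply: (@eq0_of_small _ (2 * B)) => t t0 t1.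
have := key t t0 t1; rewrite m10.
have tt : 0 < t ^+ 2 / 2 by rewrite divr_gt0// exprn_gt0.
rewrite (_ : _ - _ = t ^+ 2 / 2 * (1 - m2)); last by ring.
rewrite normrM (gtr0_norm tt) (_ : B * t ^+ 3 = t ^+ 2 / 2 * (2 * B * t)); last by field.
by rewrite ler_pM2l.
Qed.

End Gaussian.

Section GaussianStability.
Context {R : realType}.
Local Notation leb := (@lebesgue_measure R).
Local Notation N01 := (normal_prob (0 : R) 1).

Lemma normal_peakE (s : R) : normal_peak s = (Num.sqrt (s ^+ 2 * pi * 2))^-1.
Proof. by rewrite mulr_natr. Qed.

Lemma normal_peakM (s t u v : R) : s * t = u * v ->
  normal_peak s * normal_peak t = normal_peak u * normal_peak v.
Proof.
move=> h; rewrite !normal_peakE -!invfM; congr (_^-1).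
have p0 : 0 <= pi :> R by exact: pi_ge0.
have q0 (r : R) : 0 <= r ^+ 2 * pi * 2 by rewrite mulr_ge0// mulr_ge0// sqr_ge0.
rewrite -(sqrtrM _ (q0 s)) -(sqrtrM _ (q0 u)); congr Num.sqrt.
transitivity ((s * t) ^+ 2 * (pi * 2) ^+ 2); first by ring.
by rewrite h; ring.
Qed.

Lemma normal_peak_scale (s : R) : 0 < s -> normal_peak s * s = normal_peak 1.
Proof.
move=> s0; rewrite !normal_peakE expr1n mul1r -mulrA sqrtrM ?sqr_ge0//.
by rewrite sqrtr_sqr gtr0_norm// invfM mulrAC mulVf ?mul1r// gt_eqF.
Qed.

Lemma integral_normal_affine (m s : R) (f : R -> R) : 0 < s -> continuous f ->
  (forall x, 0 <= f x) ->
  (\int[N01]_y (f (s * y + m))%:E = \int[leb]_z (f z * normal_pdf m s z)%:E)%E.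
Proof.
move=> s0 cf f0.
pose F := fun y : R => s * y + m.
have dF y : deriv_at y F s.
  by apply: der_eq (der_add (der_scale s (der_id y)) (der_cst y m)) _; ring.
have dFE : (F^`())%classic = cst s.
  by apply/funext => y; rewrite derive1E; have [_ ->] := dF y.
have cF : continuous F := deriv_continuous dF.
rewrite integral_normal_prob; last 2 first.
- by apply: continuous_measurable_fun => x; apply: continuous_comp; [exact: cF|exact: cf].
- by move=> x; exact: f0.
rewrite [RHS](@increasing_ge0_integration_by_substitutionT _ F); last 9 first.
- by move=> x y xy; rewrite /F ltrD2r ltr_pM2l.
- by rewrite dFE => x; exact: cvg_cst.
- by rewrite dFE; exact: is_cvg_cst.
- by rewrite dFE; exact: is_cvg_cst.
- by move=> x; have [] := dF x.
- apply/cvgrNyPle => A; near=> x; rewrite /F -lerBrDr mulrC -ler_pdivlMr//.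
- apply/cvgryPge => A; near=> x; rewrite /F -lerBlDr mulrC -ler_pdivrMr//.
- move=> x; apply: cvgM; first exact: cf.
  by apply: continuous_normal_pdf; rewrite gt_eqF.
- by move=> x; rewrite mulr_ge0// normal_pdf_ge0.
apply: eq_integral => y _; congr (_%:E); rewrite dFE /= -mulrA; congr (_ * _).
rewrite normal_pdf_std; transitivity (normal_pdf m s (F y) * s); last by [].
have s1 : s != 0 by rewrite gt_eqF.
rewrite (normal_pdfE _ s1) mulrAC (normal_peak_scale s0).
rewrite /normal_fun /F addrK; congr (_ * expR _).
by rewrite -(mulr_natr (s ^+ 2)); field.
Unshelve. all: by end_near. Qed.

(* Completing the square in [y]. *)
Lemma normal_pdf_square (a b c y z : R) : 0 < b -> 0 < c ->
  c ^+ 2 = a ^+ 2 + b ^+ 2 ->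
  normal_pdf (a * y) b z * normal_pdf 0 1 y =
  normal_pdf 0 c z * normal_pdf (a * z / c ^+ 2) (b / c) y.
Proof.
move=> b0 c0 cE; rewrite !normal_pdfE ?gt_eqF ?divr_gt0//.
rewrite mulrACA [RHS]mulrACA; congr (_ * _).
  by apply: normal_peakM; rewrite mulr1 mulrCA divff ?gt_eqF// mulr1.
rewrite /normal_fun -!expRD; congr expR.
have c1 : c != 0 by rewrite gt_eqF.
have b1 : b != 0 by rewrite gt_eqF.
rewrite -(mulr_natr (b ^+ 2)) -(mulr_natr (1 ^+ 2)) -(mulr_natr (c ^+ 2)).
rewrite -(mulr_natr ((b / c) ^+ 2)).
have -> : - (y - 0) ^+ 2 / (1 ^+ 2 * 2) =
    - (c ^+ 2 - a ^+ 2) * y ^+ 2 / (b ^+ 2 * 2) by rewrite cE; field.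
have -> : - (z - 0) ^+ 2 / (c ^+ 2 * 2) =
    - (c ^+ 2 - a ^+ 2) * z ^+ 2 / (c ^+ 2 * b ^+ 2 * 2).
  by rewrite {2}cE; field; rewrite b1 c1.
by field; rewrite b1 c1.
Qed.

Lemma measurable_normal_pdf2 (a b : R) : 0 < b ->
  measurable_fun setT (fun p : R * R => normal_pdf (a * p.1) b p.2).
Proof.
move=> b0.
rewrite (_ : (fun p : R * R => _) = (fun p => normal_peak b *
    expR (- (p.2 - a * p.1) ^+ 2 / (b ^+ 2 *+ 2)))); last first.
  by apply/funext => p; rewrite normal_pdfE ?gt_eqF.
apply: measurable_funM => //; apply: measurableT_comp => //.
apply: measurable_funM => //; apply: measurableT_comp => //.
by apply: measurable_funX; apply: measurable_funB => //; exact: measurable_funM.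
Qed.

(** Given y, the variable a y + b y' has density [normal_pdf (a * y) b]. After Tonelli and
    completion of the square, the y-integral is that of a normal density, hence 1. The coefficient a
    may be 0, as happens in the last exchange. *)
Lemma normal_stable (a b c : R) (f : R -> R) : 0 < b -> 0 < c ->
  c ^+ 2 = a ^+ 2 + b ^+ 2 -> continuous f -> (forall x, 0 <= f x) ->
  (\int[N01]_y \int[N01]_y' (f (a * y + b * y'))%:E = \int[N01]_y (f (c * y))%:E)%E.
Proof.
move=> b0 c0 cE cf f0.
have mf : measurable_fun setT f by exact: continuous_measurable_fun.
pose G (p : R * R) := (f p.2 * normal_pdf (a * p.1) b p.2 * normal_pdf 0 1 p.1)%:E.
have mG : measurable_fun setT G.
  apply/measurable_EFinP; apply: measurable_funM.
    apply: measurable_funM; first by apply: measurableT_comp.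
    exact: measurable_normal_pdf2.
  by apply: measurableT_comp => //; exact: measurable_normal_pdf.
have G0 p : (0 <= G p)%E by rewrite lee_fin !mulr_ge0 ?normal_pdf_ge0.
have inner y : (\int[N01]_y' (f (a * y + b * y'))%:E =
    \int[leb]_z (f z * normal_pdf (a * y) b z)%:E)%E.
  rewrite -integral_normal_affine//; apply: eq_integral => y' _.
  by rewrite addrC.
under eq_integral do rewrite inner.
rewrite [LHS]ge0_integral_normal_prob; last 2 first.
- apply: (@measurable_fun_fubini_tonelli_F _ _ _ _ _ leb
    (fun p : R * R => (f p.2 * normal_pdf (a * p.1) b p.2)%:E)).
    apply/measurable_EFinP; apply: measurable_funM; first by apply: measurableT_comp.
    exact: measurable_normal_pdf2.
  by move=> p; rewrite lee_fin mulr_ge0 ?normal_pdf_ge0.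
- by move=> y; apply: integral_ge0 => z _; rewrite lee_fin mulr_ge0 ?normal_pdf_ge0.
transitivity (\int[leb]_y \int[leb]_z G (y, z))%E.
  apply: eq_integral => y _; rewrite -ge0_integralZr//; first last.
  - by rewrite lee_fin normal_pdf_ge0.
  - by move=> z _; rewrite lee_fin mulr_ge0 ?normal_pdf_ge0.
  - by apply/measurable_EFinP; apply: measurable_funM => //; exact: measurable_normal_pdf.
rewrite fubini_tonelli//.
transitivity (\int[leb]_z (f z * normal_pdf 0 c z)%:E)%E.
  apply: eq_integral => z _.
  under eq_integral => y _.
    rewrite /G/= -mulrA (normal_pdf_square _ _ b0 c0 cE) mulrA EFinM; over.
  rewrite ge0_integralZl//=.
  - by rewrite integral_normal_pdf mule1.
  - by apply/measurable_EFinP; exact: measurable_normal_pdf.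
  - by move=> y _; rewrite lee_fin normal_pdf_ge0.
  - by rewrite lee_fin mulr_ge0 ?normal_pdf_ge0.
rewrite -integral_normal_affine//.
by under eq_integral do rewrite addr0.
Qed.

End GaussianStability.

(** * Independent sampling *)

Section JointLaw.
Context {R : realType} {dO : measure_display} {Om : measurableType dO}.
Variable P : probability Om R.
Context d1 d2 (T1 : measurableType d1) (T2 : measurableType d2).

(** The product formula on rectangles identifies the joint law with a product measure, to which
    Tonelli applies. *)
Lemma integral_independent_pair (X : Om -> T1) (Y : Om -> T2)
    (nu : probability T2 R) (G : T1 * T2 -> \bar R) :
  measurable_fun setT X -> measurable_fun setT Y ->
  (forall A B, measurable A -> measurable B ->
    P (X @^-1` A `&` Y @^-1` B) = (P (X @^-1` A) * nu B)%E) ->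
  measurable_fun setT G -> (forall p, 0 <= G p)%E ->
  (\int[P]_w G (X w, Y w) = \int[P]_w \int[nu]_y G (X w, y))%E.
Proof.
move=> mX mY ind mG G0.
pose Xf : {mfun Om >-> T1} := HB.pack X (isMeasurableFun.Build _ _ _ _ X mX).
have mXY : measurable_fun setT (fun w => (X w, Y w)) by exact: measurable_fun_pair.
pose XY : {mfun Om >-> (T1 * T2)%type} :=
  HB.pack (fun w => (X w, Y w)) (isMeasurableFun.Build _ _ _ _ _ mXY).
have lawE (A : set (T1 * T2)) : measurable A ->
    (distribution P Xf \x nu)%E A = distribution P XY A.
  apply: product_measure_unique => A' B mA mB.
  exact: ind.
have h1 := @ge0_integral_distribution _ _ _ _ _ P XY G mG G0.
rewrite -[LHS]h1.
transitivity (\int[distribution P Xf \x nu]_p G p)%E.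
  by apply: eq_measure_integral => A mA _; exact/esym/lawE.
rewrite fubini_tonelli1//.
rewrite (@ge0_integral_distribution _ _ _ _ _ P Xf)//.
  exact: measurable_fun_fubini_tonelli_F.
by move=> x; apply: integral_ge0.
Qed.

End JointLaw.

Section Rectangles.
Context d (T : measurableType d) (n : nat).

Definition rectangle (B : 'I_n -> set T) : set (n.-tuple T) :=
  [set t | forall i, B i (tnth t i)].

Lemma measurable_rectangle B : (forall i, measurable (B i)) ->
  measurable (rectangle B).
Proof.
move=> mB; rewrite (_ : rectangle B =
    \big[setI/setT]_(i < n) ((fun t => tnth t i) @^-1` B i)).
  apply: bigsetI_measurable => i _; rewrite -[X in measurable X]setTI.
  exact: measurable_tnth.
apply/seteqP; split => [t h|t].
  by elim/big_ind : _ => // i _; exact: h.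
by rewrite -bigcap_seq => h i; apply: h => /=; rewrite mem_index_enum.
Qed.

Definition rectangles : set (set (n.-tuple T)) :=
  [set rectangle B | B in [set B | forall i, measurable (B i)]].

(** With closure under intersection, this makes the boxes a generating pi-system: finite measures on
    tuples may be compared on boxes alone. *)
Lemma measurable_tuple_rectangles :
  @measurable _ (n.-tuple T) = <<s rectangles >>.
Proof.
apply/seteqP; split.
  apply: smallest_sub; first exact: smallest_sigma_algebra.
  rewrite -bigcup_seq; apply: bigcup_sub => i _ _ [B mB <-].
  apply: sub_sigma_algebra; exists (fun j => if j == i then B else setT).
    by move=> j /=; case: ifP.
  apply/seteqP; split => [t h|t [_ h] j]; first by split => //; have := h i; rewrite eqxx.
  by case: eqP => // ->.
apply: smallest_sub; first exact: sigma_algebra_measurable.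
by move=> _ [B mB <-]; exact: measurable_rectangle.
Qed.

Lemma setI_closed_rectangles : setI_closed rectangles.
Proof.
move=> _ _ [A mA <-] [B mB <-]; exists (fun i => A i `&` B i).
  by move=> i; exact: measurableI.
by apply/seteqP; split => [t h|t [h h'] i]; [split => i; have [] := h i|split].
Qed.

End Rectangles.

Section IID.
Context {R : realType} {dO : measure_display} {Om : measurableType dO}.
Variable P : probability Om R.
Context d (Z : measurableType d) (nu : probability Z R) (Zs : nat -> Om -> Z).
Hypothesis mZ : forall i, measurable_fun setT (Zs i).
Hypothesis lawZ : forall i B, measurable B -> P (Zs i @^-1` B) = nu B.
Hypothesis indep : forall n (B : nat -> set Z), (forall i, measurable (B i)) ->
  P (\bigcap_(i < n) (Zs i @^-1` B i)) =
  (\prod_(i < n) fine (P (Zs i @^-1` B i)))%:E.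

Definition first_obs n (w : Om) : n.-tuple Z := [tuple Zs i w | i < n].

Lemma measurable_first_obs n : measurable_fun setT (first_obs n).
Proof.
apply/measurable_fun_tnthP => i.
rewrite (_ : _ \o _ = Zs i)//.
by apply/funext => w /=; rewrite tnth_mktuple.
Qed.

Let preim_rect n (B : nat -> set Z) :
  first_obs n @^-1` (rectangle (fun i : 'I_n => B i)) =
  \bigcap_(i < n) (Zs i @^-1` B i).
Proof.
apply/seteqP; split => w h.
  by move=> i /= ni; have := h (Ordinal ni); rewrite tnth_mktuple.
by move=> i; rewrite tnth_mktuple; exact: (h i (ltn_ord i)).
Qed.

(** For fixed [B], both sides are finite measures in [A]; they agree on boxes by independence of the
    first n + 1 observations. *)
Lemma indep_next n (A : set (n.-tuple Z)) (B : set Z) : measurable A ->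
  measurable B -> P (first_obs n @^-1` A `&` Zs n @^-1` B) =
    (P (first_obs n @^-1` A) * nu B)%E.
Proof.
move=> mA mB.
have mZB : measurable (Zs n @^-1` B).
  by rewrite -[X in measurable X]setTI; exact: mZ.
pose Xf : {mfun Om >-> n.-tuple Z} := HB.pack (first_obs n)
  (isMeasurableFun.Build _ _ _ _ _ (@measurable_first_obs n)).
pose m1 := pushforward (mrestr P mZB) Xf.
pose m2 := mscale (NngNum (fine_ge0 (measure_ge0 nu B))) (distribution P Xf).
have m1E A' : m1 A' = P (first_obs n @^-1` A' `&` Zs n @^-1` B) by [].
have m2E A' : m2 A' = (nu B * P (first_obs n @^-1` A'))%E.
  by rewrite /m2 /mscale/= fineK// fin_num_measure.
rewrite -m1E muleC -m2E.
apply: (measure_unique (@rectangles _ Z n) (fun=> setT)) => //.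
- exact: measurable_tuple_rectangles.
- exact: setI_closed_rectangles.
- move=> _; exists (fun=> setT) => //.
  by apply/seteqP; split.
- by rewrite bigcup_const//; exists 0%N.
- move=> _ [C mC <-].
  transitivity (m1 (rectangle C)); first by [].
  transitivity (m2 (rectangle C)); last by [].
  rewrite m1E m2E.
  (* Independence is phrased for sequences of sets: the box is extended by [B] from index n on. *)
  pose D (k : nat) : set Z := if insub k is Some i then C i else B.
  have DC (i : 'I_n) : D i = C i by rewrite /D valK.
  have Dn : D n = B by rewrite /D insubF// ltnn.
  have mD k : measurable (D k).
    by rewrite /D; case: insubP => // i _ _; exact: mC.
  rewrite (_ : rectangle C = rectangle (fun i : 'I_n => D i)); last first.
    by congr rectangle; apply/funext => i; rewrite DC.
  rewrite preim_rect -{1}Dn.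
  have -> : \bigcap_(i < n) (Zs i @^-1` D i) `&` Zs n @^-1` D n =
      \bigcap_(i < n.+1) (Zs i @^-1` D i).
    apply/seteqP; split => [w [h hn] i /=|w h].
      by rewrite ltnS leq_eqVlt => /predU1P[->//|/h].
    by split => [i /= ni|]; apply: h => //=; rewrite ltnS ltnW.
  rewrite !indep// big_ord_recr/= lawZ// Dn EFinM muleC fineK//.
  exact: fin_num_measure.
- move=> _; apply: (@le_lt_trans _ _ (P (first_obs n @^-1` setT `&` Zs n @^-1` B))) => //.
  by rewrite preimage_setT setTI -ge0_fin_numE// fin_num_measure.
Qed.

Lemma integral_next n (G : n.-tuple Z * Z -> \bar R) : measurable_fun setT G ->
  (forall p, 0 <= G p)%E ->
  (\int[P]_w G (first_obs n w, Zs n w) = \int[P]_w \int[nu]_z G (first_obs n w, z))%E.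
Proof.
move=> mG G0; apply: integral_independent_pair => //.
- exact: measurable_first_obs.
- by move=> A B mA mB; exact: indep_next.
Qed.

End IID.

(** * Lindeberg exchange for quadratic functionals *)

Section BoundedFubini.
Context {R : realType} d1 d2 (T1 : measurableType d1) (T2 : measurableType d2).
Variables (mu : probability T1 R) (nu : probability T2 R) (f : T1 * T2 -> R).
Hypothesis mf : measurable_fun setT f.
Hypothesis f01 : forall p, 0 <= f p <= 1.

Lemma norm_in01 (x : R) : 0 <= x <= 1 -> `|x| <= 1.
Proof. by move=> /andP[x0 x1]; rewrite ger0_norm. Qed.

Lemma intble_section1 x : intble nu (fun y => f (x, y)).
Proof.
apply: (@intble_bounded _ _ _ _ _ 1) => [|y]; last exact: norm_in01.
by apply: measurableT_comp mf _; exact: pair1_measurable.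
Qed.

Lemma intble_section2 y : intble mu (fun x => f (x, y)).
Proof.
apply: (@intble_bounded _ _ _ _ _ 1) => [|x]; last exact: norm_in01.
by apply: measurableT_comp mf _; exact: pair2_measurable.
Qed.

Let mfE : measurable_fun setT (fun p => (f p)%:E).
Proof. exact/measurable_EFinP. Qed.

Let f0E p : (0 <= (f p)%:E)%E.
Proof. by rewrite lee_fin; have /andP[] := f01 p. Qed.

Lemma measurable_Rint1 : measurable_fun setT (fun x => \int[nu]_y f (x, y)).
Proof.
apply/measurable_EFinP.
rewrite (_ : _ \o _ = (fun x => \int[nu]_y (f (x, y))%:E)%E).
  exact: (measurable_fun_fubini_tonelli_F (fun p => (f p)%:E)).
by apply/funext => x /=; rewrite EFin_Rintegral//; exact: intble_section1.
Qed.

Lemma measurable_Rint2 : measurable_fun setT (fun y => \int[mu]_x f (x, y)).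
Proof.
apply/measurable_EFinP.
rewrite (_ : _ \o _ = (fun y => \int[mu]_x (f (x, y))%:E)%E).
  exact: (measurable_fun_fubini_tonelli_G (fun p => (f p)%:E)).
by apply/funext => y /=; rewrite EFin_Rintegral//; exact: intble_section2.
Qed.

Lemma Rint_fubini :
  \int[mu]_x (\int[nu]_y f (x, y)) = \int[nu]_y (\int[mu]_x f (x, y)).
Proof.
rewrite {1 3}/Rintegral; congr fine.
transitivity (\int[mu]_x \int[nu]_y (f (x, y))%:E)%E.
  by apply: eq_integral => x _; rewrite EFin_Rintegral//; exact: intble_section1.
rewrite (fubini_tonelli (fun p => (f p)%:E))//.
by apply: eq_integral => y _; rewrite EFin_Rintegral//; exact: intble_section2.
Qed.

Lemma Rint01 (g : T2 -> R) : measurable_fun setT g -> (forall y, 0 <= g y <= 1) ->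
  0 <= \int[nu]_y g y <= 1.
Proof.
move=> mg g01; have ig : intble nu g.
  by apply: (@intble_bounded _ _ _ _ _ 1) => // y; exact: norm_in01.
apply/andP; split; first by apply: Rintegral_ge0 => y _; have /andP[] := g01 y.
rewrite -[leRHS](Rint_cst nu 1); apply: Rint_le => //; first exact: intble_cst.
by move=> y; have /andP[] := g01 y.
Qed.

End BoundedFubini.

Section LindebergStep.
Context {R : realType} dZ (Z : measurableType dZ) (nu : probability Z R).
Variables (d n : nat) (xi : Z -> 'cV[R]_d).
Hypotheses (d0 : (0 < d)%N) (n0 : (0 < n)%N).
Hypothesis mxi : forall i, measurable_fun setT (fun z => xi z i ord0).
Hypothesis ixx : forall i j, intble nu (fun z => xi z i ord0 * xi z j ord0).
Hypothesis Ex : forall i, \int[nu]_z xi z i ord0 = 0.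
Hypothesis Exx : forall i j, \int[nu]_z (xi z i ord0 * xi z j ord0) = (i == j)%:R.

Lemma intble_coord i : intble nu (fun z => xi z i ord0).
Proof.
apply: (intble_le (g := fun z => 1 + xi z i ord0 * xi z i ord0)) => //.
  by apply: intbleD => //; exact: intble_cst.
move=> z; set a := xi z i ord0.
rewrite -expr2 -real_normK ?num_real//.
have := sqr_ge0 (`|a| - 1); have := normr_ge0 a; nra.
Qed.

Lemma intble_dot x : intble nu (fun z => dot x (xi z)).
Proof. by apply: intble_sum => i _; apply: intbleZl; exact: intble_coord. Qed.

Lemma Rint_dot x : \int[nu]_z dot x (xi z) = 0.
Proof.
rewrite Rint_sum => [|i _]; last by apply: intbleZl; exact: intble_coord.
rewrite big1// => i _; rewrite RintZl ?Ex ?mulr0//; exact: intble_coord.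
Qed.

Let dot_sqrE x z : dot x (xi z) ^+ 2 = \sum_(i < d) \sum_(j < d)
  (x i ord0 * x j ord0) * (xi z i ord0 * xi z j ord0).
Proof.
rewrite expr2 /dot mulr_suml; apply: eq_bigr => i _; rewrite mulr_sumr.
by apply: eq_bigr => j _; ring.
Qed.

Lemma intble_dot_sqr x : intble nu (fun z => dot x (xi z) ^+ 2).
Proof.
under [fun z => _]funext do rewrite dot_sqrE.
by apply: intble_sum => i _; apply: intble_sum => j _; exact: intbleZl.
Qed.

Lemma Rint_dot_sqr x : \int[nu]_z (dot x (xi z) ^+ 2) = dot x x.
Proof.
under eq_Rintegral do rewrite dot_sqrE.
rewrite Rint_sum => [|i _]; last by apply: intble_sum => j _; exact: intbleZl.
apply: eq_bigr => i _; rewrite Rint_sum => [|j _]; last exact: intbleZl.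
rewrite (bigD1 i)//= big1 ?addr0 => [|j ji].
  by rewrite RintZl// Exx eqxx mulr1.
by rewrite RintZl// Exx eq_sym (negbTE ji) mulr0.
Qed.

Lemma intble_dot_self : intble nu (fun z => dot (xi z) (xi z)).
Proof. by apply: intble_sum. Qed.

Lemma Rint_dot_self : \int[nu]_z dot (xi z) (xi z) = d%:R.
Proof.
rewrite Rint_sum//; under eq_bigr do rewrite Exx eqxx.
by rewrite sumr_const card_ord.
Qed.

Lemma measurable_enorm_xi : measurable_fun setT (fun z => enorm (xi z)).
Proof.
apply: (@measurableT_comp _ _ _ _ _ _ (@Num.sqrt R) _ (fun z => \sum_(i < d) xi z i ord0 ^+ 2)).
  exact: (continuous_measurable_fun (@sqrt_continuous R)).
by apply: measurable_sum => i; exact: measurable_funX.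
Qed.

Variables (u u1 u2 u3 : R -> R) (K M : R).
Hypothesis uT : test_function u u1 u2 u3 K M.

(** c normalizes |S|^2 - d, s is the root mean square length of xi, and r scales one summand. *)
Let c : R := Num.sqrt (2 * d%:R).
Let s : R := Num.sqrt d%:R.
Let r : R := (Num.sqrt n%:R)^-1.

Let dR1 : 1 <= d%:R :> R. Proof. by rewrite ler1n. Qed.
Let nR1 : 1 <= n%:R :> R. Proof. by rewrite ler1n. Qed.
Let c2 : c ^+ 2 = 2 * d%:R. Proof. by rewrite sqr_sqrtr// mulr_ge0. Qed.
Let s2 : s ^+ 2 = d%:R. Proof. by rewrite sqr_sqrtr. Qed.
Let s0 : 0 <= s. Proof. exact: sqrtr_ge0. Qed.
Let s1 : 1 <= s. Proof. by rewrite -sqrtr1 ler_sqrt// ltr0n. Qed.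
Let c0 : 0 < c. Proof. by rewrite sqrtr_gt0 mulr_gt0// ltr0n. Qed.
Let cs : s <= c.
Proof. by rewrite ler_sqrt ?mulr_gt0 ?ltr0n// ler_peMl// ler1n. Qed.
Let c1 : 1 <= c. Proof. exact: le_trans cs. Qed.
Let cd : c <= 2 * d%:R. Proof. by rewrite -c2 expr2 ler_peMl// ltW. Qed.
Let r0 : 0 < r. Proof. by rewrite invr_gt0 sqrtr_gt0 ltr0n. Qed.
Let r2 : r ^+ 2 = n%:R^-1. Proof. by rewrite exprVn sqr_sqrtr. Qed.
Let r1 : r <= 1.
Proof.
by rewrite -(@expr_le1 _ 2)// ?r2 ?invf_le1 ?ltr0n//; exact: ltW.
Qed.

(* [quad k v]: the centred and normalized value of [v = |x|^2] after [k] steps. *)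
Definition quad (k : nat) (v : R) : R :=
  (v - k%:R * (d%:R * n%:R^-1)) / Num.sqrt (2 * d%:R).

(** On |q| <= K one has |x + t h|^2 <= c^2 L y; the square of this weight is later integrated
    against the normal law of y. *)
Let L (y : R) : R := 1 + K + `|y|.
(** The bound must not depend on the state x. Off the support of the derivatives the left side is 0;
    on it, |q| <= K bounds |x + t h| / c by the root w of [L y], so the speed of the path is at most
    2 w e and its curvature coefficient cc at most e^2. The constant is 8 + 6 * 2. *)
Lemma path_bound (k : nat) (x h : 'cV[R]_d) (y sg : R) (b cc e : R) :
  (k < n)%N -> 0 <= sg <= 1 -> e = enorm h + r * s ->
  b = 2 * dot x h / c -> cc = (dot h h - d%:R * n%:R^-1) / c ->
  forall t, 0 <= t <= 1 -> let q := quad k (dot x x) + sg * y + t * b + t ^+ 2 * cc in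
  `|u3 q| * `|b + 2 * t * cc| ^+ 3 + 6 * (`|u2 q| * (`|b + 2 * t * cc| * `|cc|)) <=
  20 * M * L y ^+ 2 * e ^+ 3.
Proof.
move=> kn /andP[sg0 sg1] eE bE ccE t /andP[t0 t1].
set q := quad _ _ + _ + _ + _; rewrite /=.
have [K0 M0] := test_ge0 uT.
have L1 : 1 <= L y by rewrite /L -addrA lerDl addr_ge0.
have h0 := enorm_ge0 h.
have e0 : 0 <= e by rewrite eE addr_ge0// mulr_ge0// ltW.
have rhs0 : 0 <= 20 * M * L y ^+ 2 * e ^+ 3.
  rewrite mulr_ge0//; last exact: exprn_ge0.
  by rewrite mulr_ge0//; [exact: mulr_ge0|exact: sqr_ge0].
have [qK|qK] := ltP K `|q|.
  by have [_ -> ->] := test_support uT qK; rewrite normr0 !mul0r mulr0 addr0.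
have [_ B2 B3] := test_bound uT q.
have c0' : c != 0 by rewrite gt_eqF.
have xth : enorm (x + t *: h) ^+ 2 = c * (q - sg * y) +
    (k%:R + t ^+ 2) * (d%:R * n%:R^-1).
  rewrite enorm_sqr !(dotDl, dotDr, dotZl, dotZr) (dotC h x).
  rewrite /q /quad -/c bE ccE; field; rewrite c0' /=.
  by rewrite andbT pnatr_eq0 -lt0n.
have kn1 : (k%:R + t ^+ 2) * n%:R^-1 <= 1.
  rewrite ler_pdivrMr ?ltr0n// mul1r (@le_trans _ _ (k%:R + 1))//.
    by rewrite lerD2l exprn_ile1.
  by rewrite natr1 ler_nat.
have xth2 : enorm (x + t *: h) ^+ 2 <= c ^+ 2 * L y.
  rewrite xth c2.
  have h1 : q - sg * y <= K + `|y|.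
    rewrite lerD//; first by rewrite (le_trans (ler_norm _)).
    rewrite (le_trans (ler_norm _))// normrN normrM (ger0_norm sg0).
    by rewrite ler_piMl.
  have h2 : c * (q - sg * y) <= 2 * d%:R * (K + `|y|).
    rewrite (le_trans (ler_wpM2l (ltW c0) h1))// ler_wpM2r// addr_ge0//.
  have h3 : (k%:R + t ^+ 2) * (d%:R * n%:R^-1) <= d%:R.
    by rewrite mulrCA ler_piMr.
  rewrite (le_trans (lerD h2 h3))//.
  rewrite (_ : 2 * d%:R * L y = 2 * d%:R * (K + `|y|) + 2 * d%:R); last by rewrite /L; ring.
  by rewrite lerD2l ler_peMl// ler1n.
pose w := Num.sqrt (L y).
have w2 : w ^+ 2 = L y by rewrite sqr_sqrtr// (le_trans ler01).
have w0 : 0 <= w by exact: sqrtr_ge0.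
have w1 : 1 <= w by rewrite -(@expr_ge1 _ 2)// w2.
have xthw : enorm (x + t *: h) <= c * w.
  rewrite -(@ler_pXn2r _ 2)// ?nnegrE ?enorm_ge0 ?mulr_ge0// ?(ltW c0)//.
  by rewrite exprMn w2.
have dn : d%:R * n%:R^-1 = (r * s) ^+ 2 by rewrite exprMn s2 r2 mulrC.
have rs0 : 0 <= r * s by rewrite mulr_ge0// ltW.
have dnc : d%:R * n%:R^-1 / c <= r * s.
  rewrite dn ler_pdivrMr// expr2 ler_wpM2l//.
  by rewrite (le_trans _ cs)// ler_piMl.
have Bb : `|b + 2 * t * cc| <= 2 * w * e.
  have -> : b + 2 * t * cc = 2 * (dot (x + t *: h) h / c) - 2 * t * (d%:R * n%:R^-1 / c).
    by rewrite bE ccE dotDl dotZl; ring.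
  rewrite (le_trans (ler_normB _ _))//.
  have a1 : `|2 * (dot (x + t *: h) h / c)| <= 2 * (w * enorm h).
    rewrite normrM (ger0_norm (ler0n _ 2)) ler_wpM2l// normrM normfV (gtr0_norm c0).
    rewrite ler_pdivrMr// (le_trans (abs_dot_le _ _))//.
    by rewrite mulrAC (mulrC w) ler_wpM2r.
  have a2 : `|2 * t * (d%:R * n%:R^-1 / c)| <= 2 * (w * (r * s)).
    have dd0 : 0 <= d%:R * n%:R^-1 / c by rewrite dn divr_ge0 ?sqr_ge0// ltW.
    rewrite -mulrA normrM (ger0_norm (ler0n _ 2)) ler_wpM2l//.
    rewrite normrM (ger0_norm t0) (ger0_norm dd0).
    rewrite (@le_trans _ _ (d%:R * n%:R^-1 / c))//; first by rewrite ler_piMl.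
    by rewrite (le_trans dnc)// ler_peMl.
  rewrite (le_trans (lerD a1 a2))// eE; lra.
have Bc : `|cc| <= e ^+ 2.
  rewrite ccE normrM normfV (gtr0_norm c0) ler_pdivrMr//.
  rewrite (@le_trans _ _ (e ^+ 2))//; last by rewrite ler_peMr// sqr_ge0.
  rewrite dn -enorm_sqr (le_trans (ler_normB _ _))//.
  rewrite !ger0_norm ?sqr_ge0// eE; have := mulr_ge0 h0 rs0; nra.
have Bbc0 : 0 <= 2 * w * e by rewrite !mulr_ge0.
have t3 : `|u3 q| * `|b + 2 * t * cc| ^+ 3 <= M * (8 * (w ^+ 3 * e ^+ 3)).
  rewrite ler_pM// ?exprn_ge0//.
  rewrite (_ : 8 * _ = (2 * w * e) ^+ 3); last by ring.
  by apply: lerXn2r; rewrite ?nnegrE.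
have t2 : `|u2 q| * (`|b + 2 * t * cc| * `|cc|) <= M * (2 * (w * e ^+ 3)).
  rewrite ler_pM// ?mulr_ge0//.
  rewrite (_ : 2 * _ = (2 * w * e) * e ^+ 2); last by ring.
  by rewrite ler_pM.
have e3 : 0 <= e ^+ 3 by rewrite exprn_ge0.
have L2 : L y ^+ 2 = w ^+ 4 by rewrite -w2; ring.
have w34 : w ^+ 3 * e ^+ 3 <= L y ^+ 2 * e ^+ 3.
  by rewrite L2 ler_wpM2r// (exprS w 3) ler_peMl// exprn_ge0.
have w14 : w * e ^+ 3 <= L y ^+ 2 * e ^+ 3.
  by rewrite L2 ler_wpM2r// (exprS w 3) ler_peMr// exprn_ege1.
have := ler_wpM2l M0 w34; have := ler_wpM2l M0 w14; lra.
Qed.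

Hypothesis ix3 : intble nu (fun z => enorm (xi z) ^+ 3).

(** Third moment of |h| + r s for the increment h = r xi; the term r s accounts for the centring by
    d / n = (r s)^2. *)
Definition third_error : R := \int[nu]_z (r * (enorm (xi z) + s)) ^+ 3.

Let ie3 : intble nu (fun z => (r * (enorm (xi z) + s)) ^+ 3).
Proof.
apply: (intble_le (g := fun z => r ^+ 3 * (4 * (enorm (xi z) ^+ 3 + s ^+ 3)))).
- apply: measurable_funX; apply: measurable_funM => //.
  by apply: measurable_funD => //; exact: measurable_enorm_xi.
- by do 2 apply: intbleZl; apply: intbleD => //; exact: intble_cst.
- move=> z; have h0 := enorm_ge0 (xi z).
  rewrite ger0_norm ?exprn_ge0 ?mulr_ge0 ?addr_ge0// ?(ltW r0)//.
  rewrite exprMn ler_wpM2l ?exprn_ge0 ?(ltW r0)//.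
  set a := enorm _ in h0 *.
  (* 4 (a^3 + s^3) - (a + s)^3 = 3 (a + s) (a - s)^2. *)
  have := mulr_ge0 (addr_ge0 h0 s0) (sqr_ge0 (a - s)); nra.
Qed.

Lemma third_error_le : third_error <=
  4 * r ^+ 3 * (\int[nu]_z (enorm (xi z) ^+ 3) + s ^+ 3).
Proof.
rewrite -[s ^+ 3 in X in _ <= X](Rint_cst nu) -RintD//; last exact: intble_cst.
rewrite -RintZl; last by apply: intbleD => //; exact: intble_cst.
apply: Rint_le => //.
  by apply: intbleZl; apply: intbleD => //; exact: intble_cst.
move=> z; have h0 := enorm_ge0 (xi z).
rewrite exprMn [leRHS]mulrAC [leRHS]mulrC ler_wpM2l ?exprn_ge0 ?(ltW r0)//.
set a := enorm _ in h0 *.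
have := mulr_ge0 (addr_ge0 h0 s0) (sqr_ge0 (a - s)); nra.
Qed.

Let u_cont : continuous u. Proof. exact: deriv_continuous (test_deriv1 uT). Qed.
Let u_meas : measurable_fun setT u. Proof. exact: continuous_measurable_fun. Qed.
Let u01 := test_range uT.

(** Since xi is centred with identity covariance, b and cc have mean 0 and b^2 has mean 2 |x|^2 / (n
    d): of the Taylor polynomial only the u2 term survives. *)
Lemma data_step (k : nat) (x : 'cV[R]_d) (y sg : R) : (k < n)%N -> 0 <= sg <= 1 ->
  let p := quad k (dot x x) + sg * y in
  `|\int[nu]_z u (quad k.+1 (dot (x + r *: xi z) (x + r *: xi z)) + sg * y)
    - u p - u2 p * (dot x x / (n%:R * d%:R))| <= 20 * M * L y ^+ 2 * third_error.
Proof.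
move=> kn sg01; set p := quad _ _ + _; rewrite /=.
have c0' : c != 0 by rewrite gt_eqF.
have n0' : n%:R != 0 :> R by rewrite pnatr_eq0 -lt0n.
have d0' : d%:R != 0 :> R by rewrite pnatr_eq0 -lt0n.
pose b z := 2 * dot x (r *: xi z) / c.
pose cc z := (dot (r *: xi z) (r *: xi z) - d%:R * n%:R^-1) / c.
have E z : quad k.+1 (dot (x + r *: xi z) (x + r *: xi z)) + sg * y = p + b z + cc z.
  rewrite /p /quad -/c /b /cc dotDl !dotDr (dotC (r *: xi z) x) -natr1.
  by field; rewrite n0' c0'.
pose D z := u (p + b z + cc z) - u p - u1 p * b z - (u2 p * b z ^+ 2 / 2 + u1 p * cc z).
have DT z : `|D z| <= 20 * M * L y ^+ 2 * (r * (enorm (xi z) + s)) ^+ 3.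
  apply: (taylor_path (test_deriv1 uT) (test_deriv2 uT) (test_deriv3 uT)) => t t01.
  have eE : r * (enorm (xi z) + s) = enorm (r *: xi z) + r * s.
    by rewrite enormZ (gtr0_norm r0); ring.
  by refine (@path_bound k x (r *: xi z) y sg (b z) (cc z) _ kn sg01 eE _ _ t t01).
have bE z : b z = (2 * r / c) * dot x (xi z) by rewrite /b dotZr; ring.
have ccE z : cc z = (r ^+ 2 / c) * dot (xi z) (xi z) + - (d%:R * n%:R^-1 / c).
  by rewrite /cc dotZl dotZr; ring.
have ib : intble nu b.
  by under [b]funext do rewrite bE; apply: intbleZl; exact: intble_dot.
have ib2 : intble nu (fun z => b z ^+ 2).
  under [fun z => b z ^+ 2]funext do rewrite bE exprMn.
  by apply: intbleZl; exact: intble_dot_sqr.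
have icc : intble nu cc.
  under [cc]funext do rewrite ccE.
  by apply: intbleD; [apply: intbleZl; exact: intble_dot_self|exact: intble_cst].
have Eb : \int[nu]_z b z = 0.
  under eq_Rintegral do rewrite bE.
  by rewrite RintZl ?Rint_dot ?mulr0//; exact: intble_dot.
have Eb2 : \int[nu]_z (b z ^+ 2) = 2 * (dot x x / (n%:R * d%:R)).
  under eq_Rintegral do rewrite bE exprMn.
  rewrite RintZl ?Rint_dot_sqr; last exact: intble_dot_sqr.
  rewrite (_ : (2 * r / c) ^+ 2 = 4 * r ^+ 2 / c ^+ 2); last by field.
  by rewrite c2 r2; field; rewrite n0' d0'.
have Ecc : \int[nu]_z cc z = 0.
  under eq_Rintegral do rewrite ccE.
  rewrite RintD ?RintZl ?Rint_cst ?Rint_dot_self ?r2.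
  - by field; rewrite c0' n0'.
  - exact: intble_dot_self.
  - by apply: intbleZl; exact: intble_dot_self.
  - exact: intble_cst.
have iu : intble nu (fun z => u (p + b z + cc z)).
  apply: (@intble_bounded _ _ _ _ _ 1) => [|z]; last exact: norm_in01.
  apply: measurableT_comp => //; apply: measurable_funD; last exact: intble_measurable icc.
  by apply: measurable_funD => //; exact: intble_measurable ib.
have i2 : intble nu (fun z => u2 p * b z ^+ 2 / 2 + u1 p * cc z).
  by apply: intbleD; [apply: intbleZr; exact: intbleZl|exact: intbleZl].
have i1 : intble nu (fun z => u (p + b z + cc z) - u p).
  by apply: intbleB => //; exact: intble_cst.
have i3 : intble nu (fun z => u (p + b z + cc z) - u p - u1 p * b z).
  by apply: intbleB => //; exact: intbleZl.
have iD : intble nu D by exact: intbleB.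
have ED : \int[nu]_z D z = \int[nu]_z u (p + b z + cc z) - u p -
    u2 p * (dot x x / (n%:R * d%:R)).
  rewrite RintB// RintB//; last exact: intbleZl.
  rewrite RintB//; last exact: intble_cst.
  rewrite Rint_cst RintZl// Eb mulr0 subr0; congr (_ - _).
  rewrite RintD; [|by apply: intbleZr; exact: intbleZl|exact: intbleZl].
  rewrite (RintZl _ icc) Ecc mulr0 addr0 RintZr; last exact: intbleZl.
  by rewrite RintZl// Eb2; field; rewrite n0' d0'.
under eq_Rintegral do rewrite E.
rewrite -ED (le_trans (Rint_norm_le iD))// /third_error -RintZl//.
apply: Rint_le => //; [exact: intble_norm|exact: intbleZl].
Qed.

Local Notation N01 := (normal_prob (0 : R) 1).
Definition gauss3 : R := \int[N01]_y (`|y| ^+ 3).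

(** The same expansion along a straight path, cc = 0, with the moments 0 and 1 of the normal law. *)
Lemma normal_step (p rho : R) : 0 <= rho ->
  `|\int[N01]_y u (p + rho * y) - u p - u2 p * (rho ^+ 2 / 2)| <= M * rho ^+ 3 * gauss3.
Proof.
move=> rho0; have [K0 M0] := test_ge0 uT.
have [m1 m2] := @normal_moments R.
pose D y := u (p + rho * y + 0) - u p - u1 p * (rho * y) -
  (u2 p * (rho * y) ^+ 2 / 2 + u1 p * 0).
have DT y : `|D y| <= M * rho ^+ 3 * `|y| ^+ 3.
  apply: (taylor_path (test_deriv1 uT) (test_deriv2 uT) (test_deriv3 uT)) => t t01 /=.
  rewrite !mulr0 normr0 !mulr0 !addr0.
  have [_ _ B3] := test_bound uT (p + t * (rho * y)).
  rewrite normrM exprMn (ger0_norm rho0) -mulrA ler_wpM2r//.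
  by rewrite mulr_ge0// exprn_ge0.
have iu : intble N01 (fun y => u (p + rho * y + 0)).
  apply: (@intble_bounded _ _ _ _ _ 1) => [|z]; last exact: norm_in01.
  apply: measurableT_comp => //; apply: measurable_funD => //.
  by apply: measurable_funD => //; exact: measurable_funM.
have iy : intble N01 (fun y => rho * y) by apply: intbleZl; exact: intble_normal_id.
have iy2 : intble N01 (fun y => (rho * y) ^+ 2).
  by under [fun y => (rho * y) ^+ 2]funext do rewrite exprMn;
     apply: intbleZl; exact: intble_normal_sqr.
have i2 : intble N01 (fun y => u2 p * (rho * y) ^+ 2 / 2 + u1 p * 0).
  by apply: intbleD; [apply: intbleZr; exact: intbleZl|exact: intble_cst].
have i1 : intble N01 (fun y => u (p + rho * y + 0) - u p).
  by apply: intbleB => //; exact: intble_cst.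
have i3 : intble N01 (fun y => u (p + rho * y + 0) - u p - u1 p * (rho * y)).
  by apply: intbleB => //; exact: intbleZl.
have iD : intble N01 D by exact: intbleB.
have ED : \int[N01]_y D y = \int[N01]_y u (p + rho * y) - u p - u2 p * (rho ^+ 2 / 2).
  rewrite RintB// RintB//; last exact: intbleZl.
  rewrite RintB//; last exact: intble_cst.
  rewrite Rint_cst RintZl// RintZl; last exact: intble_normal_id.
  rewrite m1 !mulr0 subr0; congr (_ - _).
    by congr (_ - _); apply: eq_Rintegral => y _; rewrite addr0.
  rewrite RintD; [|by apply: intbleZr; exact: intbleZl|exact: intble_cst].
  rewrite Rint_cst addr0 RintZr; last exact: intbleZl.
  rewrite RintZl//; under eq_Rintegral do rewrite exprMn.
  by rewrite RintZl ?m2 ?mulr1 ?mulrA//; exact: intble_normal_sqr.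
rewrite -ED (le_trans (Rint_norm_le iD))// /gauss3 -RintZl//; last exact: intble_normal_pow.
apply: Rint_le => //; first exact: intble_norm.
by apply: intbleZl; exact: intble_normal_pow.
Qed.

(** In order: Taylor remainder of the data, Taylor remainder of the normal variable (as rho <= 2 r),
    fluctuation of |x|^2 around k d / n, and excess 1 in the variance (2 k + 1) / n^2. *)
Definition step_error : R :=
  20 * third_error + 4 * r ^+ 3 * gauss3 + 2 * r ^+ 2 / s + r ^+ 4.

Lemma third_error_ge0 : 0 <= third_error.
Proof.
apply: Rintegral_ge0 => z _.
by rewrite exprn_ge0// mulr_ge0 ?(ltW r0)// addr_ge0// enorm_ge0.
Qed.

Lemma gauss3_ge0 : 0 <= gauss3.
Proof. by apply: Rintegral_ge0 => z _; rewrite exprn_ge0. Qed.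

(** Both steps are expanded around the same point p; what remains is to compare the second-order
    coefficients |x|^2 / (n d) and rho^2 / 2. *)
Lemma exchange_step (k : nat) (x : 'cV[R]_d) (y sg rho : R) : (k < n)%N ->
  0 <= sg <= 1 -> 0 <= rho -> rho ^+ 2 = (2 * k%:R + 1) / n%:R ^+ 2 ->
  `|\int[nu]_z u (quad k.+1 (dot (x + r *: xi z) (x + r *: xi z)) + sg * y)
    - \int[N01]_y' u (quad k (dot x x) + sg * y + rho * y')| <=
  M * step_error * L y ^+ 2.
Proof.
move=> kn sg01 rho0 rho2.
have [K0 M0] := test_ge0 uT.
have := data_step x y kn sg01; set p := quad k (dot x x) + sg * y; rewrite /= => h1.
have h2 := normal_step p rho0.
have L1 : 1 <= L y by rewrite /L -addrA lerDl addr_ge0.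
have LL : 1 <= L y ^+ 2 by rewrite exprn_ege1.
have L12 : L y <= L y ^+ 2 by rewrite expr2 ler_peMl// (le_trans ler01).
have c0' : c != 0 by rewrite gt_eqF.
have n0' : n%:R != 0 :> R by rewrite pnatr_eq0 -lt0n.
have d0' : d%:R != 0 :> R by rewrite pnatr_eq0 -lt0n.
have sp : 0 < s by rewrite (lt_le_trans ltr01).
have s0' : s != 0 by rewrite gt_eqF.
have rho4 : rho ^+ 2 <= 2 * r ^+ 2.
  rewrite rho2 r2 expr2 invfM mulrA ler_wpM2r ?invr_ge0//.
  rewrite ler_pdivrMr ?ltr0n// (_ : 2 * k%:R + 1 = (2 * k + 1)%:R); last first.
    by rewrite natrD natrM.
  by rewrite -natrM ler_nat addn1 ltn_mul2l.
have rho1 : rho <= 2 * r.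
  rewrite -(@ler_pXn2r _ 2)// ?nnegrE ?mulr_ge0 ?(ltW r0)//.
  rewrite (le_trans rho4)// exprMn ler_wpM2r ?sqr_ge0//.
  by rewrite -natrX ler_nat.
have rho3 : rho ^+ 3 <= 4 * r ^+ 3.
  rewrite (_ : 4 * r ^+ 3 = (2 * r) * (2 * r ^+ 2)); last by ring.
  by rewrite exprS ler_pM// sqr_ge0.
(* With |x|^2 = c q + k d / n, the coefficients differ by q c / (d n) - 1 / (2 n^2). Here c / d <= 2
   / s, and q = p - sg y is at most [L y] where u2 p is nonzero. *)
have h3 : `|u2 p * (dot x x / (n%:R * d%:R)) - u2 p * (rho ^+ 2 / 2)| <=
    M * L y * (2 * r ^+ 2 / s) + M * r ^+ 4.
  pose q := quad k (dot x x).
  have qE : dot x x = c * q + k%:R * (d%:R * n%:R^-1).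
    by rewrite /q /quad -/c mulrC divfK// subrK.
  have cs2 : c <= 2 * s.
    rewrite -(@ler_pXn2r _ 2)// ?nnegrE ?(ltW c0) ?mulr_ge0//.
    by rewrite c2 exprMn s2 ler_wpM2r// -natrX ler_nat.
  rewrite -mulrBr qE rho2.
  rewrite (_ : _ - _ = q * (c / d%:R * n%:R^-1) - n%:R^-1 ^+ 2 / 2); last first.
    by field; rewrite n0' d0'.
  rewrite -r2 mulrBr (le_trans (ler_normB _ _))// lerD//.
    have cd0 : 0 <= c / d%:R * r ^+ 2.
      by rewrite mulr_ge0 ?sqr_ge0// divr_ge0// ltW.
    rewrite (mulrA (u2 p)) normrM (normrM (u2 p)) (ger0_norm cd0) ler_pM//.
    - have [pK|pK] := ltP K `|p|.
        have [_ -> _] := test_support uT pK.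
        by rewrite normr0 mul0r mulr_ge0// (le_trans ler01).
      have [_ B2 _] := test_bound uT p.
      rewrite ler_pM// (_ : q = p - sg * y); last by rewrite /p addrK.
      rewrite (le_trans (ler_normB _ _))// /L -addrA addrC ler_wpDr// lerD//.
      case/andP : sg01 => sg0 sg1.
      by rewrite normrM (ger0_norm sg0) ler_piMl.
    - rewrite [leRHS]mulrAC ler_wpM2r ?sqr_ge0//.
      rewrite ler_pdivrMr ?ltr0n// -s2 (_ : 2 / s * s ^+ 2 = 2 * s)//.
      by field.
  rewrite -exprM normrM; have [_ B2 _] := test_bound uT p.
  have r40 : 0 <= r ^+ 4 by rewrite exprn_ge0// ltW.
  rewrite (_ : (2 * 2)%N = 4%N)// ler_pM// ger0_norm ?divr_ge0//.
  by rewrite ler_pdivrMr// ler_peMr// ler1n.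
have T0 := third_error_ge0; have g0 := gauss3_ge0.
set A := \int[nu]_z _ in h1 *; set B := \int[N01]_y _ in h2 *.
rewrite (_ : A - B = (A - u p - u2 p * (dot x x / (n%:R * d%:R))) -
  (B - u p - u2 p * (rho ^+ 2 / 2)) +
  (u2 p * (dot x x / (n%:R * d%:R)) - u2 p * (rho ^+ 2 / 2))); last by ring.
rewrite (le_trans (ler_normD _ _))//.
rewrite (le_trans (lerD (le_trans (ler_normB _ _) (lerD h1 h2)) h3))//.
have rs0 : 0 <= 2 * r ^+ 2 / s by rewrite divr_ge0// mulr_ge0// sqr_ge0.
have r40 : 0 <= r ^+ 4 by rewrite exprn_ge0// ltW.
have e1 : M * rho ^+ 3 * gauss3 <= M * (4 * r ^+ 3 * gauss3) * L y ^+ 2.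
  rewrite -mulrA (@le_trans _ _ (M * (4 * r ^+ 3 * gauss3)))//.
    by rewrite ler_wpM2l// ler_wpM2r.
  by rewrite ler_peMr// mulr_ge0// mulr_ge0// mulr_ge0// exprn_ge0// ltW.
have e2 : M * L y * (2 * r ^+ 2 / s) <= M * (2 * r ^+ 2 / s) * L y ^+ 2.
  by rewrite mulrAC ler_wpM2l// mulr_ge0.
have e3 : M * r ^+ 4 <= M * r ^+ 4 * L y ^+ 2.
  by rewrite ler_peMr// mulr_ge0.
rewrite (_ : M * step_error * L y ^+ 2 = 20 * M * L y ^+ 2 * third_error +
  M * (4 * r ^+ 3 * gauss3) * L y ^+ 2 + (M * (2 * r ^+ 2 / s) * L y ^+ 2 +
  M * r ^+ 4 * L y ^+ 2)); last by rewrite /step_error; ring.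
by rewrite lerD// lerD.
Qed.

End LindebergStep.

(** * Telescoping the exchange over an i.i.d. sample *)

Lemma telescope_le {R : realType} (a : nat -> R) (e : R) n :
  (forall k, (k < n)%N -> `|a k.+1 - a k| <= e) -> `|a n - a 0| <= n%:R * e.
Proof.
elim: n => [|n IH] h; first by rewrite subrr normr0 mul0r.
rewrite (_ : a n.+1 - a 0 = (a n.+1 - a n) + (a n - a 0)); last by ring.
rewrite (le_trans (ler_normD _ _))// -natr1 mulrDl mul1r addrC lerD//; last exact: h.
by apply: IH => k kn; apply: h; exact: ltnW.
Qed.

Lemma EFin_Rint2 {R : realType} d1 d2 (T1 : measurableType d1)
    (T2 : measurableType d2) (mu : probability T1 R) (nu : probability T2 R)
    (f : T1 * T2 -> R) : measurable_fun setT f -> (forall p, 0 <= f p <= 1) ->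
  (\int[mu]_x \int[nu]_y (f (x, y))%:E)%E = (\int[mu]_x \int[nu]_y f (x, y))%:E.
Proof.
move=> mf f01; rewrite -EFin_Rintegral.
  by apply: eq_integral => x _; rewrite EFin_Rintegral//; exact: intble_section1.
apply: (@intble_bounded _ _ _ _ _ 1); first exact: measurable_Rint1.
move=> x; apply: norm_in01; apply: Rint01 => //.
by apply: measurableT_comp mf _; exact: pair1_measurable.
Qed.

Section ScaledSums.
Context {R : realType} {dO : measure_display} {Om : measurableType dO}.
Variable P : probability Om R.
Context dZ (Z : measurableType dZ) (nu : probability Z R) (Zs : nat -> Om -> Z).
Hypothesis mZ : forall i, measurable_fun setT (Zs i).
Hypothesis lawZ : forall i B, measurable B -> P (Zs i @^-1` B) = nu B.
Hypothesis indep : forall n (B : nat -> set Z), (forall i, measurable (B i)) ->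
  P (\bigcap_(i < n) (Zs i @^-1` B i)) =
  (\prod_(i < n) fine (P (Zs i @^-1` B i)))%:E.
Variables (d : nat) (xi : Z -> 'cV[R]_d).
Hypothesis mxi : forall i, measurable_fun setT (fun z => xi z i ord0).
Hypothesis ixx : forall i j, intble nu (fun z => xi z i ord0 * xi z j ord0).
Hypothesis Ex : forall i, \int[nu]_z xi z i ord0 = 0.
Hypothesis Exx : forall i j, \int[nu]_z (xi z i ord0 * xi z j ord0) = (i == j)%:R.

(** A function of the tuple and not of the sample point, which is the form that [integral_next]
    conditions on. *)
Definition tuple_sum (r : R) k (t : k.-tuple Z) : 'cV[R]_d :=
  \sum_(i < k) r *: xi (tnth t i).

Lemma tuple_sum_first_obs r k w :
  tuple_sum r (first_obs Zs k w) = \sum_(i < k) r *: xi (Zs i w).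
Proof. by apply: eq_bigr => i _; rewrite tnth_mktuple. Qed.

Lemma tuple_sum_next r k w :
  tuple_sum r (first_obs Zs k.+1 w) =
  tuple_sum r (first_obs Zs k w) + r *: xi (Zs k w).
Proof. by rewrite !tuple_sum_first_obs big_ord_recr. Qed.

Lemma measurable_tuple_sum r k i :
  measurable_fun setT (fun t : k.-tuple Z => tuple_sum r t i ord0).
Proof.
under [fun t => _]funext do rewrite summxE.
apply: measurable_sum => j; under [fun t => _]funext do rewrite mxE.
apply: measurable_funM => //.
apply: (@measurableT_comp _ _ _ _ _ _ (fun z => xi z i ord0)) => //.
exact: measurable_tnth.
Qed.

Lemma measurable_sum_first_obs r k i :
  measurable_fun setT (fun w => tuple_sum r (first_obs Zs k w) i ord0).
Proof.
under [fun t => _]funext do rewrite tuple_sum_first_obs summxE.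
apply: measurable_sum => j; under [fun t => _]funext do rewrite mxE.
by apply: measurable_funM => //; exact: (measurableT_comp (mxi i)).
Qed.

Lemma measurable_dot_self dT (T : measurableType dT) (f : T -> 'cV[R]_d) :
  (forall i, measurable_fun setT (fun t => f t i ord0)) ->
  measurable_fun setT (fun t => dot (f t) (f t)).
Proof. by move=> mf; apply: measurable_sum => i; exact: measurable_funM. Qed.

Lemma measurable_next_sum r k : measurable_fun setT
  (fun p : k.-tuple Z * Z => dot (tuple_sum r p.1 + r *: xi p.2)
                                 (tuple_sum r p.1 + r *: xi p.2)).
Proof.
apply: measurable_dot_self => i.
under [fun t => _]funext do rewrite !mxE.
apply: measurable_funD.
  exact: (measurableT_comp (@measurable_tuple_sum r k i)).
apply: measurable_funM => //.
exact: (measurableT_comp (mxi i)).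
Qed.

(** The cross term of a new increment with the past has mean 0. This gives the tightness of the
    standardized score sum. *)
Lemma second_moment_sum r k :
  (\int[P]_w (dot (tuple_sum r (first_obs Zs k w))
                  (tuple_sum r (first_obs Zs k w)))%:E)%E =
  (k%:R * (r ^+ 2 * d%:R))%:E.
Proof.
elim: k => [|k IH].
  rewrite mul0r; apply: integral0_eq => w _.
  rewrite tuple_sum_first_obs big_ord0.
  by rewrite [in LHS]/dot big1// => i _; rewrite mxE mul0r.
under eq_integral do rewrite tuple_sum_next.
rewrite (integral_next mZ lawZ indep (G := fun p =>
  (dot (tuple_sum r p.1 + r *: xi p.2) (tuple_sum r p.1 + r *: xi p.2))%:E))//=; last 2 first.
- by apply/measurable_EFinP; exact: measurable_next_sum.
- by move=> p; rewrite lee_fin dot_ge0.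
transitivity (\int[P]_w ((dot (tuple_sum r (first_obs Zs k w))
     (tuple_sum r (first_obs Zs k w)))%:E + (r ^+ 2 * d%:R)%:E))%E.
  apply: eq_integral => w _; set x := tuple_sum _ _.
  have E z : dot (x + r *: xi z) (x + r *: xi z) =
      dot x x + (2 * r * dot x (xi z) + r ^+ 2 * dot (xi z) (xi z)).
    by rewrite dotDl !dotDr !dotZl !dotZr (dotC (xi z) x); ring.
  under eq_integral do rewrite E.
  have i1 : intble nu (fun z => 2 * r * dot x (xi z)).
    by apply: intbleZl; exact: intble_dot.
  have i2 : intble nu (fun z => r ^+ 2 * dot (xi z) (xi z)).
    by apply: intbleZl; exact: intble_dot_self.
  have i3 : intble nu (fun z => 2 * r * dot x (xi z) + r ^+ 2 * dot (xi z) (xi z)).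
    exact: intbleD.
  rewrite EFin_Rintegral; last by apply: intbleD => //; exact: intble_cst.
  rewrite RintD//; last exact: intble_cst.
  rewrite RintD// Rint_cst !RintZl ?Rint_dot ?Rint_dot_self ?mulr0 ?add0r//.
  - exact: intble_dot_self.
  - exact: intble_dot.
rewrite ge0_integralD//=.
- rewrite IH [X in (_ + X)%E = _](_ : _ = (r ^+ 2 * d%:R)%:E).
    by rewrite -EFinD -natr1; congr EFin; ring.
  by rewrite EFin_Rintegral ?Rint_cst//; exact: intble_cst.
- by move=> w _; rewrite lee_fin dot_ge0.
- apply/measurable_EFinP; apply: measurable_dot_self => i.
  exact: measurable_sum_first_obs.
- by move=> w _; rewrite lee_fin mulr_ge0// sqr_ge0.
Qed.

Variable n : nat.
Hypotheses (d0 : (0 < d)%N) (n0 : (0 < n)%N).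
Hypothesis ix3 : intble nu (fun z => enorm (xi z) ^+ 3).
Variables (u u1 u2 u3 : R -> R) (K M : R).
Hypothesis uT : test_function u u1 u2 u3 K M.

Local Notation N01 := (normal_prob (0 : R) 1).
Let r : R := (Num.sqrt n%:R)^-1.
(** Standard deviations of the normal part still present after k steps (1 for k = 0, 0 for k = n)
    and of the part that step k replaces. *)
Let sg (k : nat) : R := Num.sqrt (1 - (k%:R / n%:R) ^+ 2).
Let rh (k : nat) : R := Num.sqrt (2 * k%:R + 1) / n%:R.
(** The test function smoothed by the remaining normal part: it leads from the normal expectation of
    u at k = 0 to u of the data at k = n. *)
Let Psi k (v : R) : R := \int[N01]_y u (quad d n k v + sg k * y).
Let C : R := \int[N01]_y ((1 + K + `|y|) ^+ 2).

Let nR0 : 0 < n%:R :> R. Proof. by rewrite ltr0n. Qed.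
Let kn_le k : (k <= n)%N -> 0 <= (k%:R / n%:R : R) <= 1.
Proof.
move=> kn; rewrite divr_ge0//= ler_pdivrMr// mul1r ler_nat//.
Qed.
Let sg2 k : (k <= n)%N -> sg k ^+ 2 = 1 - (k%:R / n%:R) ^+ 2.
Proof.
move=> /kn_le /andP[a0 a1]; rewrite sqr_sqrtr// subr_ge0 exprn_ile1//.
Qed.
Let sg01 k : (k <= n)%N -> 0 <= sg k <= 1.
Proof.
move=> kn; rewrite sqrtr_ge0 /= -(@expr_le1 _ 2)// ?sqrtr_ge0// sg2//.
Qed.
Let sg_gt0 k : (k < n)%N -> 0 < sg k.
Proof.
move=> kn; have /andP[a0 _] := kn_le (ltnW kn).
by rewrite sqrtr_gt0 subr_gt0 exprn_ilt1// ltr_pdivrMr// mul1r ltr_nat.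
Qed.
Let rh2 k : rh k ^+ 2 = (2 * k%:R + 1) / n%:R ^+ 2.
Proof. by rewrite exprMn sqr_sqrtr ?exprVn// addr_ge0// mulr_ge0. Qed.
Let rh_gt0 k : 0 < rh k.
Proof. by rewrite divr_gt0// sqrtr_gt0 ltr_wpDl// mulr_ge0. Qed.

Let u_cont : continuous u. Proof. exact: deriv_continuous (test_deriv1 uT). Qed.
Let u_meas : measurable_fun setT u. Proof. exact: continuous_measurable_fun. Qed.
Let u01 := test_range uT.
Let mquad k : measurable_fun setT (quad d n k : R -> R).
Proof. by apply: measurable_funM => //; apply: measurable_funD. Qed.

Let u_intble (f : R -> R) : measurable_fun setT f -> intble N01 (fun y => u (f y)).
Proof.
move=> mf; apply: (@intble_bounded _ _ _ _ _ 1) => [|y]; last exact: norm_in01.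
exact: measurableT_comp.
Qed.

Let mstep k : measurable_fun setT (fun p : R * R => u (quad d n k p.1 + sg k * p.2)).
Proof.
apply: measurableT_comp => //; apply: measurable_funD.
  exact: (measurableT_comp (@mquad k)).
by apply: measurable_funM.
Qed.

Let mPsi k : measurable_fun setT (Psi k).
Proof. exact: (measurable_Rint1 N01 (@mstep k)). Qed.

Let Psi01 k v : 0 <= Psi k v <= 1.
Proof.
apply: Rint01 => //; apply: measurableT_comp => //.
by apply: measurable_funD => //; apply: measurable_funM.
Qed.

(* 1 - (k / n)^2 = (1 - ((k + 1) / n)^2) + (2 k + 1) / n^2, and normal laws are stable. *)
Let Psi_split k v : (k < n)%N ->
  Psi k v = \int[N01]_y \int[N01]_y' u (quad d n k v + sg k.+1 * y + rh k * y').
Proof.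
move=> kn; rewrite /Psi; set q := quad d n k v.
have E : sg k ^+ 2 = sg k.+1 ^+ 2 + rh k ^+ 2.
  rewrite !sg2// ?(ltnW kn)// rh2 -natr1; field.
  by rewrite pnatr_eq0 -lt0n.
have cf : continuous (fun x : R => u (q + x)).
  move=> x; apply: (@continuous_comp _ _ _ (fun x => q + x) u); last exact: u_cont.
  by apply: continuousD => //; exact: cst_continuous.
have := normal_stable (rh_gt0 k) (sg_gt0 kn) E cf (fun x => proj1 (andP (u01 (q + x)))).
have mf : measurable_fun setT
    (fun p : R * R => u (q + sg k.+1 * p.1 + rh k * p.2)).
  apply: measurableT_comp => //; apply: measurable_funD; last exact: measurable_funM.
  by apply: measurable_funD => //; exact: measurable_funM.
under eq_integral do under eq_integral do rewrite addrA.
move=> stab; apply: etrans (congr1 fine (esym stab)) _.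
have /= E2 := EFin_Rint2 N01 N01 mf (fun=> u01 _).
rewrite [LHS](_ : _ = fine (\int[N01]_y \int[N01]_y' (u (q + sg k.+1 * y + rh k * y'))%:E)%E); last first.
  congr fine; exact: eq_integral.
by rewrite E2.
Qed.

Let C_intble : intble N01 (fun y => (1 + K + `|y|) ^+ 2).
Proof.
rewrite (_ : (fun y => _) = (fun y => (1 + K) ^+ 2 + 2 * (1 + K) * (`|y| ^+ 1) + `|y| ^+ 2)).
  apply: intbleD; last exact: intble_normal_pow.
  by apply: intbleD; [exact: intble_cst|apply: intbleZl; exact: intble_normal_pow].
by apply/funext => y; ring.
Qed.

Let mexch k (x : 'cV[R]_d) : measurable_fun setT (fun p : Z * R =>
  u (quad d n k (dot (x + r *: xi p.1) (x + r *: xi p.1)) + sg k * p.2)).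
Proof.
apply: measurableT_comp => //; apply: measurable_funD; last exact: measurable_funM.
apply: (measurableT_comp (@mquad k)).
apply: measurable_dot_self => i; under [fun t => _]funext do rewrite !mxE.
by apply: measurable_funD => //; apply: measurable_funM => //; exact: (measurableT_comp (mxi i)).
Qed.

(** Fubini takes the normal variable y of step k + 1 outside; [exchange_step] applies for each y,
    and its weight [L y ^+ 2] integrates to [C]. *)
Let Psi_step k (x : 'cV[R]_d) : (k < n)%N ->
  `|\int[nu]_z Psi k.+1 (dot (x + r *: xi z) (x + r *: xi z)) - Psi k (dot x x)|
  <= M * step_error nu n xi * C.
Proof.
move=> kn; rewrite Psi_split// /Psi (Rint_fubini nu N01 (@mexch k.+1 x))//.
have m1 := measurable_Rint2 nu (@mexch k.+1 x) (fun=> u01 _).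
have b1 y := Rint01 nu (measurableT_comp (@mexch k.+1 x) (measurable_pair2 y)) (fun=> u01 _).
set q := quad d n k (dot x x).
have mf : measurable_fun setT
    (fun p : R * R => u (q + sg k.+1 * p.1 + rh k * p.2)).
  apply: measurableT_comp => //; apply: measurable_funD; last exact: measurable_funM.
  by apply: measurable_funD => //; exact: measurable_funM.
have m2 := measurable_Rint1 N01 mf (fun=> u01 _).
have b2 y := Rint01 N01 (measurableT_comp mf (measurable_pair1 y)) (fun=> u01 _).
have i1 := intble_bounded N01 m1 (fun y => norm_in01 (b1 y)).
have i2 := intble_bounded N01 m2 (fun y => norm_in01 (b2 y)).
rewrite -RintB// (le_trans (Rint_norm_le (intbleB i1 i2)))//.
rewrite -RintZl//; apply: Rint_le => //.
- by apply: intble_norm; exact: intbleB.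
- exact: intbleZl.
- move=> y; apply: (exchange_step d0 n0 mxi ixx Ex Exx uT ix3) => //.
  + exact: sg01.
  + exact: ltW.
Qed.

Let A k := \int[P]_w Psi k (dot (tuple_sum r (first_obs Zs k w))
                               (tuple_sum r (first_obs Zs k w))).

Let mS k : measurable_fun setT (fun w => dot (tuple_sum r (first_obs Zs k w))
                               (tuple_sum r (first_obs Zs k w))).
Proof.
apply: measurable_dot_self => i.
exact: measurable_sum_first_obs.
Qed.

Let A_step k : (k < n)%N -> `|A k.+1 - A k| <= M * step_error nu n xi * C.
Proof.
move=> kn.
pose F (p : k.-tuple Z * Z) := Psi k.+1 (dot (tuple_sum r p.1 + r *: xi p.2)
                                         (tuple_sum r p.1 + r *: xi p.2)).
have mF : measurable_fun setT F.
  by apply: measurableT_comp; [exact: mPsi|exact: measurable_next_sum].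
have F01 p : 0 <= F p <= 1 by exact: Psi01.
have AE : A k.+1 = \int[P]_w \int[nu]_z F (first_obs Zs k w, z).
  apply: EFin_inj; rewrite -EFin_Rintegral; last first.
    apply: (@intble_bounded _ _ _ _ _ 1) => [|w]; last exact: norm_in01.
    exact: (measurableT_comp (@mPsi k.+1)).
  under eq_integral do rewrite tuple_sum_next.
  rewrite (integral_next mZ lawZ indep (G := fun p => (F p)%:E)).
  - rewrite -EFin_Rintegral.
      apply: eq_integral => w _; rewrite EFin_Rintegral//; exact: intble_section1.
    apply: (@intble_bounded _ _ _ _ _ 1) => [|w].
      apply: (measurableT_comp (measurable_Rint1 nu mF F01)).
      exact: measurable_first_obs.
    apply: norm_in01; apply: Rint01 => //.
    by apply: measurableT_comp mF _; exact: pair1_measurable.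
  - exact/measurable_EFinP.
  - by move=> p; rewrite lee_fin; have /andP[] := F01 p.
rewrite AE; apply: Rint_dist => //.
- apply: (@intble_bounded _ _ _ _ _ 1) => [|w].
    apply: (measurableT_comp (measurable_Rint1 nu mF F01)).
    exact: measurable_first_obs.
  apply: norm_in01; apply: Rint01 => //.
  by apply: measurableT_comp mF _; exact: pair1_measurable.
- apply: (@intble_bounded _ _ _ _ _ 1) => [|w]; last exact: norm_in01.
  exact: (measurableT_comp (@mPsi k)).
- by move=> w; have := Psi_step (tuple_sum r (first_obs Zs k w)) kn.
Qed.

Lemma lindeberg :
  `|\int[P]_w u (quad d n n (dot (tuple_sum r (first_obs Zs n w))
                                 (tuple_sum r (first_obs Zs n w))))
    - \int[N01]_y u y| <= n%:R * (M * step_error nu n xi * C).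
Proof.
(* At k = 0 the sum is empty and sg 0 = 1; at k = n the normal part has disappeared. *)
have A0 : A 0 = \int[N01]_y u y.
  rewrite /A; under eq_Rintegral do rewrite tuple_sum_first_obs big_ord0.
  rewrite Rint_cst; apply: eq_Rintegral => y _.
  rewrite /sg mul0r expr0n/= subr0 sqrtr1 mul1r /quad mul0r subr0.
  by rewrite [dot _ _]big1 ?mul0r ?add0r// => i _; rewrite mxE mul0r.
have An : A n = \int[P]_w u (quad d n n (dot (tuple_sum r (first_obs Zs n w))
                                 (tuple_sum r (first_obs Zs n w)))).
  apply: eq_Rintegral => w _; rewrite /Psi /sg divff ?gt_eqF// expr1n subrr sqrtr0.
  by under eq_Rintegral do rewrite mul0r addr0; rewrite Rint_cst.
rewrite -An -A0; exact: telescope_le A_step.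
Qed.

End ScaledSums.

(** * Normal limit of the squared length in growing dimension *)

Section NormalLimit.
Context {R : realType} {dO : measure_display} {Om : measurableType dO}.
Variable P : probability Om R.
Context dZ (Z : measurableType dZ) (nu : probability Z R) (Zs : nat -> Om -> Z).
Hypothesis mZ : forall i, measurable_fun setT (Zs i).
Hypothesis lawZ : forall i B, measurable B -> P (Zs i @^-1` B) = nu B.
Hypothesis indep : forall n (B : nat -> set Z), (forall i, measurable (B i)) ->
  P (\bigcap_(i < n) (Zs i @^-1` B i)) =
  (\prod_(i < n) fine (P (Zs i @^-1` B i)))%:E.

Section StepErrorBound.
Variables (d n : nat) (xi : Z -> 'cV[R]_d).
Hypotheses (d0 : (0 < d)%N) (n0 : (0 < n)%N).
Hypothesis mxi : forall i, measurable_fun setT (fun z => xi z i ord0).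
Hypothesis ixx : forall i j, intble nu (fun z => xi z i ord0 * xi z j ord0).
Hypothesis Exx : forall i j, \int[nu]_z (xi z i ord0 * xi z j ord0) = (i == j)%:R.
Hypothesis ix3 : intble nu (fun z => enorm (xi z) ^+ 3).
Let s : R := Num.sqrt d%:R.
Let r : R := (Num.sqrt n%:R)^-1.
Let m3 := \int[nu]_z (enorm (xi z) ^+ 3).

(** Lyapunov's inequality, by integrating 3 s a^2 <= 2 a^3 + s^3, that is (a - s)^2 (2 a + s) >= 0,
    at a = |xi|, where a^2 has mean s^2. *)
Lemma third_moment_ge : s ^+ 3 <= m3.
Proof.
have s2 : s ^+ 2 = d%:R by rewrite sqr_sqrtr.
have s0 : 0 <= s by exact: sqrtr_ge0.
have i2 : intble nu (fun z => 3 * s * dot (xi z) (xi z)).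
  by apply: intbleZl; exact: intble_dot_self.
have i3 : intble nu (fun z => 2 * enorm (xi z) ^+ 3 + s ^+ 3).
  by apply: intbleD; [exact: intbleZl|exact: intble_cst].
have : \int[nu]_z (3 * s * dot (xi z) (xi z)) <=
    \int[nu]_z (2 * enorm (xi z) ^+ 3 + s ^+ 3).
  apply: Rint_le => // z; rewrite -enorm_sqr; have := enorm_ge0 (xi z).
  set a := enorm _ => a0.
  have := mulr_ge0 (sqr_ge0 (a - s)) (addr_ge0 (mulr_ge0 (ler0n _ 2) a0) s0); nra.
rewrite RintZl ?Rint_dot_self//; last exact: intble_dot_self.
rewrite RintD ?Rint_cst ?RintZl//; [|exact: intbleZl|exact: intble_cst].
by rewrite -/m3 -s2; set t := s ^+ 3 => h; move: h; rewrite (_ : 3 * s * s ^+ 2 = 3 * t); [lra|rewrite /t; ring].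
Qed.

(** As n r^2 = 1 and s^3 <= m3, each term but one is a multiple of d m3 r, with 161 = 20 * 8 + 1;
    the exception 2 / s vanishes as d grows. *)
Lemma step_error_le : n%:R * step_error nu n xi <=
  (161 + 4 * gauss3) * (d%:R * m3 * r) + 2 / s.
Proof.
have dR1 : 1 <= d%:R :> R by rewrite ler1n.
have nR1 : 1 <= n%:R :> R by rewrite ler1n.
have s1 : 1 <= s by rewrite -sqrtr1 ler_sqrt// ltr0n.
have s0 : 0 < s by rewrite (lt_le_trans ltr01).
have r0 : 0 < r by rewrite invr_gt0 sqrtr_gt0 ltr0n.
have nr2 : n%:R * r ^+ 2 = 1.
  by rewrite exprVn sqr_sqrtr// divff// gt_eqF// ltr0n.
have q1 : 1 <= Num.sqrt n%:R :> R by rewrite -{1}sqrtr1 ler_wsqrtr.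
have r1 : r <= 1 by rewrite /r invf_le1// (lt_le_trans ltr01).
have sm := third_moment_ge.
have s31 : 1 <= s ^+ 3 by rewrite exprn_ege1.
have m31 : 1 <= m3 by exact: le_trans sm.
have g0 := @gauss3_ge0 R.
have xr : m3 * r <= d%:R * m3 * r.
  by rewrite -mulrA ler_peMl// mulr_ge0 ?(ltW r0)// (le_trans ler01).
have rm : r <= m3 * r by rewrite ler_peMl// ltW.
have te := third_error_le n0 mxi ix3; rewrite -/m3 -/s -/r in te.
have nte : n%:R * third_error nu n xi <= 8 * (m3 * r).
  rewrite (le_trans (ler_wpM2l (ler0n _ n) te))//.
  rewrite (_ : n%:R * _ = 4 * r * (n%:R * r ^+ 2) * (m3 + s ^+ 3)); last by ring.
  rewrite nr2 mulr1; have := ler_wpM2l (ltW r0) sm; lra.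
rewrite /step_error -/r -/s.
rewrite (_ : n%:R * _ = 20 * (n%:R * third_error nu n xi) +
  4 * r * gauss3 * (n%:R * r ^+ 2) + 2 * (n%:R * r ^+ 2) / s +
  r ^+ 2 * (n%:R * r ^+ 2)); last by ring.
rewrite nr2 !mulr1.
have rr : r ^+ 2 <= r by rewrite expr2 ler_piMl// ltW.
have g1 : 4 * r * gauss3 <= 4 * gauss3 * (d%:R * m3 * r).
  rewrite mulrAC ler_wpM2l ?mulr_ge0//; lra.
move: g1 nte; set X := d%:R * m3 * r in xr *; set Y := n%:R * _.
set a := 4 * r * gauss3; set t := 2 / s; move=> g1 nte.
rewrite mulrDl; lra.
Qed.

End StepErrorBound.

Variables (d : nat -> nat) (xi : forall n, Z -> 'cV[R]_(d n)).
Hypothesis mxi : forall n i, measurable_fun setT (fun z => xi n z i ord0).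
Hypothesis ixx : forall n i j, intble nu (fun z => xi n z i ord0 * xi n z j ord0).
Hypothesis Ex : forall n i, \int[nu]_z xi n z i ord0 = 0.
Hypothesis Exx : forall n i j,
  \int[nu]_z (xi n z i ord0 * xi n z j ord0) = (i == j)%:R.
Hypothesis d_oo : d n @[n --> \oo] --> \oo.
Hypothesis m3_small : ((d n)%:R%:E * (\int[nu]_z (enorm (xi n z) ^+ 3)%:E) *
  ((Num.sqrt n%:R)^-1)%:E)%E @[n --> \oo] --> 0%E.

Let T n w := tuple_sum (xi n) (Num.sqrt n%:R)^-1 (first_obs Zs n w).

Lemma chi2_normal_limit : cvg_in_law P
  (fun n w => (dot (T n w) (T n w) - (d n)%:R) / Num.sqrt (2 * (d n)%:R))
  (law_of (normal_prob (0 : R) 1) id).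
Proof.
refine (@cvg_in_law_steps R dO Om P _ _ (normal_prob (0 : R) 1) id _
  (@smooth_step R) _ _ _ _ _ _ _).
- by [].
- exact: smooth_step_continuous.
- exact: smooth_step01.
- exact: smooth_step_le0.
- exact: smooth_step_ge1.
- move=> n; apply: measurable_funM => //; apply: measurable_funB => //.
  by apply: measurable_dot_self => i; exact: measurable_sum_first_obs.
move=> a eta eta0 e e0.
have [u1 [u2 [u3 [K [M uT]]]]] := test_function_step a eta0.
have [K0 M0] := test_ge0 uT.
set C := \int[normal_prob (0 : R) 1]_y ((1 + K + `|y|) ^+ 2).
have C0 : 0 <= C by apply: Rintegral_ge0 => y _; exact: sqr_ge0.
have g0 := @gauss3_ge0 R.
pose x n : R := fine ((d n)%:R%:E * (\int[nu]_z (enorm (xi n z) ^+ 3)%:E) *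
  ((Num.sqrt n%:R)^-1)%:E)%E.
have /fine_cvgP[fin_x cvg_x] := m3_small.
pose k : R := M * C * (161 + 4 * gauss3) + 1.
have k0 : 0 < k by rewrite ltr_wpDl// !mulr_ge0// addr_ge0// mulr_ge0.
have k'0 : 0 < 2 * (M * C) + 1 by rewrite ltr_wpDl// !mulr_ge0.
have d_pos : \forall n \near \oo, (0 < d n)%N.
  by apply: (d_oo (t := [set m | (0 < m)%N])); exact: nbhs_infty_gt.
(* Chosen so that the contribution of 2 / sqrt d is at most e / 2. *)
have d_big : \forall n \near \oo, (4 * (M * C) / e) ^+ 2 <= (d n)%:R :> R.
  by apply: (d_oo (t := [set m | (4 * (M * C) / e) ^+ 2 <= m%:R :> R])); exact: nbhs_infty_ger.
have x_small : \forall n \near \oo, `|x n| <= e / 2 / k.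
  move/cvgrPdist_le : cvg_x => /(_ (e / 2 / k)); rewrite !divr_gt0// => h.
  by apply: filterS (h isT) => m; rewrite sub0r normrN.
near=> n.
have n0 : (0 < n)%N by near: n; exact: nbhs_infty_gt.
have d0 : (0 < d n)%N by near: n.
have nR0 : 0 < n%:R :> R by rewrite ltr0n.
have dR0 : 0 < (d n)%:R :> R by rewrite ltr0n.
have r0 : 0 < (Num.sqrt n%:R)^-1 :> R by rewrite invr_gt0 sqrtr_gt0.
have xn : `|x n| <= e / 2 / k by near: n.
have sn : (4 * (M * C) / e) ^+ 2 <= (d n)%:R :> R by near: n.
have fx : ((d n)%:R%:E * (\int[nu]_z (enorm (xi n z) ^+ 3)%:E) *
  ((Num.sqrt n%:R)^-1)%:E)%E \is a fin_num by near: n.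
have I0 : (0 <= \int[nu]_z (enorm (xi n z) ^+ 3)%:E)%E.
  by apply: integral_ge0 => z _; rewrite lee_fin exprn_ge0// enorm_ge0.
(* An infinite third moment would make the product with the positive factors infinite. *)
have Ifin : (\int[nu]_z (enorm (xi n z) ^+ 3)%:E)%E \is a fin_num.
  rewrite ge0_fin_numE// ltey; apply: contraTneq fx => ->.
  by rewrite gt0_muley ?lte_fin// mulyr gtr0_sg// mul1e.
have ix3 : intble nu (fun z => enorm (xi n z) ^+ 3).
  apply/integrableP; split.
    by apply/measurable_EFinP; apply: measurable_funX; exact: measurable_enorm_xi.
  rewrite (_ : (\int[nu]_z _)%E = (\int[nu]_z (enorm (xi n z) ^+ 3)%:E)%E).
    by rewrite -ge0_fin_numE.
  by apply: eq_integral => z _ /=; rewrite ger0_norm// exprn_ge0// enorm_ge0.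
have xE : x n = (d n)%:R * \int[nu]_z (enorm (xi n z) ^+ 3) * (Num.sqrt n%:R)^-1.
  by rewrite /x !fineM// fin_numM.
have := lindeberg mZ lawZ indep (@mxi n) (@ixx n) (@Ex n) (@Exx n) d0 n0 ix3 uT.
rewrite (_ : \int[P]_w _ = \int[P]_w smooth_step
    (((dot (T n w) (T n w) - (d n)%:R) / Num.sqrt (2 * (d n)%:R) - a) / eta)); last first.
  apply: eq_Rintegral => w _; rewrite /quad -/(T n w).
  by rewrite mulrCA divff ?mulr1// gt_eqF.
move/le_trans; apply; rewrite -/C.
have se := step_error_le d0 n0 (@mxi n) (@ixx n) (@Exx n) ix3; rewrite -xE in se.
have ss : (M * C) * (2 / Num.sqrt (d n)%:R) <= e / 2.
  have s0 : 0 < Num.sqrt (d n)%:R :> R by rewrite sqrtr_gt0.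
  rewrite mulrA ler_pdivrMr//.
  have q0 : 0 <= 4 * (M * C) / e by rewrite divr_ge0 ?mulr_ge0// ltW.
  have : 4 * (M * C) / e <= Num.sqrt (d n)%:R.
    by rewrite -(@ler_pXn2r _ 2)// ?nnegrE ?sqrtr_ge0// sqr_sqrtr.
  rewrite ler_pdivrMr// => h; lra.
have kx : (M * C) * ((161 + 4 * gauss3) * x n) <= e / 2.
  rewrite mulrA (@le_trans _ _ (k * `|x n|))//.
    have k1 : 0 <= M * C * (161 + 4 * gauss3).
      by rewrite !mulr_ge0// addr_ge0// mulr_ge0.
    by rewrite (le_trans (ler_wpM2l k1 (ler_norm _)))// ler_wpM2r// lerDl.
  by rewrite mulrC -ler_pdivlMr.
rewrite (_ : n%:R * _ = (M * C) * (n%:R * step_error nu n (xi n))); last by ring.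
rewrite (le_trans (ler_wpM2l (mulr_ge0 M0 C0) se))// mulrDr.
by rewrite (le_trans (lerD kx ss))// -splitr.
Unshelve. all: by end_near.
Qed.

End NormalLimit.

(** * Moments of the score *)

Section Exhaustion.
Context {R : realType} d (T : measurableType d) (mu : probability T R).
Implicit Types f g w : T -> R.

Lemma intble_mul_bounded w f (C : R) : measurable_fun setT w ->
  (forall x, `|w x| <= C) -> intble mu f -> intble mu (fun x => w x * f x).
Proof.
move=> mw wC hf; apply: (intble_le (g := fun x => C * `|f x|)).
- by apply: measurable_funM => //; exact: intble_measurable hf.
- by apply: intbleZl; exact: intble_norm.
- by move=> x; rewrite normrM ler_wpM2r.
Qed.

Variable t : T -> R.
Hypothesis mt : measurable_fun setT t.

(** Multiplied by a coefficient that t dominates, this indicator gives a bounded weight, to which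
    the identities of conditional expectation apply; K then tends to infinity. *)
Definition trunc (K : nat) (x : T) : R :=
  if t x <= K%:R then 1 else 0.

Lemma trunc01 K x : 0 <= trunc K x <= 1.
Proof. by rewrite /trunc; case: ifP; rewrite ?lexx ler01. Qed.

Lemma trunc_norm K x : `|trunc K x| <= 1.
Proof. by have /norm_in01 := trunc01 K x. Qed.

Lemma measurable_trunc K : measurable_fun setT (trunc K).
Proof.
have mb : measurable_fun setT (fun x => t x <= K%:R) by apply: measurable_fun_ler.
exact: measurable_fun_ifT.
Qed.

Lemma trunc_homo x : {homo trunc^~ x : n m / (n <= m)%N >-> n <= m}.
Proof.
move=> n m nm; rewrite /trunc; case: ifP => [tn|_]; last by case: ifP.
by rewrite (le_trans tn)// ler_nat.
Qed.

Lemma trunc_near x : \forall K \near \oo, trunc K x = 1.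
Proof.
near=> K; rewrite /trunc ifT//; near: K; exact: nbhs_infty_ger.
Unshelve. all: by end_near. Qed.

Lemma intble_exhaust f (C : R) : measurable_fun setT f ->
  (forall K, (\int[mu]_x (trunc K x * `|f x|)%:E <= C%:E)%E) -> intble mu f.
Proof.
move=> mf fC; apply/integrableP; split; first exact/measurable_EFinP.
have mn : measurable_fun setT (fun x => `|f x|) by exact: measurableT_comp.
have mg K : measurable_fun setT (fun x => (trunc K x * `|f x|)%:E).
  by apply/measurable_EFinP; apply: measurable_funM => //; exact: measurable_trunc.
have lx x : limn (fun K => (trunc K x * `|f x|)%:E) = (`|f x|)%:E.
  apply: cvg_lim => //; apply: cvg_near_cst.
  by apply: filterS (trunc_near x) => K ->; rewrite mul1r.
have -> : (\int[mu]_x `|(EFin \o f) x| =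
    limn (fun K => \int[mu]_x (trunc K x * `|f x|)%:E))%E.
  transitivity (\int[mu]_x limn (fun K => (trunc K x * `|f x|)%:E))%E.
    by apply: eq_integral => x _; rewrite lx.
  apply: (@monotone_convergence _ _ _ mu _ measurableT (fun K x => (trunc K x * `|f x|)%:E)) => //.
  - by move=> n x _; rewrite lee_fin mulr_ge0//; have /andP[] := trunc01 n x.
  - by move=> x _ n m nm; rewrite lee_fin ler_wpM2r// trunc_homo.
apply: (@le_lt_trans _ _ C%:E); last exact: ltry.
apply: lime_le; last exact: nearW.
apply: ereal_nondecreasing_is_cvgn => n m nm; apply: ge0_le_integral => //.
- by move=> x _; rewrite lee_fin mulr_ge0//; have /andP[] := trunc01 n x.
- by move=> x _; rewrite lee_fin ler_wpM2r// trunc_homo.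
Qed.

Lemma Rint_exhaust0 f : intble mu f ->
  (forall K, \int[mu]_x (trunc K x * f x) = 0) -> \int[mu]_x f x = 0.
Proof.
move=> hf f0; have mf := intble_measurable hf.
have mg K : measurable_fun setT (fun x => (trunc K x * f x)%:E).
  by apply/measurable_EFinP; apply: measurable_funM => //; exact: measurable_trunc.
have := @dominated_convergence _ _ _ mu _ measurableT
  (fun K x => (trunc K x * f x)%:E) (EFin \o f) (fun x => `|f x|%:E) mg.
case.
- exact/measurable_EFinP.
- apply: aeW => x _; apply: cvg_near_cst.
  by apply: filterS (trunc_near x) => K ->; rewrite mul1r.
- exact: intble_norm.
- apply: aeW => x K _; rewrite abse_EFin lee_fin normrM.
  by rewrite ler_piMl// trunc_norm.
move=> _ _; rewrite (_ : [sequence _]_n = fun=> 0%E); last first.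
  apply/funext => K /=; rewrite EFin_Rintegral ?f0//.
  by apply: (@intble_mul_bounded _ _ 1) => //; [exact: measurable_trunc|exact: trunc_norm].
move=> h; have h' := cvg_unique _ h (cvg_cst 0%E).
by rewrite /Rintegral [X in fine X](h' _).
Qed.

End Exhaustion.

(** The sum is e min (N, floor (v / e)), written with indicators of the events i e <= v. *)
Lemma staircase {R : realType} (e v : R) (N : nat) : 0 < e -> 0 <= v ->
  let s := \sum_(i < N) e * (if i.+1%:R * e <= v then 1 else 0) in
  (N%:R * e <= v -> s = N%:R * e) /\ (v <= N%:R * e -> s <= v <= s + e).
Proof.
move=> e0 v0 s; rewrite {}/s; elim: N => [|N [IH1 IH2]].
  rewrite big_ord0 mul0r; split=> // h.
  by rewrite add0r v0 (le_trans h)// ltW.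
rewrite big_ord_recr /=; case: ifP => h.
  have hN : N%:R * e <= v by rewrite (le_trans _ h)// ler_wpM2r ?(ltW e0)// ler_nat.
  rewrite IH1// mulr1 (_ : N%:R * e + e = N.+1%:R * e); last by rewrite -natr1; ring.
  by split=> // h'; rewrite h (le_trans h')// lerDl ltW.
move/negbT : h; rewrite -ltNge => h.
rewrite mulr0 addr0; split=> // _.
have [hN|hN] := leP (N%:R * e) v; last exact: IH2 (ltW hN).
rewrite IH1// hN /= (le_trans (ltW h))// -natr1; lra.
Qed.

Section ConditionalExpectation.
Context {R : realType} d1 d2 (Y : measurableType d1) (X : measurableType d2).
Variables (mu : probability (Y * X)%type R) (D : Y * X -> R).
Hypothesis iD : intble mu D.
Hypothesis D0 : forall B : set X, measurable B ->
  (\int[mu]_(z in snd @^-1` B) (D z)%:E = 0)%E.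

(* Weights with values in [0, Ne] are within [e] of a combination of
   indicators of events of [X]. *)
Lemma Rint_weight0 (w : X -> R) (C : R) : measurable_fun setT w ->
  (forall x, `|w x| <= C) -> \int[mu]_z (w z.2 * D z) = 0.
Proof.
move=> mw wC'; pose C' := `|C|.
have wC x : `|w x| <= C' by rewrite (le_trans (wC' x))// ler_norm.
have wi (v : X -> R) K : measurable_fun setT v -> (forall x, `|v x| <= K) ->
    intble mu (fun z => v z.2 * D z).
  move=> mv vK; apply: (@intble_mul_bounded _ _ _ _ (v \o snd) D K) => // [|z].
    exact: measurableT_comp.
  exact: vK.
have mA (e : R) i : measurable_fun setT
    (fun x => if i%:R * e <= w x + C' then 1 else 0 : R).
  apply: measurable_fun_ifT => //; apply: measurable_fun_ler => //.
  exact: measurable_funD.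
have DA e i : \int[mu]_z ((if i%:R * e <= w z.2 + C' then 1 else 0) * D z) = 0.
  pose B := [set x | i%:R * e <= w x + C'].
  have mB : measurable B.
    rewrite -[B]setTI; apply: measurable_fun_ler => //; exact: measurable_funD.
  transitivity (\int[mu]_(z in snd @^-1` B) D z).
    rewrite [RHS]Rintegral_mkcond; apply: eq_Rintegral => z _.
    rewrite patchE; case: ifPn => h.
      by rewrite mem_set ?mul1r.
    by rewrite memNset ?mul0r//; exact/negP.
  by rewrite /Rintegral D0.
have ED : \int[mu]_z D z = 0.
  by rewrite /Rintegral -[setT](preimage_setT (@snd Y X)) D0.
apply: (@eq0_of_small _ _ (\int[mu]_z `|D z|)) => e e0 _.
(* The shifted weight w + C' lies in [0, 2 C'], which N stairs of height e cover. *)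
pose N := (Num.truncn (2 * C' / e)).+1.
have NC : 2 * C' <= N%:R * e.
  by rewrite -ler_pdivrMr//; apply: ltW; exact: truncnS_gt.
pose W (x : X) := \sum_(i < N) e * (if i.+1%:R * e <= w x + C' then 1 else 0).
have Wv x : `|w x + C' - W x| <= e.
  have := wC x; rewrite ler_norml => /andP[w1 w2].
  have v0 : 0 <= w x + C' by lra.
  have [_ /(_ _)] := @staircase R e (w x + C') N e0 v0.
  rewrite -/(W x) => /(_ _)/andP[|W1 W2]; first by rewrite (le_trans _ NC)//; lra.
  by rewrite ler_norml; apply/andP; split; lra.
have iDA i : intble mu (fun z => (if i%:R * e <= w z.2 + C' then 1 else 0) * D z).
  by apply: (wi (fun x => if i%:R * e <= w x + C' then 1 else 0) 1) => // x;
    case: ifP; rewrite ?normr1 ?normr0.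
have WE z : W z.2 * D z = \sum_(i < N) e *
    ((if i.+1%:R * e <= w z.2 + C' then 1 else 0) * D z).
  by rewrite /W mulr_suml; apply: eq_bigr => i _; rewrite mulrA.
have iW : intble mu (fun z => W z.2 * D z).
  under [fun z => _]funext do rewrite WE.
  by apply: intble_sum => i _; exact: intbleZl.
have EW : \int[mu]_z (W z.2 * D z) = 0.
  under eq_Rintegral do rewrite WE.
  rewrite Rint_sum => [|i _]; last exact: intbleZl.
  by rewrite big1// => i _; rewrite RintZl// DA mulr0.
have iw := wi _ _ mw wC.
have iR : intble mu (fun z => (w z.2 + C' - W z.2) * D z).
  rewrite (_ : (fun z => _) = (fun z => w z.2 * D z + C' * D z - W z.2 * D z)).
    by apply: intbleB => //; apply: intbleD => //; exact: intbleZl.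
  by apply/funext => z; ring.
have -> : \int[mu]_z (w z.2 * D z) = \int[mu]_z ((w z.2 + C' - W z.2) * D z).
  transitivity (\int[mu]_z (w z.2 * D z + C' * D z - W z.2 * D z)).
    rewrite RintB//; last by apply: intbleD => //; exact: intbleZl.
    rewrite EW subr0 RintD//; last exact: intbleZl.
    by rewrite RintZl// ED mulr0 addr0.
  by apply: eq_Rintegral => z _; ring.
rewrite (le_trans (Rint_norm_le iR))// mulrC -RintZl; last exact: intble_norm.
apply: Rint_le.
- exact: intble_norm.
- by apply: intbleZl; exact: intble_norm.
- by move=> z; rewrite normrM ler_wpM2r.
Qed.

End ConditionalExpectation.

Section MeasurableMatrices.
Context {R : realType} d (T : measurableType d).

Lemma measurable_bigprod I (s : seq I) (f : I -> T -> R) :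
  (forall i, measurable_fun setT (f i)) ->
  measurable_fun setT (fun x => \prod_(i <- s) f i x).
Proof.
move=> mf; elim: s => [|a s IH].
  by under [fun x => _]funext do rewrite big_nil; exact: measurable_cst.
under [fun x => _]funext do rewrite big_cons.
exact: measurable_funM.
Qed.

Lemma measurable_mulmx m n p (A : T -> 'M[R]_(m, n)) (B : T -> 'M[R]_(n, p)) :
  (forall i j, measurable_fun setT (fun x => A x i j)) ->
  (forall i j, measurable_fun setT (fun x => B x i j)) ->
  forall i j, measurable_fun setT (fun x => (A x *m B x) i j).
Proof.
move=> mA mB i j; under [fun x => _]funext do rewrite mxE.
by apply: measurable_sum => k; exact: measurable_funM.
Qed.

Lemma measurable_trmx m n (A : T -> 'M[R]_(m, n)) :
  (forall i j, measurable_fun setT (fun x => A x i j)) ->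
  forall i j, measurable_fun setT (fun x => (A x)^T i j).
Proof. by move=> mA i j; under [fun x => _]funext do rewrite mxE; exact: mA. Qed.

Lemma measurable_det n (A : T -> 'M[R]_n) :
  (forall i j, measurable_fun setT (fun x => A x i j)) ->
  measurable_fun setT (fun x => \det (A x)).
Proof.
move=> mA; apply: measurable_sum => s; apply: measurable_funM => //.
exact: measurable_bigprod.
Qed.

(** Writing the inverse as f (f^2)^(-1) reduces it to a power of a nonnegative function; where f
    vanishes, both sides are 0. *)
Lemma measurable_invr (f : T -> R) : measurable_fun setT f ->
  measurable_fun setT (fun x => (f x)^-1).
Proof.
move=> mf; rewrite (_ : (fun x => _) = (fun x => f x * (f x ^+ 2) `^ (-1))).
  apply: measurable_funM => //.
  apply: (@measurableT_comp _ _ _ _ _ _ (@powR R ^~ (-1)) _ (fun x => f x ^+ 2)).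
    exact: measurable_powR.
  exact: measurable_funX.
apply/funext => x; rewrite powR_inv1 ?sqr_ge0// expr2.
have [->|f0] := eqVneq (f x) 0; first by rewrite invr0 mul0r.
by rewrite invfM mulrA divff// mul1r.
Qed.

Lemma measurable_invmx n (A : T -> 'M[R]_n) :
  (forall x, A x \in unitmx) ->
  (forall i j, measurable_fun setT (fun x => A x i j)) ->
  forall i j, measurable_fun setT (fun x => invmx (A x) i j).
Proof.
move=> uA mA i j.
rewrite (_ : (fun x => _) = (fun x => (\det (A x))^-1 * cofactor (A x) j i)); last first.
  by apply/funext => x; rewrite /invmx uA !mxE.
apply: measurable_funM; first by apply: measurable_invr; exact: measurable_det.
apply: measurable_funM => //; apply: measurable_det => k l.
by under [fun x => _]funext do rewrite !mxE; exact: mA.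
Qed.

End MeasurableMatrices.

Section WeightedResiduals.
Context {R : realType} d1 d2 (Y : measurableType d1) (X : measurableType d2).
Variables (mu : probability (Y * X)%type R) (q d : nat).
Variables (rh : Y * X -> 'cV[R]_q) (c : X -> 'M[R]_(d, q)) (V : X -> 'M[R]_q).
Hypothesis mc : forall i k, measurable_fun setT (fun x => c x i k).
Hypothesis mV : forall k l, measurable_fun setT (fun x => V x k l).
Hypothesis irh : forall k, intble mu (fun z => rh z k ord0).
Hypothesis irr : forall k l, intble mu (fun z => rh z k ord0 * rh z l ord0).
Hypothesis iV : forall k l, intble mu (fun z => V z.2 k l).
Hypothesis Erh : forall k (w : X -> R) C, measurable_fun setT w ->
  (forall x, `|w x| <= C) -> \int[mu]_z (w z.2 * rh z k ord0) = 0.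
Hypothesis Err : forall k l (w : X -> R) C, measurable_fun setT w ->
  (forall x, `|w x| <= C) ->
  \int[mu]_z (w z.2 * (rh z k ord0 * rh z l ord0)) =
  \int[mu]_z (w z.2 * V z.2 k l).

Let p (z : Y * X) : 'cV[R]_d := c z.2 *m rh z.
Let B (x : X) : 'M[R]_d := c x *m V x *m (c x)^T.
(** It dominates every entry of [c x], so the entries truncated by [chi K] are at most K. *)
Let t (x : X) : R := \sum_i \sum_k `|c x i k|.
Let chi K (x : X) : R := trunc t K x.

(* [fine] sends infinite integrals to 0, so that [Bfin] implies integrability. *)
Hypothesis Bfin : forall i, 0 < fine (\int[mu]_z (B z.2 i i)%:E)%E.

Let mt : measurable_fun setT t.
Proof.
by apply: measurable_sum => i; apply: measurable_sum => k; exact: measurableT_comp.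
Qed.

Let mchi K : measurable_fun setT (chi K). Proof. exact: measurable_trunc. Qed.

Let mt2 : measurable_fun setT (fun z : Y * X => t z.2).
Proof. exact: measurableT_comp. Qed.

Let chic K x i k : `|chi K x * c x i k| <= K%:R.
Proof.
rewrite /chi /trunc; case: ifP => h; last by rewrite mul0r normr0.
rewrite mul1r (le_trans _ h)// /t (bigD1 i)//= (bigD1 k)//= -addrA lerDl.
by rewrite addr_ge0 ?sumr_ge0// => *; rewrite sumr_ge0.
Qed.

Let chi2 K x : chi K x = chi K x * chi K x.
Proof. by rewrite /chi /trunc; case: ifP; rewrite ?mulr1 ?mulr0. Qed.

Let mrh k : measurable_fun setT (fun z => rh z k ord0).
Proof. exact: intble_measurable (irh k). Qed.

Let mp i : measurable_fun setT (fun z => p z i ord0).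
Proof.
under [fun z => _]funext do rewrite mxE.
apply: measurable_sum => k; apply: measurable_funM => //.
exact: (measurableT_comp (mc i k)).
Qed.

Let mB i j : measurable_fun setT (fun x => B x i j).
Proof.
by apply: measurable_mulmx; [apply: measurable_mulmx|exact: measurable_trmx].
Qed.

Let wcc_bound (w : X -> R) C K i j k l x : 0 <= C -> (forall x, `|w x| <= C) ->
  `|w x * ((chi K x * c x i k) * (chi K x * c x j l))| <= C * (K%:R * K%:R).
Proof. by move=> C0 wC; rewrite normrM ler_pM// normrM ler_pM. Qed.

Let mwcc (w : X -> R) K i j k l : measurable_fun setT w ->
  measurable_fun setT (fun x => w x * ((chi K x * c x i k) * (chi K x * c x j l))).
Proof.
by move=> mw; do ![apply: measurable_funM => //].
Qed.

Let weighted_pp (w : X -> R) K i j z :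
  chi K z.2 * (w z.2 * (p z i ord0 * p z j ord0)) =
  \sum_k \sum_l (w z.2 * ((chi K z.2 * c z.2 i k) * (chi K z.2 * c z.2 j l))) *
    (rh z k ord0 * rh z l ord0).
Proof.
rewrite [in LHS]chi2 !mxE mulr_suml !mulr_sumr; apply: eq_bigr => k _.
by rewrite !mulr_sumr; apply: eq_bigr => l _; ring.
Qed.

Let weighted_B (w : X -> R) K i j x :
  chi K x * (w x * B x i j) =
  \sum_k \sum_l (w x * ((chi K x * c x i k) * (chi K x * c x j l))) * V x k l.
Proof.
rewrite [in LHS]chi2 /B mxE !mulr_sumr exchange_big /=; apply: eq_bigr => l _.
rewrite !mxE mulr_suml !mulr_sumr; apply: eq_bigr => k _; ring.
Qed.

Let intble_wV (w : X -> R) C K i j k l : measurable_fun setT w -> 0 <= C ->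
  (forall x, `|w x| <= C) -> intble mu (fun z =>
  (w z.2 * ((chi K z.2 * c z.2 i k) * (chi K z.2 * c z.2 j l))) * V z.2 k l).
Proof.
move=> mw C0 wC; apply: (@intble_mul_bounded _ _ _ _ (fun z => w z.2 *
  ((chi K z.2 * c z.2 i k) * (chi K z.2 * c z.2 j l))) _ (C * (K%:R * K%:R))) => //.
  exact: (measurableT_comp (@mwcc w K i j k l mw)).
by move=> z; exact: wcc_bound.
Qed.

Let intble_wr (w : X -> R) C K i j k l : measurable_fun setT w -> 0 <= C ->
  (forall x, `|w x| <= C) -> intble mu (fun z =>
  (w z.2 * ((chi K z.2 * c z.2 i k) * (chi K z.2 * c z.2 j l))) *
  (rh z k ord0 * rh z l ord0)).
Proof.
move=> mw C0 wC; apply: (@intble_mul_bounded _ _ _ _ (fun z => w z.2 *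
  ((chi K z.2 * c z.2 i k) * (chi K z.2 * c z.2 j l))) _ (C * (K%:R * K%:R))) => //.
  exact: (measurableT_comp (@mwcc w K i j k l mw)).
by move=> z; exact: wcc_bound.
Qed.

(** After truncation, both sides are finite sums of bounded functions of X times rh_k rh_l,
    respectively V_kl, so [Err] applies term by term. *)
Let weighted_moments (w : X -> R) C K i j : measurable_fun setT w -> 0 <= C ->
  (forall x, `|w x| <= C) ->
  [/\ intble mu (fun z => chi K z.2 * (w z.2 * (p z i ord0 * p z j ord0))),
      intble mu (fun z => chi K z.2 * (w z.2 * B z.2 i j)) &
      \int[mu]_z (chi K z.2 * (w z.2 * (p z i ord0 * p z j ord0))) =
      \int[mu]_z (chi K z.2 * (w z.2 * B z.2 i j))].
Proof.
move=> mw C0 wC; split.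
- under [fun z => _]funext do rewrite weighted_pp.
  by apply: intble_sum => k _; apply: intble_sum => l _; exact: (@intble_wr w C).
- under [fun z => _]funext do rewrite weighted_B.
  by apply: intble_sum => k _; apply: intble_sum => l _; exact: (@intble_wV w C).
- under eq_Rintegral do rewrite weighted_pp.
  under [RHS]eq_Rintegral do rewrite weighted_B.
  rewrite !Rint_sum => [||k _]; last 2 first.
  + by move=> k _; apply: intble_sum => l _; exact: (@intble_wV w C).
  + by apply: intble_sum => l _; exact: (@intble_wr w C).
  apply: eq_bigr => k _; rewrite !Rint_sum => [||l _]; last 2 first.
  + by move=> l _; exact: (@intble_wV w C).
  + exact: (@intble_wr w C).
  apply: eq_bigr => l _.
  apply: (@Err k l (fun x => w x * ((chi K x * c x i k) * (chi K x * c x j l)))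
    (C * (K%:R * K%:R))); first exact: mwcc.
  by move=> x; exact: wcc_bound.
Qed.

Let weighted_moments1 K i j :
  [/\ intble mu (fun z => chi K z.2 * (1 * (p z i ord0 * p z j ord0))),
      intble mu (fun z => chi K z.2 * (1 * B z.2 i j)) &
      \int[mu]_z (chi K z.2 * (1 * (p z i ord0 * p z j ord0))) =
      \int[mu]_z (chi K z.2 * (1 * B z.2 i j))].
Proof. by apply: (@weighted_moments (fun=> 1) 1) => // x; rewrite normr1. Qed.

Let chi_ge0 K x : 0 <= chi K x.
Proof. by have /andP[] := trunc01 t K x. Qed.

(** If the positive or the negative part had an infinite integral, so would be their difference, and
    [fine] would send it to 0, against [Bfin]. *)
Let intble_Bii i : intble mu (fun z => B z.2 i i).
Proof.
pose f (z : Y * X) := (B z.2 i i)%:E.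
have mf : measurable_fun setT f.
  by apply/measurable_EFinP; exact: (measurableT_comp (mB i i)).
have p0 : (0 <= \int[mu]_z f^\+ z)%E by apply: integral_ge0 => z _; exact: funepos_ge0.
have n0 : (0 <= \int[mu]_z f^\- z)%E by apply: integral_ge0 => z _; exact: funeneg_ge0.
have := Bfin i; rewrite (integralE _ _ f) => h.
apply/integrableP; split; first exact: mf.
have -> : (\int[mu]_z `|f z| = \int[mu]_z f^\+ z + \int[mu]_z f^\- z)%E.
  rewrite -ge0_integralD//.
  - by apply: eq_integral => z _; have /(congr1 (@^~ z)) := fune_abse f.
  - exact: measurable_funepos.
  - exact: measurable_funeneg.
move: h p0 n0; case: (\int[mu]_z f^\+ z)%E => [a| |]; case: (\int[mu]_z f^\- z)%E => [b| |] //=;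
  by rewrite ?ltxx// => *; exact: ltry.
Qed.

(** The truncated second moments equal truncated integrals of B_ii, which the integral of |B_ii|
    bounds uniformly in K. *)
Let intble_pp_self i : intble mu (fun z => p z i ord0 * p z i ord0).
Proof.
apply: (@intble_exhaust _ _ _ mu (fun z : Y * X => t z.2) mt2 _ (\int[mu]_z `|B z.2 i i|)).
  exact: measurable_funM.
move=> K; rewrite -[trunc _ K]/(fun z : Y * X => chi K z.2).
have [i1 i2 E] := weighted_moments1 K i i.
rewrite (_ : (\int[mu]_z _)%E =
    (\int[mu]_z (chi K z.2 * (1 * (p z i ord0 * p z i ord0)))%:E)%E); last first.
  by apply: eq_integral => z _; rewrite mul1r ger0_norm// -expr2 sqr_ge0.
rewrite EFin_Rintegral// E lee_fin; apply: Rint_le => //.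
  by apply: intble_norm; exact: intble_Bii.
move=> z; rewrite (le_trans (ler_norm _))// mul1r normrM ler_piMl//.
exact: trunc_norm.
Qed.

Let intble_p i : intble mu (fun z => p z i ord0).
Proof.
apply: (intble_le (g := fun z => 1 + p z i ord0 * p z i ord0)) => //.
  by apply: intbleD; [exact: intble_cst|exact: intble_pp_self].
move=> z; set a := p z i ord0.
rewrite -expr2 -real_normK ?num_real//.
have := sqr_ge0 (`|a| - 1); have := normr_ge0 a; nra.
Qed.

Lemma intble_residuals i j : intble mu (fun z =>
  (c z.2 *m rh z) i ord0 * (c z.2 *m rh z) j ord0).
Proof.
apply: (intble_le (g := fun z => p z i ord0 * p z i ord0 + p z j ord0 * p z j ord0)).
- exact: measurable_funM.
- by apply: intbleD; exact: intble_pp_self.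
- move=> z; rewrite -/(p z) normrM -!expr2 -(real_normK (num_real (p z i ord0))).
  rewrite -(real_normK (num_real (p z j ord0))).
  set a := `|p z i ord0|; set b := `|p z j ord0|.
  have := sqr_ge0 (a - b); have := mulr_ge0 (normr_ge0 (p z i ord0)) (normr_ge0 (p z j ord0)).
  rewrite -/a -/b; nra.
Qed.

(** Off the diagonal the comparison is reversed: the sign of B_ij is a bounded weight on X, and it
    turns the truncated integral of |B_ij| into one of p_i p_j, already integrable. *)
Let intble_B i j : intble mu (fun z => B z.2 i j).
Proof.
pose w x : R := if 0 <= B x i j then 1 else -1.
have mw : measurable_fun setT w.
  by apply: measurable_fun_ifT => //; exact: measurable_fun_ler.
have w1 x : `|w x| <= 1 by rewrite /w; case: ifP; rewrite ?normrN1 ?normr1.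
have wB x : w x * B x i j = `|B x i j|.
  rewrite /w; case: ifPn => h; first by rewrite mul1r ger0_norm.
  by rewrite mulN1r ltr0_norm// ltNge.
apply: (@intble_exhaust _ _ _ mu (fun z : Y * X => t z.2) mt2 _
  (\int[mu]_z `|p z i ord0 * p z j ord0|)).
  exact: (measurableT_comp (mB i j)).
move=> K; have [i1 i2 E] := @weighted_moments w 1 K i j mw ler01 w1.
rewrite (_ : (\int[mu]_z _)%E = (\int[mu]_z (chi K z.2 * (w z.2 * B z.2 i j))%:E)%E); last first.
  by apply: eq_integral => z _; rewrite wB.
rewrite EFin_Rintegral// -E lee_fin; apply: Rint_le => //.
  by apply: intble_norm; exact: intble_residuals.
move=> z; rewrite (le_trans (ler_norm _))// !normrM mulrA ler_piMl ?mulr_ge0//.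
by rewrite mulr_ile1// trunc_norm.
Qed.

Lemma Rint_residuals i j : \int[mu]_z ((c z.2 *m rh z) i ord0 * (c z.2 *m rh z) j ord0) =
  \int[mu]_z (c z.2 *m V z.2 *m (c z.2)^T) i j.
Proof.
apply/eqP; rewrite -subr_eq0 -RintB; [|exact: intble_residuals|exact: intble_B].
apply/eqP; apply: (@Rint_exhaust0 _ _ _ mu (fun z : Y * X => t z.2) mt2).
  by apply: intbleB; [exact: intble_residuals|exact: intble_B].
move=> K; have [i1 i2 E] := weighted_moments1 K i j.
rewrite (_ : \int[mu]_z _ = \int[mu]_z (chi K z.2 * (1 * (p z i ord0 * p z j ord0)) -
    chi K z.2 * (1 * B z.2 i j))); first by rewrite RintB// E subrr.
by apply: eq_Rintegral => z _; rewrite !mul1r -mulrBr.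
Qed.

Lemma Rint_residual i : \int[mu]_z (c z.2 *m rh z) i ord0 = 0.
Proof.
apply: (@Rint_exhaust0 _ _ _ mu (fun z : Y * X => t z.2) mt2); first exact: intble_p.
move=> K.
have mck k : measurable_fun setT (fun x => chi K x * c x i k) by exact: measurable_funM.
transitivity (\int[mu]_z \sum_k ((chi K z.2 * c z.2 i k) * rh z k ord0)).
  apply: eq_Rintegral => z _; rewrite mxE mulr_sumr.
  by apply: eq_bigr => k _; rewrite mulrA.
rewrite Rint_sum => [|k _].
  by rewrite big1// => k _; exact: (Erh k (mck k) (fun x => chic K x i k)).
apply: (@intble_mul_bounded _ _ _ _ (fun z => chi K z.2 * c z.2 i k) _ K%:R) => //.
exact: (measurableT_comp (mck k)).
Qed.

End WeightedResiduals.

Section AlmostEverywhere.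
Context {R : realType} d (T : measurableType d) (mu : probability T R).

Lemma intble_ae (f g : T -> R) : measurable_fun setT g ->
  {ae mu, forall x, f x = g x} -> intble mu f -> intble mu g.
Proof.
move=> mg fg hf; have mf := intble_measurable hf.
apply/integrableP; split; first exact/measurable_EFinP.
have /integrableP[_] := hf; congr (_ < _)%E; apply: ae_eq_integral => //.
- by apply/measurable_EFinP; exact: measurableT_comp.
- by apply/measurable_EFinP; exact: measurableT_comp.
- by apply: filterS fg => x /= -> _.
Qed.

Lemma integral_ae (f g : T -> R) (B : set T) : measurable B ->
  measurable_fun setT f -> measurable_fun setT g ->
  {ae mu, forall x, f x = g x} ->
  (\int[mu]_(x in B) (f x)%:E = \int[mu]_(x in B) (g x)%:E)%E.
Proof.
move=> mB mf mg fg; apply: ae_eq_integral => //.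
- by apply: measurable_funTS; exact/measurable_EFinP.
- by apply: measurable_funTS; exact/measurable_EFinP.
- by apply: filterS fg => x /= -> _.
Qed.

End AlmostEverywhere.

Lemma condexp_weight {R : realType} d1 d2 (Y : measurableType d1)
    (X : measurableType d2) (mu : probability (Y * X)%type R) (f : Y * X -> R)
    (g : X -> R) (w : X -> R) (C : R) :
  intble mu f -> intble mu (fun z => g z.2) ->
  (forall B : set X, measurable B ->
     (\int[mu]_(z in snd @^-1` B) (f z)%:E =
      \int[mu]_(z in snd @^-1` B) (g z.2)%:E)%E) ->
  measurable_fun setT w -> (forall x, `|w x| <= C) ->
  \int[mu]_z (w z.2 * f z) = \int[mu]_z (w z.2 * g z.2).
Proof.
move=> hf hg fg mw wC.
have mB (B : set X) : measurable B -> measurable ((snd : Y * X -> X) @^-1` B).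
  by move=> h; rewrite -[X in measurable X]setTI; exact: measurable_snd.
have D0 (B : set X) : measurable B ->
    (\int[mu]_(z in snd @^-1` B) (f z - g z.2)%:E = 0)%E.
  move=> h; under eq_integral do rewrite EFinB.
  have i1 : mu.-integrable (snd @^-1` B) (EFin \o f).
    by apply: integrableS hf => //; exact: mB.
  have i2 : mu.-integrable (snd @^-1` B) (fun z => (g z.2)%:E).
    by apply: integrableS hg => //; exact: mB.
  rewrite (integralB _ i1 i2)//; last exact: mB.
  rewrite fg// subee//; apply: integrable_fin_num => //; exact: mB.
have wi (h : Y * X -> R) : intble mu h -> intble mu (fun z => w z.2 * h z).
  move=> ih; apply: (@intble_mul_bounded _ _ _ _ (w \o snd) _ C) => // [|z].
    exact: measurableT_comp.
  exact: wC.
apply/eqP; rewrite -subr_eq0 -RintB; [|exact: wi|exact: wi].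
rewrite -(Rint_weight0 (intbleB hf hg) D0 mw wC); apply/eqP.
by apply: eq_Rintegral => z _; rewrite mulrBr.
Qed.

Lemma posdef_unit {R : realType} n (A : 'M[R]_n) : posdef A -> A \in unitmx.
Proof.
case=> _ A0; rewrite -unitmx_tr -row_free_unit -kermx_eq0; apply/rowV0P => v.
move=> /sub_kermxP vA.
apply/eqP; apply: contraT => v0.
have : 0 < qform v^T A v^T by apply: A0; rewrite trmx_eq0.
by rewrite /qform -mulmxA -[A *m v^T]trmxK trmx_mul trmxK vA trmx0 mulmx0 mxE ltxx.
Qed.

Lemma is_inv_sqrt_unit {R : realType} n (A S : 'M[R]_n) :
  is_inv_sqrt A S -> S *m A *m S = 1%:M.
Proof.
case=> uA _ SS; apply: mulmx1C; rewrite mulmxA SS; exact: mulVmx.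
Qed.

(** For u the i-th unit vector, u = S S A u, so A_ii = u.A u = |S A u|^2; if this were 0, so would
    be u. *)
Lemma is_inv_sqrt_diag {R : realType} n (A S : 'M[R]_n) i :
  is_inv_sqrt A S -> 0 < A i i.
Proof.
move=> AS; have SAS := is_inv_sqrt_unit AS; have ST := is_inv_sqrt_sym AS.
pose u : 'cV[R]_n := delta_mx i ord0.
have Au : A i i = dot u (A *m u).
  by rewrite -colE /dot (bigD1 i)//= big1 ?addr0 => [|j ji];
    rewrite !mxE ?eqxx ?mul1r// (negbTE ji) mul0r.
have uE : u = S *m (S *m (A *m u)).
  by case: AS => uA _ SS; rewrite !mulmxA SS mulVmx// mul1mx.
rewrite Au {1}uE dot_sym// -enorm_sqr exprn_gt0// lt_neqAle enorm_ge0 andbT eq_sym.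
apply/eqP => /enorm_eq0 h; have /matrixP/(_ i ord0) := uE.
by rewrite h mulmx0 !mxE !eqxx => /eqP; rewrite oner_eq0.
Qed.

Section ScoreMoments.
Context {R : realType} {H : completeNormedModType R}.
Context {dO : measure_display} {Om : measurableType dO}.
Variables (P : probability Om R) (S : psmd H Om).
Hypothesis hmodel : model P S.
Hypothesis hpath : pathwise_derivative S.
Hypothesis hOmis : forall n, is_inv_sqrt (Omega S n) (Omis S n).

Local Notation law := (law S).
Local Notation X := ((dx S).-tuple R).
Local Notation Sig := (@Sig _ _ _ _ S).
Local Notation Sig0 := (@Sig0 _ _ _ _ S).
Local Notation score := (@score _ _ _ _ S).
Local Notation rho0 z := (rho z (alpha0 S)).

(** The score is [coef] times the residual, and [coef] depends on X alone: this is the setting of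
    weighted residuals. *)
Let coef n (x : X) : 'M[R]_(dn S n, drho S) := (mdotv n x)^T *m invmx (Sig x).

Lemma Sig_sym x : (Sig x)^T = Sig x.
Proof. by have [_ [_ /(_ x)[]]] := hmodel. Qed.

Lemma Sig_unit x : Sig x \in unitmx.
Proof. by apply: posdef_unit; have [_ []] := hmodel. Qed.

Lemma alpha0_in : Aspace (alpha0 S).
Proof. by have [[_ _ _ [/interior_subset]]] := hmodel. Qed.

Let mcoef n i k : measurable_fun setT (fun x => coef n x i k).
Proof.
have [_ [mS _ _]] := hmodel; have [mm _ _ _] := hpath.
apply: measurable_mulmx => [k' l|].
  apply: measurable_trmx => a b; under [fun x => _]funext do rewrite mxE.
  exact: mm.
by apply: measurable_invmx => //; exact: Sig_unit.
Qed.

Let m0 : {ae law, forall z, mreg z.2 (alpha0 S) = 0}.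
Proof. by have [[_ _ _ []]] := hmodel. Qed.

Let rho_condexp k : is_condexp (S := S) (fun z => rho0 z k ord0)
  (fun x => mreg x (alpha0 S) k ord0).
Proof. by have [[_ _ h _] _] := hmodel; apply: h; exact: alpha0_in. Qed.

Let rr_condexp k l := (let: conj _ (And3 _ _ h) := hmodel in h) k l.

Let irho k : intble law (fun z => rho0 z k ord0).
Proof. by have [] := rho_condexp k. Qed.

Let mrho k : measurable_fun setT (fun z => rho0 z k ord0).
Proof. exact: intble_measurable (irho k). Qed.

Let rr_ae k l : {ae law, forall z,
  (rho0 z k ord0 - mreg z.2 (alpha0 S) k ord0) *
  (rho0 z l ord0 - mreg z.2 (alpha0 S) l ord0) = rho0 z k ord0 * rho0 z l ord0}.
Proof. by apply: filterS m0 => z ->; rewrite !mxE !subr0. Qed.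

Let irr k l : intble law (fun z => rho0 z k ord0 * rho0 z l ord0).
Proof.
have [_ h _ _] := rr_condexp k l.
by apply: intble_ae (rr_ae k l) h; exact: measurable_funM.
Qed.

Let iV k l : intble law (fun z => Sig0 z.2 k l).
Proof. by have [] := rr_condexp k l. Qed.

Let mV k l : measurable_fun setT (fun x => Sig0 x k l).
Proof. by have [] := rr_condexp k l. Qed.

Let mpre (B : set X) : measurable B -> measurable (snd @^-1` B : set (obs R (dy S) (dx S))).
Proof. by move=> mB; rewrite -[X in measurable X]setTI; exact: measurable_snd. Qed.

Let Erho k (w : X -> R) C : measurable_fun setT w ->
  (forall x, `|w x| <= C) -> \int[law]_z (w z.2 * rho0 z k ord0) = 0.
Proof.
move=> mw wC; apply: (Rint_weight0 (irho k) _ mw wC) => B mB.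
have [mm _ im E] := rho_condexp k; rewrite E//.
rewrite (integral_ae (g := fun=> 0)) ?integral0//; [exact: mpre|exact: (intble_measurable im)|].
by apply: filterS m0 => z ->; rewrite mxE.
Qed.

Let Err k l (w : X -> R) C : measurable_fun setT w ->
  (forall x, `|w x| <= C) ->
  \int[law]_z (w z.2 * (rho0 z k ord0 * rho0 z l ord0)) =
  \int[law]_z (w z.2 * Sig0 z.2 k l).
Proof.
move=> mw wC; refine (@condexp_weight _ _ _ _ _ law _ (fun x => Sig0 x k l) w C (irr k l)
  (iV k l) _ mw wC) => B mB.
have [_ h _ <-//] := rr_condexp k l.
apply: integral_ae; [exact: mpre|exact: intble_measurable (irr k l)|
  exact: intble_measurable h|].
by apply: filterS (rr_ae k l) => z.
Qed.

Let coefV n x : coef n x *m Sig0 x *m (coef n x)^T =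
  (mdotv n x)^T *m invmx (Sig x) *m Sig0 x *m invmx (Sig x) *m mdotv n x.
Proof.
by rewrite /coef trmx_mul trmxK trmx_inv Sig_sym !mulmxA.
Qed.

(** Invertibility of [Omega] makes its diagonal positive, and through [fine] this yields square
    integrability of the score. *)
Let Bfin n i :
  0 < fine (\int[law]_z ((coef n z.2 *m Sig0 z.2 *m (coef n z.2)^T) i i)%:E)%E.
Proof.
have := is_inv_sqrt_diag i (hOmis n); rewrite mxE /EZ.
by under eq_integral do rewrite -coefV.
Qed.

Lemma measurable_score n i : measurable_fun setT (fun z => score n z i ord0).
Proof.
have -> : (fun z => score n z i ord0) = (fun z => (coef n z.2 *m rho0 z) i ord0) by [].
apply: (measurable_mulmx (A := fun z => coef n z.2) (B := fun z => rho0 z)) => [k l|k l].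
  exact: (measurableT_comp (@mcoef n k l)).
by rewrite ord1; exact: mrho.
Qed.

Lemma intble_score2 n i j : intble law (fun z => score n z i ord0 * score n z j ord0).
Proof. exact: (@intble_residuals R _ _ _ _ law _ _ (fun z => rho0 z) (coef n) Sig0 (@mcoef n) mV irho irr iV
  Err (@Bfin n) i j). Qed.

Lemma Rint_score2 n i j :
  \int[law]_z (score n z i ord0 * score n z j ord0) = Omega S n i j.
Proof.
have := @Rint_residuals R _ _ _ _ law _ _ (fun z => rho0 z) (coef n) Sig0 (@mcoef n) mV irho irr iV
  Err (@Bfin n) i j; move=> ->; rewrite mxE /EZ.
by rewrite /Rintegral; congr fine; apply: eq_integral => z _; rewrite coefV.
Qed.

Lemma Rint_score n i : \int[law]_z score n z i ord0 = 0.
Proof. exact: (@Rint_residual R _ _ _ _ law _ _ (fun z => rho0 z) (coef n) Sig0 (@mcoef n) mV irho irr iV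
  Erho Err (@Bfin n) i). Qed.

End ScoreMoments.

Lemma enorm_dim0 {R : realType} n (u : 'cV[R]_n) : n = 0%N -> enorm u = 0.
Proof. by move=> n0; move: u; rewrite n0 => u; rewrite /enorm big_ord0 sqrtr0. Qed.

Lemma markov_oprob {R : realType} dO (Om : measurableType dO) (P : probability Om R)
    (f : Om -> R) (a b : R) : measurable_fun setT f -> (forall w, 0 <= f w) ->
  (\int[P]_w (f w)%:E)%E = b%:E -> 0 < a ->
  ((P^* [set w | a < f w]%R)%mu <= (b / a)%:E)%E.
Proof.
move=> mf f0 fb a0.
have hf : intble P f.
  apply/integrableP; split; first exact/measurable_EFinP.
  rewrite (eq_integral (fun w => (f w)%:E)) ?fb ?ltry// => w _ /=.
  by rewrite ger0_norm.
have mA : measurable [set w | a < f w].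
  by rewrite -[X in measurable X]setTI; apply: measurable_fun_ltr.
rewrite oprobE// -(@fineK _ (P _)) ?fin_num_measure// lee_fin ler_pdivlMr//.
rewrite -(Rint_indic P mA) -[leRHS]/(fine b%:E) -fb -RintZr; last exact: intble_indic.
apply: Rint_le => //; first by apply: intbleZr; exact: intble_indic.
move=> w; rewrite indicE; case: (boolP (w \in _)) => [|_]; last by rewrite mul0r.
by rewrite inE /= => /ltW; rewrite mul1r.
Qed.

Section StandardizedScore.
Context {R : realType} {H : completeNormedModType R}.
Context {dO : measure_display} {Om : measurableType dO}.
Variables (P : probability Om R) (S : psmd H Om).
Hypothesis hmodel : model P S.
Hypothesis hpath : pathwise_derivative S.
Hypothesis hOmis : forall n, is_inv_sqrt (Omega S n) (Omis S n).

Local Notation law := (law S).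
Local Notation score := (@score _ _ _ _ S).

Definition std_score n (z : obs R (dy S) (dx S)) : 'cV[R]_(dn S n) :=
  Omis S n *m score n z.

Lemma measurable_std_score n i : measurable_fun setT (fun z => std_score n z i ord0).
Proof.
under [fun z => _]funext do rewrite mxE.
by apply: measurable_sum => k; apply: measurable_funM => //; exact: (measurable_score hmodel).
Qed.

Let is2 n i j := intble_score2 hmodel hpath hOmis (n := n) i j.

Let std_scoreM n i j z : std_score n z i ord0 * std_score n z j ord0 =
  \sum_k \sum_l (Omis S n i k * Omis S n j l) *
    (score n z k ord0 * score n z l ord0).
Proof.
rewrite !mxE mulr_suml; apply: eq_bigr => k _; rewrite mulr_sumr.
by apply: eq_bigr => l _; ring.
Qed.

Lemma intble_std_score2 n i j :
  intble law (fun z => std_score n z i ord0 * std_score n z j ord0).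
Proof.
under [fun z => _]funext do rewrite std_scoreM.
by apply: intble_sum => k _; apply: intble_sum => l _; apply: intbleZl; exact: is2.
Qed.

Lemma Rint_std_score2 n i j :
  \int[law]_z (std_score n z i ord0 * std_score n z j ord0) = (i == j)%:R.
Proof.
under eq_Rintegral do rewrite std_scoreM.
rewrite Rint_sum => [|k _]; last by apply: intble_sum => l _; apply: intbleZl; exact: is2.
transitivity ((Omis S n *m Omega S n *m Omis S n) i j); last first.
  by rewrite (is_inv_sqrt_unit (hOmis n)) mxE.
rewrite mxE; under [RHS]eq_bigr do rewrite mxE mulr_suml.
rewrite exchange_big /=; apply: eq_bigr => k _.
rewrite Rint_sum => [|l _]; last by apply: intbleZl; exact: is2.
apply: eq_bigr => l _; rewrite RintZl; last exact: is2.
rewrite (Rint_score2 hmodel hpath hOmis).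
have -> : Omis S n j l = Omis S n l j by rewrite -[in LHS](is_inv_sqrt_sym (hOmis n)) mxE.
by ring.
Qed.

Lemma Rint_std_score n i : \int[law]_z std_score n z i ord0 = 0.
Proof.
under eq_Rintegral do rewrite mxE.
have is1 k : intble law (fun z => score n z k ord0).
  apply: (intble_le (g := fun z => 1 + score n z k ord0 * score n z k ord0)).
  - exact: (measurable_score hmodel).
  - by apply: intbleD; [exact: intble_cst|exact: is2].
  - move=> z; set a := score n z k ord0.
    rewrite -expr2 -real_normK ?num_real//.
    have := sqr_ge0 (`|a| - 1); have := normr_ge0 a; nra.
rewrite Rint_sum => [|k _]; last exact: intbleZl.
rewrite big1// => k _; rewrite RintZl//.
by rewrite (Rint_score hmodel hpath hOmis) mulr0.
Qed.

Let mZ i : measurable_fun setT (Zs S i).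
Proof. by have [[/(_ i)[]]] := hmodel. Qed.
Let lawZ i B : measurable B -> P (Zs S i @^-1` B) = law B.
Proof. by have [[/(_ i)[_ h] _ _ _] _] := hmodel; exact: h. Qed.
Let indep := (let: conj (And4 _ h _ _) _ := hmodel in h).

Definition std_sum n (w : Om) : 'cV[R]_(dn S n) :=
  Num.sqrt n%:R *: (Omis S n *m Zn S n w).

Lemma std_sumE n w : std_sum n w =
  tuple_sum (std_score n) (Num.sqrt n%:R)^-1 (first_obs (Zs S) n w).
Proof.
rewrite /std_sum /Zn tuple_sum_first_obs -scalemxAr scalerA mulmx_sumr scaler_sumr.
have [->|n0] := eqVneq n 0%N; first by rewrite !big_ord0.
apply: eq_bigr => i _; rewrite /sample tnth_mktuple; congr (_ *: _).
have s0 : Num.sqrt n%:R != 0 :> R by rewrite gt_eqF// sqrtr_gt0 ltr0n lt0n.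
rewrite -{2}(sqr_sqrtr (ler0n R n)) expr2 invfM mulrA divff// mul1r//.
Qed.

Lemma std_sum_sqr n w : n%:R * qform (Zn S n w) (invmx (Omega S n)) (Zn S n w) =
  enorm (std_sum n w) ^+ 2.
Proof.
rewrite (qform_inv_sqrt _ (hOmis n)) /std_sum enormZ exprMn ger0_norm ?sqrtr_ge0//.
by congr (_ * _); rewrite sqr_sqrtr.
Qed.

Lemma measurable_std_sum n i : measurable_fun setT (fun w => std_sum n w i ord0).
Proof.
under [fun w => _]funext do rewrite std_sumE.
by apply: (measurable_sum_first_obs mZ) => j; exact: measurable_std_score.
Qed.

Lemma std_sum_tight (e : R) : 0 < e -> exists C : R, 0 < C /\ forall n,
  ((P^* [set w | C * Num.sqrt (dn S n)%:R < enorm (std_sum n w)]%R)%mu <= e%:E)%E.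
Proof.
(* The squared length has mean d, so by Markov's inequality it exceeds C^2 d with probability at
   most C^(-2) = e. The cases d = 0 and n = 0, where the sum is 0, are separate. *)
move=> e0; pose C := Num.sqrt e^-1; have C0 : 0 < C by rewrite sqrtr_gt0 invr_gt0.
exists C; split=> // n.
have [d0|d0] := eqVneq (dn S n) 0%N.
  rewrite (_ : [set _ | _] = set0) ?oprobE// ?measure0 ?lee_fin ?ltW//.
  apply/seteqP; split=> w //=.
  by rewrite (enorm_dim0 _ d0) ltNge mulr_ge0 ?sqrtr_ge0// ltW.
have [n0|n0] := eqVneq n 0%N.
  rewrite (_ : [set _ | _] = set0) ?oprobE// ?measure0 ?lee_fin ?ltW//.
  apply/seteqP; split=> w //=.
  have s0 : Num.sqrt n%:R = 0 :> R by rewrite n0 sqrtr0.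
  by rewrite /std_sum s0 scale0r enorm0 ltNge mulr_ge0 ?sqrtr_ge0// ltW.
have dR0 : 0 < (dn S n)%:R :> R by rewrite ltr0n lt0n.
have nR0 : 0 < n%:R :> R by rewrite ltr0n lt0n.
have C2 : C ^+ 2 = e^-1 by rewrite sqr_sqrtr// invr_ge0 ltW.
have E := second_moment_sum mZ lawZ indep (@measurable_std_score n)
  (@intble_std_score2 n) (@Rint_std_score n) (@Rint_std_score2 n) (Num.sqrt n%:R)^-1 n.
have := @markov_oprob _ _ _ P (fun w => dot (std_sum n w) (std_sum n w))
  (C ^+ 2 * (dn S n)%:R) (dn S n)%:R.
move=> /(_ (measurable_dot_self (@measurable_std_sum n)) (fun=> dot_ge0 _)).
rewrite C2 (_ : _ / _ = e); last by field; rewrite !gt_eqF.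
move=> h; apply: le_trans (h _ _).
- apply: oprob_le => w /= hw; rewrite -enorm_sqr -C2 -(sqr_sqrtr (ltW dR0)) -exprMn.
  by rewrite ltr_pXn2r// ?nnegrE ?enorm_ge0// mulr_ge0// ltW.
- under eq_integral do rewrite std_sumE.
  by rewrite E exprVn sqr_sqrtr// mulrA divff ?mul1r// gt_eqF.
- by rewrite mulr_gt0// invr_gt0.
Qed.

Lemma std_sum_normal_limit : dn S n @[n --> \oo] --> \oo ->
  ((dn S n)%:R%:E * mu3 S n * ((Num.sqrt n%:R)^-1)%:E)%E @[n --> \oo] --> 0%E ->
  cvg_in_law P (fun n w => (enorm (std_sum n w) ^+ 2 - (dn S n)%:R) /
                           Num.sqrt (2 * (dn S n)%:R)) (@normal_law R).
Proof.
move=> d_oo m3.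
have := chi2_normal_limit mZ lawZ indep measurable_std_score intble_std_score2
  Rint_std_score Rint_std_score2 d_oo m3.
rewrite (_ : (fun n w => _) = (fun n w => (enorm (std_sum n w) ^+ 2 - (dn S n)%:R) /
                           Num.sqrt (2 * (dn S n)%:R)))//.
by apply/funext => n; apply/funext => w; rewrite enorm_sqr std_sumE.
Qed.

End StandardizedScore.

(** * Localization of the estimator *)

Lemma qform_ge0 {R : realType} n (A : 'M[R]_n) (u : 'cV[R]_n) : posdef A -> 0 <= qform u A u.
Proof.
case=> _ A0; have [->|u0] := eqVneq u 0; last by rewrite ltW// A0.
by rewrite qformE mulmx0 /dot big1// => i _; rewrite mxE mul0r.
Qed.

Lemma posdef_inv {R : realType} n (A : 'M[R]_n) : posdef A -> posdef (invmx A).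
Proof.
move=> pA; have uA := posdef_unit pA; have [AT A0] := pA.
have WT : (invmx A)^T = invmx A by rewrite trmx_inv AT.
split=> // u u0; have -> : qform u (invmx A) u = qform (invmx A *m u) A (invmx A *m u).
  by rewrite !qformE mulKVmx// dotC.
apply: A0; apply: contra_neq u0 => h.
by rewrite -(mulKVmx uA u) h mulmx0.
Qed.

Lemma qform_sym {R : realType} n (A : 'M[R]_n) (u v : 'cV[R]_n) : A^T = A ->
  qform u A v = qform v A u.
Proof. by move=> AT; rewrite !qformE -dot_sym// dotC. Qed.

Lemma qformDl {R : realType} n (A : 'M[R]_n) (c : R) (u v w : 'cV[R]_n) :
  qform (c *: u + v) A w = c * qform u A w + qform v A w.
Proof. by rewrite !qformE dotDl dotZl. Qed.

Lemma nonneg_quadratic {R : realType} (a b c : R) : 0 <= c ->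
  (forall t, 0 <= a + 2 * t * b + t ^+ 2 * c) -> b ^+ 2 <= a * c.
Proof.
move=> c0' h; have a0 : 0 <= a by have := h 0; rewrite mulr0 mul0r expr0n mul0r !addr0.
have [c0|c0] := eqVneq c 0.
  have [b0|b0] := eqVneq b 0; first by rewrite b0 c0 expr0n mulr0.
  (* For c = 0 the polynomial is affine in t, and takes the value -1 here. *)
  have := h (- (a + 1) / (2 * b)); rewrite c0 mulr0 addr0.
  rewrite (_ : a + _ = -1); last by field.
  by rewrite ler0N1.
have cp : 0 < c by rewrite lt_neqAle eq_sym c0.
have := h (- b / c).
rewrite (_ : a + _ + _ = a - b ^+ 2 / c); last by field.
by rewrite subr_ge0 ler_pdivrMr.
Qed.

Section InnerProduct.
Context {R : realType} {H : completeNormedModType R}.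
Context {dO : measure_display} {Om : measurableType dO}.
Variables (P : probability Om R) (S : psmd H Om).
Hypothesis hmodel : model P S.
Hypothesis hpath : pathwise_derivative S.

Local Notation law := (law S).
Local Notation mdot := (@mdot _ _ _ _ S).
Local Notation Sig := (@Sig _ _ _ _ S).
Local Notation E := ('cV[R]_(dth S) * H)%type.
Implicit Types u v w : E.

Definition wprod (x : (dx S).-tuple R) u v : R :=
  qform (mdot x u) (invmx (Sig x)) (mdot x v).

Let pW x : posdef (invmx (Sig x)).
Proof. by apply: posdef_inv; have [_ []] := hmodel. Qed.

Let measurable_wprod u v : measurable_fun setT (fun z : obs R (dy S) (dx S) => wprod z.2 u v).
Proof.
have [_ [mS _ _]] := hmodel; have [mm _ _ _] := hpath.
apply: (measurableT_comp (f := fun x => wprod x u v)) => //.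
apply: measurable_mulmx => [i j|k j]; last by rewrite ord1; exact: mm.
apply: measurable_mulmx => [a b|].
  by apply: (measurable_trmx (A := fun x => mdot x u)) => k l; rewrite ord1; exact: mm.
by apply: measurable_invmx => [x|//]; exact: (Sig_unit hmodel).
Qed.

Lemma wprod_ge0 x u : 0 <= wprod x u u.
Proof. exact: qform_ge0. Qed.

(** Nonnegativity of the form at u + v and v - u gives 2 |wprod u v| <= wprod u u + wprod v v. *)
Lemma intble_wprod u v : intble law (fun z => wprod z.2 u v).
Proof.
have [_ _ _ ii] := hpath.
apply: (intble_le (g := fun z => wprod z.2 u u + wprod z.2 v v)) => //.
  by apply: intbleD; exact: ii.
move=> z; have [WT _] := pW z.2.
have := qform_ge0 (1 *: mdot z.2 u + mdot z.2 v) (pW z.2).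
have := qform_ge0 (-1 *: mdot z.2 u + mdot z.2 v) (pW z.2).
rewrite !qformDl !(qform_sym _ (_ + _) WT) !qformDl (qform_sym (mdot z.2 v) (mdot z.2 u) WT).
rewrite -/(wprod _ _ _) -/(wprod z.2 u v) -/(wprod z.2 v v) ler_norml.
have := wprod_ge0 z.2 u; have := wprod_ge0 z.2 v.
by move=> *; apply/andP; split; lra.
Qed.

Lemma innerE u v : inner u v = \int[law]_z wprod z.2 u v. Proof. by []. Qed.

Lemma innerC u v : inner u v = inner v u.
Proof. by rewrite !innerE; apply: eq_Rintegral => z _; apply: qform_sym; have [] := pW z.2. Qed.

Lemma inner_linear (c : R) u v w :
  inner (c *: u + v) w = c * inner u w + inner v w.
Proof.
have [_ _ lin _] := hpath.
transitivity (\int[law]_z (c * wprod z.2 u w + wprod z.2 v w)).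
  rewrite innerE /Rintegral; congr fine; apply: integral_ae => //.
  - by apply: measurable_funD => //; exact: measurable_funM.
  - by apply: filterS (lin c u v) => z h; rewrite /wprod h qformDl.
rewrite RintD ?RintZl//; try exact: intble_wprod.
by apply: intbleZl; exact: intble_wprod.
Qed.

Lemma innerDl u v w : inner (u + v) w = inner u w + inner v w.
Proof. by rewrite -{1}[u]scale1r inner_linear mul1r. Qed.

Lemma inner0l w : inner 0 w = 0.
Proof. by apply: (addrI (inner 0 w)); rewrite -innerDl !addr0. Qed.

Lemma innerZl (c : R) u w : inner (c *: u) w = c * inner u w.
Proof. by rewrite -[c *: u]addr0 inner_linear inner0l addr0. Qed.

Lemma innerDr u v w : inner w (u + v) = inner w u + inner w v.
Proof. by rewrite !(innerC w) innerDl. Qed.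

Lemma innerZr (c : R) u w : inner w (c *: u) = c * inner w u.
Proof. by rewrite !(innerC w) innerZl. Qed.

Lemma inner_ge0 u : 0 <= inner u u.
Proof. by rewrite innerE; apply: Rintegral_ge0 => z _; exact: wprod_ge0. Qed.

Lemma nrm_ge0 u : 0 <= nrm u. Proof. exact: sqrtr_ge0. Qed.

Lemma nrm_sqr u : nrm u ^+ 2 = inner u u.
Proof. by rewrite sqr_sqrtr// inner_ge0. Qed.

Lemma nrm_eq0 u : nrm u = 0 -> inner u u = 0.
Proof. by move=> h; rewrite -nrm_sqr h expr0n. Qed.

Lemma nrmZ (c : R) u : nrm (c *: u) = `|c| * nrm u.
Proof.
by rewrite /nrm innerZl innerZr mulrA -expr2 sqrtrM ?sqr_ge0// sqrtr_sqr.
Qed.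

Lemma nrmN u : nrm (- u) = nrm u.
Proof. by rewrite -scaleN1r nrmZ normrN1 mul1r. Qed.

Lemma nrmB u v : nrm (u - v) = nrm (v - u).
Proof. by rewrite -opprB nrmN. Qed.

Lemma inner_le_nrm u v : `|inner u v| <= nrm u * nrm v.
Proof.
rewrite -(@ler_pXn2r _ 2)// ?nnegrE ?mulr_ge0 ?nrm_ge0//.
rewrite real_normK ?num_real// exprMn !nrm_sqr; apply: nonneg_quadratic => [|t]; first exact: inner_ge0.
have := inner_ge0 (u + t *: v).
by rewrite innerDl !innerDr !innerZl !innerZr (innerC v u); congr (_ <= _); ring.
Qed.

Lemma nrmD u v : nrm (u + v) <= nrm u + nrm v.
Proof.
rewrite -(@ler_pXn2r _ 2)// ?nnegrE ?addr_ge0 ?nrm_ge0//.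
rewrite nrm_sqr innerDl !innerDr (innerC v u) -!nrm_sqr.
have := le_trans (ler_norm _) (inner_le_nrm u v); nra.
Qed.

End InnerProduct.

Lemma running_min {R : realType} (b : nat -> R) : exists s : nat -> R,
  (forall n j, (j <= n)%N -> s n <= b j) /\
  (forall n, exists2 j, (j <= n)%N & s n = b j).
Proof.
pose fix s n := if n is m.+1 then Num.min (s m) (b m.+1) else b 0%N.
exists s; split.
- elim=> [|n IH] j /=; first by rewrite leqn0 => /eqP->.
  rewrite leq_eqVlt => /predU1P[->|jn]; first by rewrite ge_min lexx orbT.
  by rewrite ge_min IH.
- elim=> [|n [j jn sj]] /=; first by exists 0%N.
  rewrite /Num.min; case: ifP => _; last by exists n.+1.
  by exists j => //; exact: leqW.
Qed.

(* If [n dl_n^2] were not bounded below, [e_n = 2 min_(j <= n) (j + 1) dl_j^2 / (n + 1)]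
   would be o(1/n) and exceed [dl_n^2] at each new minimum. *)
Lemma rate_lower_bound {R : realType} (dl : nat -> R) : (forall n, 0 < dl n) ->
  (forall e : nat -> R, n%:R * e n @[n --> \oo] --> 0 ->
     \forall n \near \oo, e n <= dl n ^+ 2) ->
  exists2 kap : R, 0 < kap & \forall n \near \oo, kap <= n%:R * dl n ^+ 2.
Proof.
move=> dl0 h.
pose b n := n.+1%:R * dl n ^+ 2.
have b0 n : 0 < b n by rewrite mulr_gt0 ?ltr0n// exprn_gt0.
have [s [s_le s_eq]] := running_min b.
have s0 n : 0 < s n by have [j _ ->] := s_eq n.
have [[kap kap0 kb]|nkap] := pselect (exists2 kap : R, 0 < kap & forall n, kap <= b n).
  exists (kap / 2); first by rewrite divr_gt0.
  exists 1%N => // n /= n1; have := kb n; rewrite /b -natr1 => hn.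
  have : 1 * dl n ^+ 2 <= n%:R * dl n ^+ 2 by rewrite ler_wpM2r ?sqr_ge0// ler1n.
  move: hn; rewrite mulrDl mul1r; set x := n%:R * _; set y := dl n ^+ 2; lra.
have small (e : R) : 0 < e -> exists n, b n < e.
  move=> e0; apply: contrapT => hn; apply: nkap; exists e => // n.
  by rewrite leNgt; apply/negP => bn; apply: hn; exists n.
have s_small (e : R) : 0 < e -> \forall n \near \oo, s n < e.
  move=> e0; have [N bN] := small e e0.
  by exists N => // n /= Nn; rewrite (le_lt_trans _ bN)// s_le.
pose e n : R := 2 * s n / n.+1%:R.
have ne : n%:R * e n @[n --> \oo] --> 0.
  apply/cvgrPdist_le => eps eps0.
  apply: filterS (s_small _ (divr_gt0 eps0 (ltr0n R 2))) => n sn.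
  have n1 : 0 < n.+1%:R :> R by rewrite ltr0n.
  rewrite sub0r normrN ger0_norm; last by rewrite /e mulr_ge0// divr_ge0// mulr_ge0// ltW.
  rewrite /e mulrA ler_pdivrMr//.
  have : n%:R * (2 * s n) <= n.+1%:R * (2 * s n).
    by rewrite ler_wpM2r ?ler_nat// mulr_ge0// ltW.
  have : n.+1%:R * (2 * s n) <= n.+1%:R * eps by rewrite ler_wpM2l//; lra.
  by rewrite (mulrC eps); lra.
have [N _ hN] := h e ne.
have [n0 n0P] := small _ (s0 N).
have ex : exists n, b n < s N by exists n0.
(* The first index at which b falls below s N lies beyond N and is a record, so s n = b n and e n =
   2 dl n ^ 2. *)
case: (ex_minnP ex) => n bn nmin.
have Nn : (N < n)%N.
  by rewrite ltnNge; apply/negP => nN; move: bn; rewrite ltNge s_le.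
have sn : s n = b n.
  have [j jn sj] := s_eq n; move: jn; rewrite leq_eqVlt => /predU1P[jE|jn].
    by rewrite sj jE.
  have sNj : s N <= b j by rewrite leNgt; apply/negP => /nmin; rewrite leqNgt jn.
  have := s_le n n (leqnn n); rewrite sj => bjn.
  by move: (le_trans sNj bjn); rewrite leNgt bn.
have := hN n (ltnW Nn); rewrite /e sn /b.
rewrite (_ : _ / _ = 2 * dl n ^+ 2); last by field; rewrite -?natr1 gt_eqF// ltr_wpDl.
have := exprn_gt0 2 (dl0 n); lra.
Qed.

Section StrongNorm.
Context {R : realType} {H : completeNormedModType R}.
Context {dO : measure_display} {Om : measurableType dO}.
Variable S : psmd H Om.
Local Notation E := ('cV[R]_(dth S) * H)%type.
Implicit Types a b : E.

Lemma snorm_ge0 a : 0 <= snorm a.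
Proof. by rewrite addr_ge0 ?enorm_ge0. Qed.

Lemma snormD a b : snorm (a + b) <= snorm a + snorm b.
Proof.
rewrite /snorm addrACA lerD//; [exact: enormD|exact: ler_normD].
Qed.

Lemma snormN a : snorm (- a) = snorm a.
Proof. by rewrite /snorm /= enormN normrN. Qed.

Lemma snormB a b : snorm (a - b) = snorm (b - a).
Proof. by rewrite -opprB snormN. Qed.

Lemma snorm_eq0 a : snorm a = 0 -> a = 0.
Proof.
case: a => x h; rewrite /snorm /= => e0.
have [x0 h0] : enorm x = 0 /\ `|h| = 0.
  have := enorm_ge0 x; have := normr_ge0 h; move: e0.
  by set u := enorm x; set v := `|h|; move=> *; split; lra.
by rewrite (enorm_eq0 x0) (normr0_eq0 h0).
Qed.

Lemma nbhs_snorm a (r : R) : 0 < r -> nbhs a [set b | snorm (b - a) < r].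
Proof.
(* Neighbourhoods are products of entrywise balls: the parameter contributes at most dth s, the
   function s, and (dth + 1) s = r / 2. *)
move=> r0; pose s := r / (2 * (dth S).+1%:R).
have d0 : 0 < 2 * (dth S).+1%:R :> R by rewrite mulr_gt0// ltr0n.
have s0 : 0 < s by rewrite divr_gt0.
exists (ball a.1 s, ball a.2 s) => /=; first by split; exact: nbhsx_ballx.
case=> x h /= [bx bh]; rewrite /snorm /=.
have hs : `|h - a.2| < s by rewrite distrC; move: bh; rewrite -ball_normE.
have xs i : `|(x - a.1) i ord0| < s.
  by rewrite !mxE distrC; case: bx => _ /(_ i ord0); rewrite -ball_normE /ball_ /=.
have ex : enorm (x - a.1) <= (dth S)%:R * s.
  rewrite (le_trans (enorm_le_sum _))//.
  rewrite (le_trans (ler_sum _ (fun i _ => ltW (xs i))))//.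
  by rewrite sumr_const card_ord mulr_natl.
have -> : r = (dth S).+1%:R * s + (dth S).+1%:R * s.
  rewrite -mulrDl (_ : _ + _ = 2 * (dth S).+1%:R); last by ring.
  by rewrite /s mulrC divfK// gt_eqF.
have n0 : 0 <= (dth S)%:R * s by rewrite mulr_ge0// ltW.
rewrite -natr1 mulrDl mul1r; lra.
Qed.

End StrongNorm.

Section Identification.
Context {R : realType} {H : completeNormedModType R}.
Context {dO : measure_display} {Om : measurableType dO}.
Variables (P : probability Om R) (S : psmd H Om).
Hypothesis hmodel : model P S.
Hypothesis hID : ID S.
Hypothesis hPEN : PEN S.

Local Notation law := (law S).
Local Notation Sig := (@Sig _ _ _ _ S).
Local Notation Pen := (@Pen _ _ _ _ S).
Local Notation E := ('cV[R]_(dth S) * H)%type.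
Implicit Types a b : E.

Let pW x : posdef (invmx (Sig x)).
Proof. by apply: posdef_inv; have [_ []] := hmodel. Qed.

Let measurable_mreg a : Aspace a -> forall i,
  measurable_fun setT (fun x => @mreg _ _ _ _ S x a i ord0).
Proof. by move=> ha i; have [[_ _ /(_ a ha i)[]]] := hmodel. Qed.

Let qm a (z : obs R (dy S) (dx S)) : R :=
  qform (mreg z.2 a) (invmx (Sig z.2)) (mreg z.2 a).

Let measurable_qm a : Aspace a -> measurable_fun setT (qm a).
Proof.
move=> ha; have [_ [mS _ _]] := hmodel; have mm := measurable_mreg ha.
apply: (measurableT_comp (f := fun x => qform (@mreg _ _ _ _ S x a) (invmx (Sig x)) (mreg x a))) => //.
apply: measurable_mulmx => [i j|k j]; last by rewrite ord1; exact: mm.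
apply: measurable_mulmx => [k l|].
  by apply: (measurable_trmx (A := fun x => @mreg _ _ _ _ S x a)) => i' j'; rewrite ord1; exact: mm.
by apply: measurable_invmx => [x|//]; exact: (Sig_unit hmodel).
Qed.

Lemma Q_eq0 a : Aspace a -> (Q a <= 0)%E -> snorm (a - alpha0 S) = 0.
Proof.
move=> ha Q0; have [h _ _ _] := hID; apply/(h a ha).
have : (\int[law]_z `|(qm a z)%:E| = 0)%E.
  apply/eqP; rewrite eq_le; apply/andP; split; last exact: integral_ge0.
  apply: le_trans Q0; rewrite le_eqVlt; apply/orP; left; apply/eqP.
  by apply: eq_integral => z _; rewrite gee0_abs// lee_fin; exact: qform_ge0.
move=> /(ae_eq_integral_abs _ measurableT) h0.
have {}h0 : ae_eq law setT (EFin \o qm a) (cst 0%E).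
  by apply: h0; apply/measurable_EFinP; exact: measurable_qm.
apply: filterS h0 => z /(_ Logic.I) /= [q0].
apply/eqP; apply: contraT => m0; have [_ /(_ _ m0)] := pW z.2.
by rewrite -/(qm a z) q0 ltxx.
Qed.

(** Otherwise some points with Q tending to 0 stay e away from [alpha0]. By compactness they cluster
    at some p, where identification gives Q p > 0, and lower semicontinuity keeps Q away from 0 near
    p. *)
Lemma Q_separates (M e : R) : 0 < e -> exists2 y : R, 0 < y &
  forall a, Aspace a -> (Pen a.2 <= M%:E)%E -> (Q a <= y%:E)%E ->
    snorm (a - alpha0 S) < e.
Proof.
move=> e0; apply: contrapT => hn.
have /choice[f fP] : forall m : nat, exists a, [/\ Aspace a, (Pen a.2 <= M%:E)%E,
    (Q a <= (m.+1%:R^-1)%:E)%E & e <= snorm (a - alpha0 S)].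
  move=> m; apply: contrapT => hm; apply: hn; exists (m.+1%:R^-1).
    by rewrite invr_gt0 ltr0n.
  move=> a a1 a2 a3; rewrite ltNge; apply/negP => a4; apply: hm.
  by exists a; split.
have [_ [cTheta _ _ _ _] lsc _] := hID; have [_ _ cPen] := hPEN.
have := compact_setX cTheta (cPen M).
have fK : (f @ \oo) (@Theta _ _ _ _ S `*` [set h | (Pen h <= M%:E)%E]).
  by exists 0%N => // m _; have [] := fP m.
move=> /(_ (f @ \oo) _ fK)[p [[pT pM] cl]].
(* A cluster point closer than e to [alpha0] would have terms of the sequence nearby that are also
   closer than e. *)
have [pe|pe] := ltP (snorm (p - alpha0 S)) e.
  have B : nbhs p [set b | snorm (b - p) < e - snorm (p - alpha0 S)].
    by apply: nbhs_snorm; rewrite subr_gt0.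
  have fR : (f @ \oo) (range f) by exists 0%N => // m _; exists m.
  have [_ [[m _ <-] /=]] := cl (range f) _ fR B.
  have [_ _ _ fe] := fP m; rewrite ltNge => /negP; apply.
  rewrite lerBlDr (le_trans fe)//.
  by rewrite (_ : f m - alpha0 S = (f m - p) + (p - alpha0 S)) ?snormD// addrA subrK.
have Qp : (0 < Q p)%E.
  rewrite ltNge; apply/negP => /(Q_eq0 pT) h; move: pe; rewrite h.
  by rewrite leNgt e0.
have [y y0 yQ] : exists2 y : R, 0 < y & (y%:E < Q p)%E.
  case: (Q p) Qp => [q| |] //; last by move=> _; exists 1 => //; exact: ltry.
  rewrite lte_fin => q0; exists (q / 2); first by rewrite divr_gt0.
  rewrite lte_fin; lra.
have [r r0 rP] := lsc p y pT yQ.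
have [N _ NP] : \forall m \near \oo, (m.+1%:R^-1 : R) < y.
  by apply: near_infty_natSinv_lt (PosNum y0).
have FA : (f @ \oo) [set a | exists2 m, (N <= m)%N & a = f m].
  by exists N => // m Nm; exists m.
have [_ [[m Nm ->] /= fr]] := cl _ _ FA (nbhs_snorm p r0).
have [fA _ fQ _] := fP m.
have := lt_le_trans (rP _ fA fr) fQ; rewrite lte_fin => h.
by have := lt_trans h (NP m Nm); rewrite ltxx.
Qed.

End Identification.

Section Localization.
Context {R : realType} {H : completeNormedModType R}.
Context {dO : measure_display} {Om : measurableType dO}.
Variables (P : probability Om R) (S : psmd H Om).
Hypothesis hmodel : model P S.
Hypothesis hest : estimators P S.
Hypothesis hpath : pathwise_derivative S.
Hypothesis hloc : local_objects P S.
Hypothesis hID : ID S.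
Hypothesis hPEN : PEN S.
Hypothesis hCRIT : CRIT P S.
Hypothesis hLOC : LOC P S.

Local Notation E := ('cV[R]_(dth S) * H)%type.
Local Notation Pen := (@Pen _ _ _ _ S).
Local Notation lam := (@lam _ _ _ _ S).
Local Notation M0 := (@M0 _ _ _ _ S).
Local Notation Aos := (@Aos _ _ _ _ S).
Local Notation kn := (@kn _ _ _ _ S).
Local Notation delta := (@delta _ _ _ _ S).
Local Notation dbar := (@dbar _ _ _ _ S).
Local Notation ahat := (@ahat_at _ _ _ _ S).
Local Notation Qn n w := (Qhat (sample S n w)).
Implicit Types a b : E.

Lemma delta_gt0 n : 0 < delta n.
Proof. by have [_ [[_ _ [/(_ n)/andP[]]]]] := hloc. Qed.

Lemma delta_cvg0 : delta n @[n --> \oo] --> 0.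
Proof. by have [_ [[_ _ [_ h] _ _] _]] := hloc. Qed.

(** For lam n = 0, the strict penalty bound at [Pia0] would read 0 < 0. Positivity allows dividing
    lam out of the penalty constraints. *)
Lemma lam_gt0 n : 0 < lam n.
Proof.
have [_ _ _ [_ [_ [/(_ n) l0 _]]] _] := hest.
have [_ [[/(_ n)[_ h] _ _ _ _] _]] := hloc.
rewrite lt_neqAle l0 andbT; move: h; rewrite /lpen; apply: contraTneq => <-.
by rewrite mul0e mul0r ltxx.
Qed.

Lemma lpen_lt n a : (lpen n a < (lam n * M0)%:E)%E = (Pen a.2 < M0%:E)%E.
Proof. by rewrite /lpen EFinM lte_pmul2l// lte_fin lam_gt0. Qed.

Lemma lpen_le n a : (lpen n a <= (lam n * M0)%:E)%E = (Pen a.2 <= M0%:E)%E.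
Proof. by rewrite /lpen EFinM lee_pmul2l// lte_fin lam_gt0. Qed.

Lemma lpen_ge0 n a : (0 <= lpen n a)%E.
Proof.
have [_ _ _ [p0 _] _] := hest.
by rewrite mule_ge0 ?p0// lee_fin ltW// lam_gt0.
Qed.

Lemma Pia0_pen n : (Pen (Pia0 S n).2 < M0%:E)%E.
Proof. by have [_ [[/(_ n)[_ h] _ _ _ _] _]] := hloc; rewrite -(lpen_lt n). Qed.

Lemma Pia0_Ak n : Ak (kn n) (Pia0 S n).
Proof. by have [_ [[/(_ n)[[h _] _] _ _ _ _] _]] := hloc. Qed.

Lemma Aos_neighbourhood : exists2 r : R, 0 < r & forall a, Aspace a ->
  (Pen a.2 < M0%:E)%E -> snorm (a - alpha0 S) < r -> Aos a.
Proof.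
have [[M00 _ _ _ [r r0 h]] _] := hloc.
exists (Num.min r M0) => [|a aA aP]; first by rewrite lt_min r0.
rewrite lt_min => /andP[ar aM]; apply: h => //; split=> // n.
by rewrite lpen_lt.
Qed.

Lemma Pia0_cvg : snorm (Pia0 S n - alpha0 S) @[n --> \oo] --> 0.
Proof.
have [_ [_ _ _ _ h] _ _] := hID.
rewrite (_ : (fun n => _) = (fun n => `|PiH0 S n - h0 S|))//.
apply/funext => n; rewrite /snorm /=; have -> : theta0 S - theta0 S = 0 by exact: subrr.
by rewrite enorm0 add0r.
Qed.

Lemma Pia0_Aosk : \forall n \near \oo, Aosk (kn n) (Pia0 S n).
Proof.
have [r r0 h] := Aos_neighbourhood.
move/cvgrPdist_lt : Pia0_cvg => /(_ r r0); apply: filterS => n.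
rewrite sub0r normrN ger0_norm ?snorm_ge0// => hn; split; last exact: Pia0_Ak.
by apply: h hn; [have [] := Pia0_Ak n|exact: Pia0_pen].
Qed.

Let max_le (e : nat -> R) : n%:R * e n @[n --> \oo] --> 0 -> \forall n \near \oo,
  [/\ (Q (Pia0 S n) <= (delta n ^+ 2)%:E)%E, lam n <= delta n ^+ 2 & e n <= delta n ^+ 2].
Proof.
have [_ _ [_ h] _] := hLOC; move=> /h; apply: filterS => n /eqP.
rewrite eq_le => /andP[+ _]; rewrite !ge_max => /andP[/andP[_ ->] /andP[]].
by rewrite !lee_fin => -> ->.
Qed.

Lemma Q_lam_le : \forall n \near \oo,
  (Q (Pia0 S n) <= (delta n ^+ 2)%:E)%E /\ lam n <= delta n ^+ 2.
Proof.
have : n%:R * (fun=> 0 : R) n @[n --> \oo] --> (0 : R).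
  by under eq_fun do rewrite mulr0; exact: cvg_cst.
by move=> /max_le; apply: filterS => n [].
Qed.

(** [LOC] lets delta^2 dominate every sequence of order o(1/n), which forces n delta^2 to be bounded
    below. *)
Lemma delta_rate : exists2 kap : R, 0 < kap &
  \forall n \near \oo, kap <= n%:R * delta n ^+ 2.
Proof.
apply: rate_lower_bound => [|e he]; first exact: delta_gt0.
by apply: filterS (max_le he) => n [].
Qed.

(* The terms of order o_P(1/n) are absorbed since 1/n = O(delta^2). *)
Lemma minimum_bound : exists2 c : R, 0 < c & exists2 B : nat -> set Om, vanish P B &
  \forall n \near \oo, forall w, ~ B n w ->
    Qn n w (ahat n w) <= c * delta n ^+ 2.
Proof.
have [[c0 c00 [r hr hQ]] _] := hCRIT.
have [_ _ _ _ [eta heta hmin]] := hest.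
have [kap kap0 hkap] := delta_rate.
have [[M00 _ _ _ _] _] := hloc.
pose B n := [set w | 1 * n%:R^-1 < `|r n w| ] `|` [set w | 1 * n%:R^-1 < `|eta n w| ].
exists (c0 + M0 + 2 / kap).
  by rewrite addr_gt0 ?addr_gt0// divr_gt0.
exists B.
  by apply: vanishU; [apply: (proj1 (oP_vanish _ _ _) hr)|apply: (proj1 (oP_vanish _ _ _) heta)].
near=> n => w nB.
have n0 : (0 < n)%N by near: n; exact: nbhs_infty_gt.
have nR0 : 0 < n%:R :> R by rewrite ltr0n.
have [Qd ld] : (Q (Pia0 S n) <= (delta n ^+ 2)%:E)%E /\ lam n <= delta n ^+ 2.
  by near: n; exact: Q_lam_le.
have kd : kap <= n%:R * delta n ^+ 2 by near: n.
have rn : r n w <= n%:R^-1.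
  rewrite (le_trans (ler_norm _))// leNgt; apply/negP => h; apply: nB; left.
  by rewrite /= mul1r.
have en : eta n w <= n%:R^-1.
  rewrite (le_trans (ler_norm _))// leNgt; apply/negP => h; apply: nB; right.
  by rewrite /= mul1r.
have inv : n%:R^-1 <= kap^-1 * delta n ^+ 2.
  by rewrite ler_pdivlMl// ler_pdivrMr// mulrC.
have [_ /(_ _ (Pia0_Ak n)) hm] := hmin n w.
have : ((Qn n w (ahat n w))%:E <= (c0 * delta n ^+ 2 + r n w + lam n * M0 + eta n w)%:E)%E.
  apply: (@le_trans _ _ ((Qn n w (ahat n w))%:E + lpen n (ahat n w))%E).
    by rewrite leeDl// lpen_ge0.
  apply: le_trans hm _; rewrite !EFinD leeD2r// leeD//.
    apply: le_trans (hQ n w) _; rewrite leeD2r// EFinM lee_pmul2l//.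
  by rewrite lpen_le ltW// Pia0_pen.
rewrite lee_fin => /le_trans; apply.
have : lam n * M0 <= delta n ^+ 2 * M0 by rewrite ler_wpM2r// ltW.
rewrite (_ : (c0 + M0 + 2 / kap) * _ = c0 * delta n ^+ 2 + delta n ^+ 2 * M0 +
  2 * (kap^-1 * delta n ^+ 2)); last by ring.
set x := kap^-1 * _ in inv *; lra.
Unshelve. all: by end_near.
Qed.

Lemma good_ahat : vanish P (fun n => ~` [set w | AkM0 n (ahat n w) /\
  (Pen (ahat n w).2 < M0%:E)%E]).
Proof.
have [_ [[_ h _ _ _] _]] := hloc; apply: vanish_sub (proj1 (vanishP _ _) h) _.
by apply: nearW => n w /=; apply: contra_not => -[h1]; rewrite lpen_lt.
Qed.

(** The lower bound on the criterion with rate [dbar] turns near-minimality into a bound on Q at the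
    estimator that tends to 0, while its penalty is below M0; [Q_separates] concludes. *)
Lemma consistency (e : R) : 0 < e -> vanish P (fun n =>
  [set w | ~ snorm (ahat n w - alpha0 S) < e]).
Proof.
move=> e0; have [_ [c c0 [r hr hQ]]] := hCRIT.
have [c1 c10 [B vB hB]] := minimum_bound.
have [y y0 hy] := Q_separates hmodel hID hPEN M0 e0.
apply: vanish_tight => eps eps0; have [C hC] := hr eps eps0.
exists (fun n => [set w | C * dbar n ^+ 2 < `|r n w| ]) => //.
apply: (vanish_sub (vanishU vB good_ahat)).
have [_ [[_ _ _ [_ dbar0] _] _]] := hloc.
have small : c1 * delta n ^+ 2 + C * dbar n ^+ 2 @[n --> \oo] --> (c1 * 0 ^+ 2 + C * 0 ^+ 2).
  apply: cvgD; apply: cvgM; try exact: cvg_cst.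
    by rewrite expr2; under eq_fun do rewrite expr2; apply: cvgM; exact: delta_cvg0.
  by rewrite expr2; under eq_fun do rewrite expr2; apply: cvgM.
rewrite expr0n !mulr0 addr0 in small.
near=> n => w /= [nse nr].
apply: contrapT => /not_orP[nB /contrapT[hA hP]]; apply: nse.
have rC : r n w <= C * dbar n ^+ 2.
  by rewrite (le_trans (ler_norm _))// leNgt; exact/negP.
have hn : c1 * delta n ^+ 2 + C * dbar n ^+ 2 <= c * y.
  near: n; move/cvgrPdist_le : small => /(_ (c * y) (mulr_gt0 c0 y0)).
  by apply: filterS => n; rewrite sub0r normrN; exact: le_trans (ler_norm _).
have Qb : Qn n w (ahat n w) <= c1 * delta n ^+ 2.
  by move: w nB {nr hA hP rC}; near: n.
apply: hy; [by have [[]] := hA|exact: ltW|].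
rewrite -(@lee_pmul2l _ c%:E)// -EFinM.
have := hQ n w _ hA; rewrite leeBlDr// -EFinD => /le_trans; apply.
rewrite lee_fin; lra.
Unshelve. all: by end_near.
Qed.

Lemma ahat_Aosk : vanish P (fun n => [set w | ~ Aosk (kn n) (ahat n w)]).
Proof.
have [r r0 hA] := Aos_neighbourhood.
apply: (vanish_sub (vanishU good_ahat (consistency r0))); apply: nearW => n w /= nA.
apply: contrapT => /not_orP[/contrapT[[hk _] hP] /contrapT hs]; apply: nA.
by split=> //; apply: hA => //; case: hk.
Qed.

Lemma rate_ahat (e : R) : 0 < e -> exists2 C : R, 0 < C & \forall n \near \oo,
  ((P^* [set w | ~ (Aosk (kn n) (ahat n w) /\
     nrm (ahat n w - alpha0 S) <= C * delta n)%R])%mu <= e%:E)%E.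
Proof.
move=> e0; have [_ [c1 [c2 [c10 c20 hQn]]] [[c c0 [r hr hQ]] _] _] := hLOC.
have [c3 c30 [B vB hB]] := minimum_bound.
have [C hC] := hr (e / 2) (divr_gt0 e0 (ltr0n R 2)).
(* From c c1 nrm^2 <= c Q <= Qhat + |C| delta^2 <= (c3 + |C|) delta^2; A + 1 is then used as a bound
   for the square root of A. *)
pose A := (c3 + `|C|) / (c * c1).
have A0 : 0 <= A by rewrite divr_ge0 ?addr_ge0 ?mulr_ge0 ?(ltW c30) ?(ltW c0) ?(ltW c10).
exists (A + 1); first by rewrite ltr_wpDl.
have vn : vanish P (fun n => B n `|` [set w | ~ Aosk (kn n) (ahat n w)]).
  by apply: vanishU vB _; exact: ahat_Aosk.
have hv := vn (e / 2) (divr_gt0 e0 (ltr0n R 2)).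
near=> n.
apply: (@le_trans _ _ ((P^* (B n `|` [set w | ~ Aosk (kn n) (ahat n w)]))%mu +
   (P^* [set w | C * delta n ^+ 2 < `|r n w| ]%R)%mu)%E); last first.
  rewrite (splitr e) EFinD leeD//; near: n; [exact: hv|exact: hC].
apply: le_trans (oprobU _ _ _); apply: oprob_le => w /=; apply: contra_notP.
move=> /not_orP[/not_orP[nB /contrapT hA] nr]; split=> //.
have Qb : Qn n w (ahat n w) <= c3 * delta n ^+ 2.
  by move: w nB {nr hA}; near: n.
have rC : r n w <= `|C| * delta n ^+ 2.
  rewrite (le_trans (ler_norm _))// (@le_trans _ _ (C * delta n ^+ 2))//.
    by rewrite leNgt; exact/negP.
  by rewrite ler_wpM2r ?sqr_ge0// ler_norm.
have [hAos _] := hA; have /andP[qn _] := hQn _ hAos.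
have := hQ n w _ hA; rewrite leeBlDr// -EFinD => qh.
have : (c%:E * (c1 * nrm (ahat n w - alpha0 S) ^+ 2)%:E <=
    (Qn n w (ahat n w) + r n w)%:E)%E.
  by apply: le_trans qh; rewrite lee_pmul2l.
rewrite -EFinM lee_fin => h.
have h2 : nrm (ahat n w - alpha0 S) ^+ 2 <= A * delta n ^+ 2.
  rewrite /A mulrAC ler_pdivlMr ?mulr_gt0// mulrC -mulrA; lra.
have Cd0 : 0 <= (A + 1) * delta n by rewrite mulr_ge0 ?addr_ge0// ltW// delta_gt0.
rewrite -(@ler_pXn2r _ 2)// ?nnegrE ?nrm_ge0//.
rewrite (le_trans h2)// exprMn ler_wpM2r ?sqr_ge0//; nra.
Unshelve. all: by end_near.
Qed.

End Localization.

Section Spans.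
Context {R : realType} {E : lmodType R}.

Lemma lspan_diff (A : set E) u v : A u -> A v -> lspan A (u - v).
Proof.
move=> Au Av; exists 2%N, (fun i => if i == ord0 then 1 else -1),
  (fun i => if i == ord0 then u else v); split.
  by move=> i; case: ifP.
by rewrite !big_ord_recl big_ord0 /= addr0 scale1r scaleN1r.
Qed.

Lemma lspan_in (A : set E) u : A u -> lspan A u.
Proof.
move=> Au; exists 1%N, (fun=> 1), (fun=> u); split=> //.
by rewrite big_ord_recl big_ord0 addr0 scale1r.
Qed.

End Spans.

(** * From the rate in [nrm] to the neighbourhood [Nosn] *)

Section ConvergenceRate.
Context {R : realType} {H : completeNormedModType R}.
Context {dO : measure_display} {Om : measurableType dO}.
Variables (P : probability Om R) (S : psmd H Om).
Hypothesis hmodel : model P S.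
Hypothesis hest : estimators P S.
Hypothesis hpath : pathwise_derivative S.
Hypothesis hloc : local_objects P S.
Hypothesis hID : ID S.
Hypothesis hPEN : PEN S.
Hypothesis hCRIT : CRIT P S.
Hypothesis hLOC : LOC P S.
Hypothesis hVPHI : VPHI S.

Local Notation E := ('cV[R]_(dth S) * H)%type.
Local Notation kn := (@kn _ _ _ _ S).
Local Notation delta := (@delta _ _ _ _ S).
Local Notation ahat := (@ahat_at _ _ _ _ S).
Local Notation alpha0k := (@alpha0k _ _ _ _ S).
Implicit Types a b : E.

Lemma nrm0 : nrm (S := S) 0 = 0.
Proof. by rewrite /nrm (inner0l hmodel hpath) sqrtr0. Qed.

Lemma sub_nclosure (W : set E) : W `<=` nclosure (S := S) W.
Proof. by move=> v Wv e e0; exists v => //; rewrite subrr nrm0. Qed.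

Lemma Vbark_diff k a b : Aosk k a -> Aosk k b -> Vbark (S := S) k (a - b).
Proof.
move=> ha hb; apply: sub_nclosure.
rewrite (_ : a - b = (a - alpha0k k) - (b - alpha0k k)).
  by apply: lspan_diff; [exists a|exists b].
by rewrite opprB addrA subrK.
Qed.

Lemma tau_ge0 n : 0 <= tau S n.
Proof.
have [[x rx]|h] := pselect (ratios S n !=set0); last first.
  by rewrite /tau sup_out// => -[].
have [_ [[_ _ _ _ [/(_ n) ub _]] _]] := hloc.
apply: (@le_trans _ _ x); last exact: ub_le_sup.
by case: rx => a _ <-; rewrite divr_ge0 ?snorm_ge0 ?nrm_ge0.
Qed.

Lemma nrm_Vbark_eq0 k v : Vbark (S := S) k v -> nrm v = 0 -> v = 0.
Proof.
by move=> vV /(nrm_eq0 hmodel) v0; have [_ [_ _ h _] _ _ _] := hVPHI; exact: h vV v0.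
Qed.

(** The ratios defining [tau] leave out differences of zero [nrm]; these lie in [Vbark], where [nrm]
    is definite, and so vanish. *)
Lemma snorm_le_tau n a : Aosk (kn n) (Pia0 S n) -> Aosk (kn n) a ->
  snorm (a - Pia0 S n) <= tau S n * nrm (a - Pia0 S n).
Proof.
move=> hP ha; have [h|h] := eqVneq (nrm (a - Pia0 S n)) 0.
  rewrite (nrm_Vbark_eq0 (Vbark_diff ha hP) h) nrm0 mulr0.
  by rewrite /snorm /= enorm0 normr0 addr0.
have [_ [[_ _ _ _ [/(_ n) ub _]] _]] := hloc.
rewrite -ler_pdivrMr; last by rewrite lt_neqAle eq_sym h nrm_ge0.
by apply: ub_le_sup => //; exists a.
Qed.

Lemma deltas_ge0 n : 0 <= deltas S n.
Proof.
by rewrite addr_ge0 ?snorm_ge0// mulr_ge0 ?tau_ge0// ltW// (delta_gt0 hloc).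
Qed.

(* If [deltas n = 0], the local sieve reduces to [alpha0], so that the space
   [Vbark (kn n)] is trivial; but its dimension is of order [kn n]. *)
Lemma deltas_gt0 : \forall n \near \oo, 0 < deltas S n.
Proof.
have [_ [_ [proj [D [hD [c1 [c2 [c10 c20 hk]]]]]]]] := hloc.
have [_ _ _ [_ [k_oo _]] _] := hest.
have k_pos : \forall n \near \oo, (0 < kn n)%N.
  by apply: (k_oo [set m | (0 < m)%N]); exact: nbhs_infty_gt.
have hPi := Pia0_Aosk hest hloc hID.
near=> n.
have kn0 : (0 < kn n)%N by near: n.
have /andP[kD _] : c1 * (kn n)%:R <= (D n)%:R <= c2 * (kn n)%:R by near: n.
have [dimV _] : has_dim (Vbark (S := S) (kn n)) (D n) /\ has_dim (lspan (Ak (S := S) (kn n))) (D n).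
  by near: n.
have hP : Aosk (kn n) (Pia0 S n) by near: n.
have D0 : (0 < D n)%N.
  by rewrite -(ltr_nat R) (lt_le_trans _ kD)// mulr_gt0// ltr0n.
rewrite lt_neqAle deltas_ge0 andbT eq_sym; apply/negP => /eqP d0.
have d1 := delta_gt0 hloc n.
have t0 := tau_ge0 n; have td := mulr_ge0 t0 (ltW d1).
have s0 := snorm_ge0 (alpha0 S - Pia0 S n).
have sP : snorm (alpha0 S - Pia0 S n) = 0 by move: d0; rewrite /deltas; lra.
have tau0 : tau S n = 0.
  apply/eqP; have /eqP : tau S n * delta n = 0 by move: d0; rewrite /deltas; lra.
  by rewrite mulf_eq0 (gt_eqF d1) orbF.
have Pa : Pia0 S n = alpha0 S by apply/esym/subr0_eq; exact: snorm_eq0.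
have single a : Aosk (kn n) a -> a = alpha0 S.
  move=> /(snorm_le_tau hP); rewrite tau0 mul0r Pa => h.
  apply: subr0_eq; apply: snorm_eq0; apply/eqP.
  by rewrite eq_le h snorm_ge0.
(* Now [alpha0] equals [Pia0 n], a point of the sieve, so its best approximation is at distance
   0. *)
have nk : nrm (alpha0 S - alpha0k (kn n)) = 0.
  have [_ /(_ (alpha0 S))] := proj (kn n); rewrite subrr nrm0 => h.
  rewrite (nrmB hmodel hpath); apply/eqP; rewrite eq_le nrm_ge0 andbT; apply: h.
  by rewrite -Pa; case: hP => _ [].
have V0 v : Vbark (S := S) (kn n) v -> v = 0.
  move=> vV; apply: (nrm_Vbark_eq0 vV); apply/eqP; rewrite eq_le nrm_ge0 andbT.
  apply/ler_addgt0Pr => e e0; rewrite add0r.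
  have [u [N [c [s [sA ->]]]] vu] := vV e e0.
  have sE i : s i = alpha0 S - alpha0k (kn n).
    by have [a /single -> <-] := sA i.
  rewrite (_ : v = (v - \sum_(i < N) c i *: s i) + \sum_(i < N) c i *: s i); last by rewrite subrK.
  rewrite (le_trans (nrmD hmodel hpath _ _))//.
  rewrite [X in _ + nrm X](_ : _ = (\sum_(i < N) c i) *: (alpha0 S - alpha0k (kn n))).
    by rewrite (nrmZ hmodel hpath) nk mulr0 addr0 ltW.
  by rewrite scaler_suml; apply: eq_bigr => i _; rewrite sE.
have [b [bfree bV]] := dimV.
have b0 i : b i = 0.
  apply: V0; rewrite bV; exists (fun j => (j == i)%:R) => //.
  rewrite (bigD1 i)//= eqxx scale1r big1 ?addr0// => j /negbTE->.
  by rewrite scale0r.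
have /(_ _ (Ordinal D0))/eqP := bfree (fun=> 1) _.
rewrite oner_eq0 => /(_ _) h.
have : false by apply: h; rewrite big1// => i _; rewrite b0 scaler0.
by [].
Unshelve. all: by end_near.
Qed.

(** Positivity of [deltas] matters: the inverse of 0 is 0, and the second term of the minimum would
    then be ln 1 = 0. *)
Lemma Mn_cvgy (A : R) : \forall n \near \oo, A <= Mn S n.
Proof.
have [_ [[_ _ _ _ [_ /cvgrPdist_le dc]] _]] := hloc.
have hd := deltas_gt0.
near=> n.
have d0 : 0 < deltas S n by near: n.
rewrite /Mn le_min; apply/andP; split.
  have nA : expR (expR A) <= n.+1%:R.
    rewrite (@le_trans _ _ n%:R)// ?ler_nat//; near: n; exact: nbhs_infty_ger.
  have e1 : expR A <= ln n.+1%:R.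
    by rewrite -[leLHS]expRK ler_ln// ?posrE ?expR_gt0// ltr0n.
  rewrite -[leLHS]expRK ler_ln ?posrE ?expR_gt0//.
  by rewrite (lt_le_trans _ e1)// expR_gt0.
rewrite -[leLHS]expRK ler_ln ?posrE ?expR_gt0//; last by rewrite addr_gt0// invr_gt0.
rewrite (@le_trans _ _ (deltas S n)^-1)//; last by rewrite lerDl.
rewrite -[leLHS]invrK lef_pV2 ?posrE ?invr_gt0 ?expR_gt0//.
near: n; apply: filterS (dc (expR A)^-1 _) => [n|]; last by rewrite invr_gt0 expR_gt0.
by rewrite sub0r normrN; exact: le_trans (ler_norm _).
Unshelve. all: by end_near.
Qed.

(** Estimator and [Pia0] are within C delta and B delta of [alpha0], so their difference is at most
    tau (C + B) delta in [snorm]; eventually [Mn] exceeds C + B + 1. *)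
Lemma ahat_Nosn : vanish P (fun n => [set w | ~ Nosn n (ahat n w)]).
Proof.
move=> e e0.
have [C C0 hC] := rate_ahat hmodel hest hloc hID hPEN hCRIT hLOC e0.
have [_ [c1 [c2 [c10 c20 hQn]]] _ _] := hLOC.
(* An upper bound for the square root of 1 / c1, from c1 nrm^2 <= Q <= delta^2 at [Pia0]. *)
pose B := c1^-1 + 1.
have B0 : 0 < B by rewrite addr_gt0// invr_gt0.
have hM := Mn_cvgy (C + B + 1).
have hPi := Pia0_Aosk hest hloc hID.
have hQl := Q_lam_le hLOC.
near=> n.
have hP : Aosk (kn n) (Pia0 S n) by near: n.
have [Qd _] : (Q (Pia0 S n) <= (delta n ^+ 2)%:E)%E /\ lam S n <= delta n ^+ 2 by near: n.
have Mn0 : C + B + 1 <= Mn S n by near: n.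
have d0 := delta_gt0 hloc n.
have nP : nrm (Pia0 S n - alpha0 S) <= B * delta n.
  have Bd0 : 0 <= B * delta n by rewrite mulr_ge0// ltW.
  have [hA _] := hP; have /andP[qn _] := hQn _ hA.
  have := le_trans qn Qd; rewrite lee_fin => h.
  rewrite -(@ler_pXn2r _ 2)// ?nnegrE ?nrm_ge0//.
  have h1 : nrm (Pia0 S n - alpha0 S) ^+ 2 <= c1^-1 * delta n ^+ 2.
    by rewrite ler_pdivlMl.
  rewrite (le_trans h1)// exprMn ler_wpM2r ?sqr_ge0// /B.
  have : 0 < c1^-1 by rewrite invr_gt0.
  set x := c1^-1 => x0; nra.
apply: le_trans (_ : (P^* [set w | ~ (Aosk (kn n) (ahat n w) /\
     nrm (ahat n w - alpha0 S) <= C * delta n)%R])%mu <= _)%E; last by near: n.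
apply: oprob_le => w /=; apply: contra_not => -[hA hn].
have [hAos hAk] := hA.
split=> //; split.
- by case: hAk.
- rewrite (le_trans hn)// ler_wpM2r ?(ltW d0)//; lra.
- have h1 : snorm (ahat n w - alpha0 S) <=
      tau S n * nrm (ahat n w - Pia0 S n) + snorm (alpha0 S - Pia0 S n).
    rewrite (snormB (alpha0 S)) (_ : ahat n w - alpha0 S =
      (ahat n w - Pia0 S n) + (Pia0 S n - alpha0 S)); last by rewrite addrA subrK.
    by rewrite (le_trans (snormD _ _))// lerD2r snorm_le_tau.
  have h2 : nrm (ahat n w - Pia0 S n) <= (C + B) * delta n.
    rewrite (_ : ahat n w - Pia0 S n = (ahat n w - alpha0 S) + (alpha0 S - Pia0 S n)).
      rewrite (le_trans (nrmD hmodel hpath _ _))// mulrDl lerD//.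
      by rewrite (nrmB hmodel hpath).
    by rewrite addrA subrK.
  have t0 := tau_ge0 n; have td := mulr_ge0 t0 (ltW d0).
  have s0 := snorm_ge0 (alpha0 S - Pia0 S n).
  apply: (@le_trans _ _ ((C + B + 1) * deltas S n)); last by rewrite ler_wpM2r ?deltas_ge0.
  apply: le_trans h1 _; rewrite /deltas.
  have h3 := ler_wpM2l t0 h2.
  have CB : 0 <= C + B by rewrite addr_ge0 ?ltW.
  have := mulr_ge0 CB s0; move: h3.
  set x := snorm _; set y := tau S n * (_ * _); set v := tau S n * nrm _.
  have -> : y = (C + B) * (tau S n * delta n) by rewrite /y; ring.
  set u := tau S n * delta n in td *; nra.
- have [[_ _ _ hG _] _] := hloc.
  by have [_ _ /(_ n)/ltW] := hG _ hAos.
Unshelve. all: by end_near.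
Qed.

End ConvergenceRate.

(** * Expansion of the Wald statistic *)

(** Stated with a sum because the vectors to be compared, built from [phi] and from [Zn], are nearly
    opposite. *)
Lemma enorm_dist_le {R : realType} n (f g : 'cV[R]_n) :
  `|enorm f - enorm g| <= enorm (f + g).
Proof.
have h (u v : 'cV[R]_n) : enorm u <= enorm (u + v) + enorm v.
  by rewrite -{1}[u](addrK v) (le_trans (enormD _ _))// enormN.
have := h f g; have := h g f; rewrite (addrC g).
by rewrite ler_norml => *; apply/andP; split; lra.
Qed.

Section WaldExpansion.
Context {R : realType} {H : completeNormedModType R}.
Context {dO : measure_display} {Om : measurableType dO}.
Variables (P : probability Om R) (S : psmd H Om).
Hypothesis hmodel : model P S.
Hypothesis hest : estimators P S.
Hypothesis hpath : pathwise_derivative S.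
Hypothesis hloc : local_objects P S.
Hypothesis hfun : functional_objects S.
Hypothesis hID : ID S.
Hypothesis hPEN : PEN S.
Hypothesis hCRIT : CRIT P S.
Hypothesis hLOC : LOC P S.
Hypothesis hpert : LOC_perturbed S.
Hypothesis hVPHI : VPHI S.
Hypothesis hVLQA : VLQA P S.

Local Notation E := ('cV[R]_(dth S) * H)%type.
Local Notation Pen := (@Pen _ _ _ _ S).
Local Notation kn := (@kn _ _ _ _ S).
Local Notation ahat := (@ahat_at _ _ _ _ S).
Local Notation alpha0k := (@alpha0k _ _ _ _ S).
Local Notation dn := (@dn _ _ _ _ S).
Local Notation Qn n w := (Qhat (sample S n w)).
Implicit Types a b : E.

Let hOmis n : is_inv_sqrt (Omega S n) (Omis S n).
Proof. by have [[_ _ _ /(_ n)]] := hfun. Qed.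

Lemma Hk_linear k (c : R) (u v : H) : Hk S k u -> Hk S k v -> Hk S k (c *: u + v).
Proof.
move=> [b _ <-] [b' _ <-]; exists (fun j => c * b j + b' j) => //.
rewrite scaler_sumr -big_split; apply: eq_bigr => j _ /=.
by rewrite scalerDl scalerA.
Qed.

(** The minimization runs over a linear space, the first component being unrestricted; perturbing by
    t w with t of either sign kills the linear term. *)
Lemma projection_orth k (w : E) : Hk S k w.2 -> inner (alpha0k k - alpha0 S) w = 0.
Proof.
move=> hw; have [_ [_ [/(_ k)[ha hmin] _]]] := hloc.
set x := alpha0k k - alpha0 S.
have hx t : nrm x <= nrm (t *: w + x).
  by rewrite /x addrA; apply: hmin; exact: Hk_linear.
clearbody x.
have : inner x w ^+ 2 <= 0 * inner w w.
  apply: nonneg_quadratic => [|t]; first exact: (inner_ge0 hmodel).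
  have := hx t.
  rewrite -(@ler_pXn2r _ 2)// ?nnegrE ?nrm_ge0// !(nrm_sqr hmodel).
  rewrite (inner_linear hmodel hpath) !(innerDr hmodel hpath)
    !(innerZr hmodel hpath) (innerC hmodel w x).
  by move=> h; rewrite -subr_ge0 in h; move: h; congr (_ <= _); ring.
by rewrite mul0r => h; apply/eqP; rewrite -sqrf_eq0 eq_le h sqr_ge0.
Qed.

Lemma Vbark_orth k (v : E) : Vbark (S := S) k v -> inner (alpha0k k - alpha0 S) v = 0.
Proof.
move=> vV; have [_ [_ [/(_ k)[hk _] _]]] := hloc.
set x := alpha0k k - alpha0 S.
apply: (@eq0_of_small _ _ (nrm x)) => e e0 _.
have [u [N [c [s [sA ->]]]] vu] := vV e e0.
have u0 : inner x (\sum_(i < N) c i *: s i) = 0.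
  elim/big_ind: _ => [|y z hy hz|i _].
  - by rewrite (innerC hmodel) (inner0l hmodel hpath).
  - by rewrite (innerDr hmodel hpath) hy hz addr0.
  - rewrite (innerZr hmodel hpath) projection_orth ?mulr0//.
    have [a [_ [_ ha]] <-] := sA i; rewrite addrC -scaleN1r.
    exact: Hk_linear.
rewrite -[v](subrK (\sum_(i < N) c i *: s i)) (innerDr hmodel hpath) u0 addr0.
by rewrite (le_trans (inner_le_nrm hmodel hpath _ _))// ler_wpM2l ?nrm_ge0// ltW.
Qed.

(** The representers act on a - alpha0k; since alpha0k - alpha0 is orthogonal to [Vbark], the inner
    product may be taken with a - alpha0, leaving only the approximation bias. *)
Lemma dphiv_decomp n a : Aosk (kn n) a -> dphiv n (a - alpha0 S) =
  innerv n (a - alpha0 S) + dphiv n (alpha0k (kn n) - alpha0 S).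
Proof.
move=> ha; have [[_ hd hv _ _] _] := hfun.
apply/colP => j; rewrite !mxE.
have [_ lin _] := hd n j; have [vV /(_ (a - alpha0k (kn n))) rep] := hv n j.
have E1 : a - alpha0 S = 1 *: (a - alpha0k (kn n)) + (alpha0k (kn n) - alpha0 S).
  by rewrite scale1r addrA subrK.
rewrite E1 lin mul1r rep; last first.
  by apply: (sub_nclosure hmodel hpath); apply: lspan_in; exists a.
rewrite (innerDr hmodel hpath (1 *: _)) scale1r
  (innerC hmodel _ (alpha0k (kn n) - alpha0 S)).
by rewrite (Vbark_orth vV) addr0.
Qed.

Let V n w : 'cV[R]_(dn n) :=
  Omis S n *m (Zn S n w + innerv n (ahat n w - alpha0 S)).

Lemma shift_at0 n a : shift_at a (0 : 'cV[R]_(dn n)) = a.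
Proof.
rewrite /shift_at big1 ?addr0// => j _; by rewrite mulmx0 mxE scale0r.
Qed.

(** The expansion of [phi] is used at t = 0, which lies in [Tn] once [Mn] is nonnegative; the bias
    term is of order cn as well. *)
Lemma phiv_expansion : exists2 C : R, 0 < C & \forall n \near \oo, forall a,
  Nosn n a -> Aosk (kn n) a ->
  enorm (Omis S n *m (phiv n a - phiv n (alpha0 S) - innerv n (a - alpha0 S))) <= C * cn S n.
Proof.
have [_ _ [C1 h1] [C2 h2] _] := hVPHI.
have hM := Mn_cvgy hmodel hest hpath hloc hID hVPHI 0.
have [[_ _ _ _ pos] _] := hfun.
exists (`|C1| + `|C2| + 1); first by rewrite ltr_wpDl// addr_ge0.
apply: filterS3 h1 h2 hM => n g1 e2 M0 a ha hA.
have c0 : 0 < cn S n by have [] := pos n.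
have T0 : Tn (0 : 'cV[R]_(dn n)).
  by rewrite /Tn /= enorm0 mulr_ge0 ?sqrtr_ge0// mulr_ge0// invr_ge0 sqrtr_ge0.
have := g1 a 0 ha T0; rewrite shift_at0 => e1.
rewrite (_ : _ - innerv n _ = (phiv n a - phiv n (alpha0 S) - dphiv n (a - alpha0 S)) +
   dphiv n (alpha0k (kn n) - alpha0 S)); last first.
  by rewrite (dphiv_decomp hA) opprD addrA subrK.
rewrite mulmxDr (le_trans (enormD _ _))// (le_trans (lerD e1 e2))//.
rewrite -mulrDl ler_wpM2r ?(ltW c0)//.
have := ler_norm C1; have := ler_norm C2; lra.
Qed.

Let pen_gap n a (t : 'cV[R]_(dn n)) : \bar R := (`|Pen (shift_at a t).2 - Pen a.2|)%E.

Lemma penalty_increment (e : R) : 0 < e -> \forall n \near \oo,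
  forall a (t : 'cV[R]_(dn n)), Nosn n a -> Tn t ->
  ((n%:R * lam S n)%:E * pen_gap a t <= e%:E)%E.
Proof.
move=> e0; have /fine_cvgP[fin_sup /cvgrPdist_le/(_ e e0) small] := hpert.
apply: filterS2 fin_sup small => n fn sn a t ha ht.
have nl0 : 0 <= n%:R * lam S n by rewrite mulr_ge0// ltW// (lam_gt0 hest hloc).
have : (pen_gap a t <= ereal_sup [set (`|Pen (shift_at at_.1 at_.2).2 - Pen at_.1.2|)%E |
        at_ in Nosn n `*` @Tn _ _ _ _ S n])%E.
  by apply: ereal_sup_ubound; exists (a, t).
move=> /(@lee_wpmul2l _ (n%:R * lam S n)%:E _) => h.
apply: le_trans (h _) _; first by rewrite lee_fin.
rewrite -(fineK fn) lee_fin; move: sn; rewrite sub0r normrN.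
exact: le_trans (ler_norm _).
Qed.

Section Direction.
Variables (n : nat) (w : Om) (s CB CG ep : R).
Hypotheses (n0 : (0 < n)%N) (s0 : 0 < s) (Vp : 0 < enorm (V n w)).
Hypothesis hN : Nosn n (ahat n w).
Hypothesis sT : s <= Mn S n * (Num.sqrt n%:R)^-1 * Num.sqrt (dn n)%:R.
Hypothesis penP : forall a (t : 'cV[R]_(dn n)), Nosn n a -> Tn t ->
  ((n%:R * lam S n)%:E * pen_gap a t <= ep%:E)%E.
Variable eta : R.
Hypothesis eta_small : n%:R * eta <= ep.
Hypothesis minP : forall a, Ak (kn n) a ->
  ((Qn n w (ahat n w))%:E + lpen n (ahat n w) <= (Qn n w a)%:E + lpen n a + eta%:E)%E.
Hypothesis opB : opnorm (BB (sample S n w)) <= CB.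
Let rem : R := Num.max (Num.max (s ^+ 2 * bn S n) (s * an S n)) (sn S n).
Hypothesis gapP : forall a (t : 'cV[R]_(dn n)), Nosn n a -> Tn t -> enorm t = s ->
  `|2^-1 * (Qn n w (shift_at a t) - Qn n w a)
    - (t^T *m Omis S n *m (Zn S n w + innerv n (a - alpha0 S))) ord0 ord0
    - 2^-1 * qform t (BB (sample S n w)) t| <= CG * rem.

(* Compare [ahat] with its perturbation by [t = - s V / |V|]. *)
Lemma direction_bound : s * enorm (V n w) <= CG * rem + 2^-1 * (CB * s ^+ 2) + ep / n%:R.
Proof.
have nR0 : 0 < n%:R :> R by rewrite ltr0n.
have V0 : enorm (V n w) != 0 by rewrite gt_eqF.
pose t : 'cV[R]_(dn n) := (- (s / enorm (V n w))) *: V n w.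
have ts : enorm t = s.
  rewrite /t enormZ normrN ger0_norm; last by rewrite divr_ge0// ltW.
  by rewrite divfK.
have tT : Tn t by rewrite /Tn /= ts.
have tV : (t^T *m Omis S n *m (Zn S n w + innerv n (ahat n w - alpha0 S))) ord0 ord0 =
    - (s * enorm (V n w)).
  rewrite -mulmxA dotE -/(V n w) /t dotZl -enorm_sqr; field; exact: V0.
have := gapP hN tT ts; rewrite tV => hg.
have hk : Ak (kn n) (shift_at (ahat n w) t).
  by have [h _ _ _ _] := hVLQA; exact: h.
have nl0 : 0 < n%:R * lam S n by rewrite mulr_gt0// (lam_gt0 hest hloc).
have hmin := minP hk; have hpen := penP hN tT.
have qb : qform t (BB (sample S n w)) t <= CB * s ^+ 2.
  by rewrite (le_trans (qform_le_opnorm _ _))// ts ler_wpM2r ?sqr_ge0.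
have Pf : Pen (ahat n w).2 \is a fin_num.
  have [[_ _ _ hp] _] := hN.
  have [_ _ _ [p0 _] _] := hest.
  rewrite ge0_fin_numE ?p0//; move: hp; rewrite (lpen_le hest hloc) => hp.
  exact: le_lt_trans hp (ltry _).
(* An infinite penalty at the perturbed point would make the penalty increment infinite, against
   [penP]. *)
have Pf' : Pen (shift_at (ahat n w) t).2 \is a fin_num.
  have [_ _ _ [p0 _] _] := hest.
  rewrite ge0_fin_numE ?p0// ltey; apply: contraTneq hpen => h.
  rewrite /pen_gap h -(fineK Pf) /= gt0_muley ?lte_fin// -ltNge; exact: ltry.
move: hmin hpen; rewrite /pen_gap /lpen -(fineK Pf) -(fineK Pf').
set p := fine _; set p' := fine _.
rewrite -EFinB abse_EFin -!EFinM -!EFinD !lee_fin => hmin hpen.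
(* One ep / n comes from the minimization error, the other from the penalty. *)
have dQ : Qn n w (ahat n w) - Qn n w (shift_at (ahat n w) t) <= 2 * (ep / n%:R).
  have : n%:R * (eta + lam S n * (p' - p)) <= 2 * ep.
    have h2 : n%:R * lam S n * (p' - p) <= ep.
      by apply: le_trans hpen; rewrite ler_wpM2l ?ler_norm// ltW.
    rewrite (_ : n%:R * _ = n%:R * eta + n%:R * lam S n * (p' - p)); last by ring.
    by rewrite (le_trans (lerD eta_small h2))// -[ep + ep]mulr2n mulr_natl.
  rewrite -ler_pdivlMl// => h; have := hmin.
  rewrite (_ : 2 * (ep / n%:R) = n%:R^-1 * (2 * ep)); last by ring.
  move: h; rewrite mulrBr; lra.
move: hg; rewrite ler_norml => /andP[_ hg]; lra.
Qed.

End Direction.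

(** For d = 0 the set [Tn] has radius 0 and allows no perturbation, so that case is excluded
    here. *)
Lemma deviation_small (e : R) : 0 < e ->
  vanish P (fun n => [set w | (0 < dn n)%N /\ e < Num.sqrt n%:R * enorm (V n w)]).
Proof.
move=> e0; have [hshift hgap _ hB [hs hb ha]] := hVLQA.
have [_ _ _ _ [eta heta hmin]] := hest.
apply: vanish_tight => eps eps0.
have eps2 : 0 < eps / 2 by rewrite divr_gt0.
have [CG hCG] := hgap _ eps2; have [CB hCB] := hB _ eps2.
pose B n := [set w | CB * 1 < `|opnorm (BB (sample S n w))| ] `|`
  [set w | exists a (t : 'cV[R]_(dn n)), [/\ Nosn n a, Tn t &
    CG < (Num.max (Num.max (enorm t ^+ 2 * bn S n) (enorm t * an S n)) (sn S n))^-1 *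
    `|2^-1 * (Qn n w (shift_at a t) - Qn n w a)
    - (t^T *m Omis S n *m (Zn S n w + innerv n (a - alpha0 S))) ord0 ord0
    - 2^-1 * qform t (BB (sample S n w)) t|]].
exists B.
  apply: filterS2 hCG hCB => n h1 h2; apply: le_trans (oprobU _ _ _) _.
  by rewrite (splitr eps) EFinD leeD.
pose b0 := `|CB| + 1; pose g0 := `|CG| + 1.
have b00 : 0 < b0 by rewrite ltr_wpDl.
have g00 : 0 < g0 by rewrite ltr_wpDl.
(* With s = tt / sqrt n, the quadratic term contributes b0 tt^2 / 2 = tt e / 4 = ep after
   multiplication by n. The three terms of [direction_bound] total at most 3 ep, below the tt e that
   a deviation larger than e would give. *)
pose tt := e / (2 * b0).
have tt0 : 0 < tt by rewrite divr_gt0// mulr_gt0.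
pose ep := tt * e / 4.
have ep0 : 0 < ep by rewrite divr_gt0// mulr_gt0.
have veta : vanish P (fun n => [set w | ep * n%:R^-1 < `|eta n w| ]).
  exact: (proj1 (oP_vanish _ _ _) heta).
have vN := ahat_Nosn hmodel hest hpath hloc hID hPEN hCRIT hLOC hVPHI.
apply: (vanish_sub (vanishU veta vN)).
have small (x : nat -> R) k : 0 <= k -> x n @[n --> \oo] --> 0 ->
    \forall n \near \oo, k * x n <= ep.
  move=> k0 /cvgrPdist_le/(_ (ep / (k + 1))); rewrite divr_gt0 ?ltr_wpDl// => /(_ isT).
  apply: filterS => n; rewrite sub0r normrN => h.
  have k1 : 0 < k + 1 by rewrite ltr_wpDl.
  move: h; rewrite ler_pdivlMr// => h.
  apply: le_trans h; rewrite mulrC; have := ler_norm (x n); have := normr_ge0 (x n).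
  set y := `|x n|; nra.
have sb := small _ (g0 * tt ^+ 2) _ hb; have {}sb := sb (mulr_ge0 (ltW g00) (sqr_ge0 _)).
have sa := small _ (g0 * tt) _ ha; have {}sa := sa (mulr_ge0 (ltW g00) (ltW tt0)).
have ss := small _ g0 (ltW g00) hs.
have hM := Mn_cvgy hmodel hest hpath hloc hID hVPHI tt.
have hpen := penalty_increment ep0.
near=> n => w /= [[d0 Ve] nB]; apply: contrapT => /not_orP[neta /contrapT hN].
have n0 : (0 < n)%N by near: n; exact: nbhs_infty_gt.
have nR0 : 0 < n%:R :> R by rewrite ltr0n.
have q0 : 0 < Num.sqrt n%:R :> R by rewrite sqrtr_gt0.
have q2 : Num.sqrt n%:R ^+ 2 = n%:R :> R by rewrite sqr_sqrtr.
have dR1 : 1 <= (dn n)%:R :> R by rewrite ler1n.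
have sd1 : 1 <= Num.sqrt (dn n)%:R :> R by rewrite -{1}sqrtr1 ler_wsqrtr.
have [[_ _ _ _ /(_ n)[an0 bn0 _ sn0]] _] := hfun.
pose s := tt / Num.sqrt n%:R.
have s0 : 0 < s by rewrite divr_gt0.
have s2 : s ^+ 2 * n%:R = tt ^+ 2 by rewrite expr_div_n q2 divfK// gt_eqF.
have Vp : 0 < enorm (V n w).
  by rewrite -(pmulr_rgt0 _ q0) (lt_trans e0).
have sT : s <= Mn S n * (Num.sqrt n%:R)^-1 * Num.sqrt (dn n)%:R.
  have ttM : tt <= Mn S n by near: n.
  rewrite /s [leRHS]mulrAC ler_wpM2r ?invr_ge0 ?(ltW q0)//.
  by rewrite (le_trans ttM)// ler_peMr// (le_trans _ ttM)// ltW.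
have penP : forall a (t : 'cV[R]_(dn n)), Nosn n a -> Tn t ->
  ((n%:R * lam S n)%:E * pen_gap a t <= ep%:E)%E by near: n.
have eta_small : n%:R * eta n w <= ep.
  rewrite -ler_pdivlMl// mulrC (le_trans (ler_norm _))// leNgt; exact/negP.
have opB : opnorm (BB (sample S n w)) <= b0.
  rewrite (le_trans (ler_norm _))// (@le_trans _ _ CB)//.
    rewrite leNgt; apply/negP => h; apply: nB; left; by rewrite /= mulr1.
  by rewrite /b0 (le_trans (ler_norm _))// lerDl.
pose rem : R := Num.max (Num.max (s ^+ 2 * bn S n) (s * an S n)) (sn S n).
have rem0 : 0 < rem by rewrite lt_max sn0 orbT.
have gapP : forall a (t : 'cV[R]_(dn n)), Nosn n a -> Tn t -> enorm t = s ->
  `|2^-1 * (Qn n w (shift_at a t) - Qn n w a)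
    - (t^T *m Omis S n *m (Zn S n w + innerv n (a - alpha0 S))) ord0 ord0
    - 2^-1 * qform t (BB (sample S n w)) t| <= g0 * rem.
  move=> a t ha' ht ts; rewrite leNgt; apply/negP => h; apply: nB; right.
  exists a, t; split=> //; rewrite ts -/rem -(ltr_pM2l rem0) mulVKf ?gt_eqF//.
  apply: le_lt_trans h; rewrite mulrC ler_wpM2r ?(ltW rem0)// /g0.
  by rewrite (le_trans (ler_norm _))// lerDl.
have := direction_bound n0 s0 Vp hN sT penP eta_small (proj2 (hmin n w)) opB gapP.
rewrite -/rem => hbound.
(* Each of the three rates required by [VLQA] handles one term of the maximum, up to factors sqrt d
   >= 1 or d >= 1. *)
have remP : n%:R * (g0 * rem) <= ep.
  have hb' : g0 * tt ^+ 2 * (bn S n * Num.sqrt (dn n)%:R) <= ep by near: n.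
  have ha' : g0 * tt * (Num.sqrt (n%:R * (dn n)%:R) * an S n) <= ep by near: n.
  have hs' : g0 * (sn S n * n%:R * (dn n)%:R) <= ep by near: n.
  have ng0 : 0 < n%:R * g0 by rewrite mulr_gt0.
  rewrite mulrA -ler_pdivlMl// !ge_max !ler_pdivlMl//; apply/andP; split; first (apply/andP; split).
  - apply: le_trans hb'.
    rewrite (_ : _ * (s ^+ 2 * _) = g0 * (s ^+ 2 * n%:R) * bn S n); last by ring.
    by rewrite s2 [leRHS]mulrA ler_peMr//
      (mulr_ge0 (mulr_ge0 (ltW g00) (sqr_ge0 tt)) (ltW bn0)).
  - apply: le_trans ha'; rewrite sqrtrM//.
    rewrite (_ : _ * (s * _) = g0 * tt * (Num.sqrt n%:R * an S n)); last first.
      by rewrite -{1}q2 /s; field; rewrite gt_eqF.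
    apply: (ler_wpM2l (mulr_ge0 (ltW g00) (ltW tt0))).
    by rewrite [leRHS]mulrAC ler_peMr// (mulr_ge0 (ltW q0) (ltW an0)).
  - apply: le_trans hs'.
    rewrite (_ : n%:R * g0 * sn S n = g0 * (sn S n * n%:R)); last by ring.
    by rewrite ler_wpM2l ?(ltW g00)// ler_peMr// mulr_ge0 ?(ltW sn0).
have : n%:R * (s * enorm (V n w)) <= ep + ep + ep.
  apply: le_trans (ler_wpM2l (ltW nR0) hbound) _.
  rewrite !mulrDr lerD//; last by rewrite mulrCA divff ?mulr1// gt_eqF.
  rewrite lerD// [leLHS](_ : _ = 2^-1 * b0 * (s ^+ 2 * n%:R)); last by ring.
  by rewrite s2 /ep le_eqVlt; apply/orP; left; apply/eqP; rewrite /tt; field; rewrite gt_eqF.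
have -> : n%:R * (s * enorm (V n w)) = tt * (Num.sqrt n%:R * enorm (V n w)).
  by rewrite -{1}q2 /s; field; rewrite gt_eqF.
have := ltr_pM2l tt0 e (Num.sqrt n%:R * enorm (V n w)); rewrite Ve.
move=> h1 h2; have : tt * e < ep + ep + ep by rewrite (lt_le_trans _ h2)// h1.
have : 0 < tt * e by rewrite mulr_gt0.
rewrite /ep; lra.
Unshelve. all: by end_near.
Qed.

Lemma sqr_diff_le (x y z : R) : 0 <= x -> 0 <= y -> `|x - y| <= z ->
  `|x ^+ 2 - y ^+ 2| <= z ^+ 2 + 2 * z * y.
Proof.
move=> x0 y0; rewrite subr_sqr normrM (ger0_norm (addr_ge0 x0 y0)).
rewrite ler_norml => /andP[h1 h2].
have z0 : 0 <= z by lra.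
have : `|x - y| <= z by rewrite ler_norml h1.
have := normr_ge0 (x - y); set u := `|x - y|; nra.
Qed.

(** The two lengths differ by o_P(1), and the length of the standardized score is O_P(sqrt d); the
    difference of squares is therefore o_P(sqrt d). *)
Theorem wald_expansion : oP P (fun n w => wald S n w -
    n%:R * qform (Zn S n w) (invmx (Omega S n)) (Zn S n w))
  (fun n => Num.sqrt (dn n)%:R).
Proof.
apply/oP_vanish => e e0; apply: vanish_tight => eps eps0.
have [C [C0 hC]] := std_sum_tight hmodel hpath hOmis eps0.
exists (fun n => [set w | C * Num.sqrt (dn n)%:R < enorm (std_sum S n w)]).
  by apply: nearW => n; exact: hC.
(* The squares differ by at most 4 eta^2 + 4 eta |g| <= 4 eta (C + 1) sqrt d, because eta <= 1 <=
   sqrt d. *)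
pose eta := Num.min 1 (e / (8 * (C + 1))).
have C10 : 0 < C + 1 by rewrite addr_gt0.
have eta0 : 0 < eta by rewrite lt_min ltr01 divr_gt0// mulr_gt0.
have eta1 : eta <= 1 by rewrite ge_min lexx.
have etae : eta * (8 * (C + 1)) <= e.
  by rewrite -ler_pdivlMr ?mulr_gt0// ge_min lexx orbT.
have [K K0 hK] := phiv_expansion.
have vN := ahat_Nosn hmodel hest hpath hloc hID hPEN hCRIT hLOC hVPHI.
have vA := ahat_Aosk hmodel hest hloc hID hPEN hCRIT hLOC.
apply: (vanish_sub (vanishU (deviation_small eta0) (vanishU vN vA))).
have [_ _ _ _ hc] := hVPHI.
have hcn : \forall n \near \oo, K * (Num.sqrt n%:R * cn S n) <= eta.
  move/cvgrPdist_le : hc => /(_ (eta / K)); rewrite divr_gt0// => /(_ isT).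
  apply: filterS => n; rewrite sub0r normrN => h.
  by rewrite mulrC -ler_pdivlMr// (le_trans (ler_norm _)).
near=> n => w /= [hw nC]; apply: contrapT => /not_orP[nV /not_orP[/contrapT hN /contrapT hA]].
have q0 : 0 <= Num.sqrt n%:R :> R by exact: sqrtr_ge0.
pose D := phiv n (ahat n w) - phiv n (alpha0 S).
have wE : wald S n w = enorm (Num.sqrt n%:R *: (Omis S n *m D)) ^+ 2.
  rewrite /wald (qform_inv_sqrt _ (hOmis n)) enormZ exprMn (ger0_norm q0).
  by congr (_ * _); rewrite sqr_sqrtr.
rewrite wE (std_sum_sqr hOmis) in hw.
have [d0|d0] := eqVneq (dn n) 0%N.
  move: hw; rewrite !(enorm_dim0 _ d0) subrr normr0 ltNge => /negP; apply.
  by rewrite mulr_ge0 ?sqrtr_ge0// ltW.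
rewrite -lt0n in d0.
have Vn : Num.sqrt n%:R * enorm (V n w) <= eta.
  by rewrite leNgt; apply/negP => h; exact: nV.
set f := Num.sqrt n%:R *: (Omis S n *m D) in hw *; set g := std_sum S n w in hw nC *.
have hfg : `|enorm f - enorm g| <= 2 * eta.
  have fg : enorm (f + g) <= 2 * eta.
    rewrite (_ : f + g = Num.sqrt n%:R *: (Omis S n *m (D - innerv n (ahat n w - alpha0 S)))
       + Num.sqrt n%:R *: V n w); last first.
      rewrite /f /g /std_sum /V -!scalerDr -!mulmxDr; congr (_ *: (_ *m _)).
      by rewrite [Zn _ _ _ + _]addrC addrA subrK.
    rewrite (le_trans (enormD _ _))// !enormZ (ger0_norm q0).
    have h1 : enorm (Omis S n *m (D - innerv n (ahat n w - alpha0 S))) <= K * cn S n.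
      move: hN hA; rewrite /D; move: (ahat n w); near: n; exact: hK.
    have h2 := ler_wpM2l q0 h1.
    have h3 : K * (Num.sqrt n%:R * cn S n) <= eta by near: n.
    rewrite mulrCA in h2; have := le_trans h2 h3; lra.
  exact: le_trans (enorm_dist_le f g) fg.
have gC : enorm g <= C * Num.sqrt (dn n)%:R by rewrite leNgt; exact/negP.
have sd1 : 1 <= Num.sqrt (dn n)%:R :> R by rewrite -{1}sqrtr1 ler_wsqrtr// ler1n.
have := sqr_diff_le (enorm_ge0 f) (enorm_ge0 g) hfg; move/(lt_le_trans hw).
set r := Num.sqrt _ in sd1 gC *; set y := enorm g in gC *.
rewrite ltNge => /negP; apply.
have y1 : 4 * eta * y <= 4 * eta * (C * r) by rewrite ler_wpM2l ?mulr_ge0// ltW.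
have e2 : eta ^+ 2 <= eta * r.
  by rewrite expr2 ler_wpM2l ?(ltW eta0)// (le_trans eta1).
have : (eta * (8 * (C + 1))) * r <= e * r by rewrite ler_wpM2r// (le_trans ler01).
have er0 : 0 <= eta * r by rewrite mulr_ge0 ?(ltW eta0)// (le_trans ler01).
have Cer0 : 0 <= C * (eta * r) by rewrite mulr_ge0 ?(ltW C0).
move: y1 e2; rewrite exprMn; set u := eta ^+ 2.
move=> y1 e2 h; lra.
Unshelve. all: by end_near.
Qed.

End WaldExpansion.

(** * The limit laws of the Wald statistic *)

Lemma dot_castmx {R : realType} m n (e : m = n) (v : 'cV[R]_m) :
  dot (castmx (e, erefl 1%N) v) (castmx (e, erefl 1%N) v) = dot v v.
Proof. by case: n / e; rewrite castmx_id. Qed.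

Lemma dot_self_continuous {R : realType} n : continuous (fun v : 'cV[R]_n => dot v v).
Proof.
apply: continuous_big => [|i _ v]; first exact: add_continuous.
have ci : {for v, continuous (fun x : 'cV[R]_n => x i ord0)}.
  exact: (@coord_continuous R n 1 i ord0).
exact: (cvgM ci ci).
Qed.

Theorem theoremA5 (R : realType) (H : completeNormedModType R)
    (dO : measure_display) (Om : measurableType dO) (P : probability Om R)
    (S : psmd H Om) :
  model P S -> estimators P S -> pathwise_derivative S -> local_objects P S ->
  functional_objects S ->
  ID S -> PEN S -> CRIT P S -> LOC P S -> LOC_perturbed S -> VPHI S ->
  VLQA P S ->
  [/\ oP P (fun n w => wald S n w -
                       n%:R * qform (Zn S n w) (invmx (Omega S n)) (Zn S n w))
        (fun n => Num.sqrt (dn S n)%:R),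
      (forall (d : nat) (hd : forall n, dn S n = d),
         cvg_in_law P (fun n w => castmx (hd n, erefl 1%N)
             (Num.sqrt n%:R *: (Omis S n *m Zn S n w)))
           (@gauss_law R d) ->
         cvg_in_law P (wald S) (@chi2_law R d)) &
      (dn S n @[n --> \oo] --> \oo ->
       ((dn S n)%:R%:E * mu3 S n * ((Num.sqrt n%:R)^-1)%:E)%E
         @[n --> \oo] --> 0%E ->
       cvg_in_law P
         (fun n w => (wald S n w - (dn S n)%:R) / Num.sqrt (2 * (dn S n)%:R))
         (@normal_law R))].
Proof.
move=> hmodel hest hpath hloc hfun hID hPEN hCRIT hLOC hpert hVPHI hVLQA.
have hOmis n : is_inv_sqrt (Omega S n) (Omis S n) by have [[_ _ _ /(_ n)]] := hfun.
have expansion := wald_expansion hmodel hest hpath hloc hfun hID hPEN hCRIT hLOC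
  hpert hVPHI hVLQA.
have small (e : R) : 0 < e -> vanish P (fun n => [set w |
    e * Num.sqrt (dn S n)%:R < `|wald S n w - enorm (std_sum S n w) ^+ 2| ]).
  move=> e0; apply: vanish_sub (proj1 (oP_vanish _ _ _) expansion e e0) _.
  by apply: nearW => n w /=; rewrite (std_sum_sqr hOmis).
split=> //.
(* Convergence of the vector is tested on v |-> f (v.v); the cast to dimension d leaves v.v
   unchanged. *)
- move=> d hd hcvg.
  apply: (@slutsky _ _ _ P _ _ (gauss d)
    (fun x : d.-tuple (measurableTypeR R) => \sum_(i < d) (tnth x i : R) ^+ 2) _
    (fun n w => enorm (std_sum S n w) ^+ 2)).
  + apply: measurable_sum => i; apply: measurable_funX; exact: measurable_tnth.
  + move=> e e0; have d1 : 0 < Num.sqrt d%:R + 1 :> R by rewrite ltr_wpDl ?sqrtr_ge0.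
    apply: vanish_sub (small (e / (Num.sqrt d%:R + 1)) (divr_gt0 e0 d1)) _.
    apply: nearW => n w /=; apply: le_lt_trans; rewrite hd.
    by rewrite mulrAC ler_pdivrMr// ler_wpM2l ?(ltW e0)// lerDl.
  + move=> f cf fb.
    have := hcvg (fun v => f (dot v v)) _ _.
    rewrite (_ : gauss_law _ = law_of (gauss d) (fun x : d.-tuple (measurableTypeR R) =>
      \sum_(i < d) (tnth x i : R) ^+ 2) f); last first.
      apply: eq_integral => x _; congr ((f _)%:E).
      by apply: eq_bigr => i _; rewrite !mxE expr2.
    rewrite (_ : (fun n => _) = (fun n => outer_expectation P
      (fun w => f (enorm (std_sum S n w) ^+ 2)))); last first.
      apply/funext => n; congr outer_expectation; apply/funext => w.
      by rewrite dot_castmx enorm_sqr.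
    apply.
      move=> v; apply: (@continuous_comp _ _ _ (fun v : 'cV[R]_d => dot v v) f).
        exact: dot_self_continuous.
      exact: cf.
    by case: fb => C fC; exists C.
- move=> d_oo m3.
  apply: (@slutsky _ _ _ P _ _ (normal_prob (0 : R) 1) id _
    (fun n w => (enorm (std_sum S n w) ^+ 2 - (dn S n)%:R) / Num.sqrt (2 * (dn S n)%:R))).
  + by [].
  + move=> e e0; apply: vanish_sub (small e e0) _; apply: nearW => n w /=.
    rewrite -mulrBl opprB addrA subrK normrM normfV (ger0_norm (sqrtr_ge0 _)).
    move: `|_| => y; have [d0|d0] := eqVneq (dn S n) 0%N.
      (* For d = 0 the division by sqrt 0 gives 0. *)
      by rewrite d0 mulr0 sqrtr0 invr0 mulr0 ltNge (ltW e0).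
    have dp : 0 < (dn S n)%:R :> R by rewrite ltr0n lt0n.
    rewrite ltr_pdivlMr ?sqrtr_gt0 ?mulr_gt0//; apply: le_lt_trans.
    by rewrite ler_wpM2l ?(ltW e0)// ler_wsqrtr// ler_peMl ?(ltW dp)// ler1n.
  + exact: std_sum_normal_limit.
Qed.
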